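(* Let $(R,\mathfrak m)$ be a Noetherian local ring of dimension $d\ge1$ with infinite residue field and $\operatorname{depth}R\ge d-1$, and let $I$ be an $\mathfrak m$-primary ideal. Let $x_1,\dots,x_d$ be a superficial sequence of $I$ such that $Q=(x_1,\dots,x_d)$ is a minimal reduction of $I$. Assume that $x_1,\dots,x_{d-1}$ is a regular sequence in $R$, and set $R_{d-1}=R/(x_1,\dots,x_{d-1})$, $I_{d-1}=IR_{d-1}$, $Q_{d-1}=QR_{d-1}$. Then the following hold: (i) $\displaystyle\sum_{n\ge1}\lambda\bigl(I_{d-1}^{n+1}/Q_{d-1}I_{d-1}^n\bigr)\le\mathrm g_s(I)-\mathrm g_s(Q)-(e_0(I)-e_1(Q))e_1(Q)$. Further, equality holds if and only if $R$ is Cohen-Macaulay. (ii) If $\operatorname{depth}G(I)\ge d-1$, then $r_Q(I)\le\mathrm g_s(I)-\mathrm g_s(Q)-(e_0(I)-e_1(Q))e_1(Q)+1$.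
   Context: $\lambda(-)$ denotes length. For an $\mathfrak m$-primary ideal $J$ of a $d$-dimensional Noetherian local ring $R$, the Hilbert coefficients $e_0(J),\dots,e_d(J)$ are the integers with $\lambda(R/J^n)=\sum_{i=0}^d(-1)^ie_i(J)\binom{n+d-1-i}{d-i}$ for all $n\gg0$. The sectional genus is $\mathrm g_s(J)=\lambda(R/J)-e_0(J)+e_1(J)$. $G(I)=\bigoplus_{n\ge0}I^n/I^{n+1}$, with depth taken with respect to its unique maximal homogeneous ideal. An ideal $Q\subseteq I$ is a reduction of $I$ if $QI^n=I^{n+1}$ for some $n$; a minimal reduction is one minimal under inclusion among reductions of $I$. The reduction number is $r_Q(I)=\min\{n:QI^n=I^{n+1}\}$. An element $x\in I\setminus I^2$ is superficial for $I$ if there is $c>0$ with $(I^{n+1}:x)\cap I^c=I^n$ for all $n\ge c$; $x_1,\dots,x_j$ is a superficial sequence of $I$ if $x_1$ is superficial for $I$ and the image of $x_i$ is superficial for the image of $I$ in $R/(x_1,\dots,x_{i-1})$ for $2\le i\le j$. *)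

(* Defs.v *)
From HB Require Import structures.
From mathcomp Require Import all_boot all_order all_algebra.
From mathcomp Require Import generic_quotient.
From mathcomp Require Import boolp classical_sets functions cardinality.
From mathcomp Require Import constructive_ereal.

Set Implicit Arguments.
Unset Strict Implicit.
Unset Printing Implicit Defensive.

Import GRing.Theory.
Local Open Scope classical_set_scope.
Local Open Scope quotient_scope.
Local Open Scope ring_scope.

(* Ideals are arbitrary (possibly improper) [Prop]-valued ideals; the ideals of
   [ring_quotient] are proper, which excludes quotients equal to the zero
   ring. *)
Record ideal (R : comPzRingType) := Ideal {
  ideal_set :> R -> Prop;
  ideal0 : ideal_set 0;
  idealD : forall x y, ideal_set x -> ideal_set y -> ideal_set (x + y);
  idealM : forall a x, ideal_set x -> ideal_set (a * x) }.

Notation "J %:I" := (ideal_set J : set _) (at level 2, format "J %:I").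

Section IdealOperations.
Variable R : comPzRingType.
Implicit Types (A : set R) (I J : ideal R).

Lemma idealB J x y : J x -> J y -> J (x - y).
Proof. by move=> Jx Jy; apply: idealD => //; rewrite -mulN1r; apply: idealM. Qed.

Lemma ideal_sum J (T : Type) (r : seq T) (P : pred T) (F : T -> R) :
  (forall i, P i -> J (F i)) -> J (\sum_(i <- r | P i) F i).
Proof. by move=> h; elim/big_ind: _ => //; [exact: ideal0 | exact: idealD]. Qed.

Definition generated A : ideal R.
Proof.
exists (fun x => forall J, A `<=` J%:I -> J x).
- by move=> J _; apply: ideal0.
- by move=> x y hx hy J hJ; apply: idealD; [apply: hx | apply: hy].
- by move=> a x hx J hJ; apply: idealM; apply: hx.
Defined.

Lemma sub_generated A : A `<=` (generated A)%:I.
Proof. by move=> x Ax J; apply. Qed.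

Definition generated_by (s : seq R) : ideal R := generated [set x | x \in s].

Definition ideal_mul I J : ideal R :=
  generated [set z | exists x y, [/\ I x, J y & z = x * y]].

Definition unit_ideal : ideal R :=
  @Ideal R (fun=> True) Logic.I (fun _ _ _ _ => Logic.I) (fun _ _ _ => Logic.I).

Definition ideal_exp I (n : nat) : ideal R := iter n (ideal_mul I) unit_ideal.

Lemma ideal_expM I m n x y :
  ideal_exp I m x -> ideal_exp I n y -> ideal_exp I (m + n) (x * y).
Proof.
elim: m x => [|m IHm] x /= Ix Iy; first by apply: idealM.
pose K : set R := fun a => ideal_exp I (m.+1 + n) (a * y).
have K0 : K 0 by rewrite /K mul0r; apply: ideal0.
have KD a b : K a -> K b -> K (a + b).
  by rewrite /K mulrDl; apply: idealD.
have KM c a : K a -> K (c * a) by rewrite /K -mulrA; apply: idealM.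
apply: (Ix (Ideal K0 KD KM)) => _ [a [b [Ia Ib ->]]] /=.
rewrite /K -mulrA; apply: sub_generated; exists a, (b * y); split=> //.
exact: IHm.
Qed.

Definition prime_ideal J : Prop :=
  ~ J 1 /\ forall x y, J (x * y) -> J x \/ J y.

Definition maximal_ideal J : Prop :=
  ~ J 1 /\ forall J', ~ J' 1 -> J%:I `<=` J'%:I -> J'%:I = J%:I.

Definition radical J : set R := [set x | exists n, J (x ^+ n)].

Definition primary_ideal J : Prop :=
  ~ J 1 /\ forall x y, J (x * y) -> J x \/ exists n, J (y ^+ n).

Definition is_primary_to (m J : ideal R) : Prop :=
  primary_ideal J /\ radical J = m%:I.

Definition reduction (Q I : ideal R) : Prop :=
  Q%:I `<=` I%:I /\
  exists n, (ideal_mul Q (ideal_exp I n))%:I = (ideal_exp I n.+1)%:I.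

Definition minimal_reduction (Q I : ideal R) : Prop :=
  reduction Q I /\
  forall Q', reduction Q' I -> Q'%:I `<=` Q%:I -> Q'%:I = Q%:I.

Definition is_reduction_number (Q I : ideal R) (r : nat) : Prop :=
  (ideal_mul Q (ideal_exp I r))%:I = (ideal_exp I r.+1)%:I /\
  forall n, (ideal_mul Q (ideal_exp I n))%:I = (ideal_exp I n.+1)%:I ->
    (r <= n)%N.

Definition superficial I (x : R) : Prop :=
  [/\ I x, ~ ideal_exp I 2 x &
    exists c, (0 < c)%N /\ forall n, (c <= n)%N ->
      [set a | ideal_exp I n.+1 (a * x)] `&` (ideal_exp I c)%:I
        = (ideal_exp I n)%:I].

Definition nonzerodivisor (x : R) : Prop := forall y, x * y = 0 -> y = 0.

Definition strict_chain (P : set (ideal R)) (n : nat) : Prop :=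
  exists J : nat -> ideal R,
    (forall i, (i <= n)%N -> P (J i)) /\
    (forall i, (i < n)%N -> (J i)%:I `<` (J i.+1)%:I).

Definition max_chain_length (P : set (ideal R)) (n : nat) : Prop :=
  strict_chain P n /\ forall k, strict_chain P k -> (k <= n)%N.

(* The length of the R-module N/L, for ideals L, N of R with L contained in N:
   the submodules of N/L are the J/L with L <= J <= N. *)
Definition length (N L : ideal R) : \bar int :=
  match pselect (exists n,
    max_chain_length [set J | L%:I `<=` J%:I /\ J%:I `<=` N%:I] n) with
  | left h => (Posz (projT1 (cid h)))%:E
  | right _ => +oo%E
  end.

Definition noetherian : Prop :=
  forall J, exists s : seq R, J%:I = (generated_by s)%:I.

Definition local_ring (m : ideal R) : Prop :=
  maximal_ideal m /\ forall J, maximal_ideal J -> J%:I = m%:I.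

Definition krull_dim (d : nat) : Prop := max_chain_length prime_ideal d.

End IdealOperations.

Arguments unit_ideal {R}.
Arguments noetherian : clear implicits.
Arguments krull_dim : clear implicits.

Notation "I *i J" := (ideal_mul I J) (at level 40, left associativity).
Notation "I ^i n" := (ideal_exp I n) (at level 30, right associativity).

Section QuotientRing.
Variables (R : comPzRingType) (J : ideal R).

Definition ideal_pred : {pred R} := fun x => `[< J x >].

Lemma ideal_predP x : reflect (J x) (x \in ideal_pred).
Proof. exact: asboolP. Qed.

Lemma ideal_pred_zmod_closed : zmod_closed ideal_pred.
Proof.
split=> [|x y /ideal_predP Jx /ideal_predP Jy]; apply/ideal_predP.
  exact: ideal0.
exact: idealB.
Qed.

HB.instance Definition _ :=
  GRing.isZmodClosed.Build R ideal_pred ideal_pred_zmod_closed.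

Definition quo_ring : Type := Quotient.quot ideal_pred.

HB.instance Definition _ := GRing.Zmodule.on quo_ring.

Definition quo_pi (x : R) : quo_ring := \pi_(Quotient.quot ideal_pred) x.
Definition quo_repr (x : quo_ring) : R := repr (x : Quotient.quot ideal_pred).

Lemma quo_piK x : quo_pi (quo_repr x) = x.
Proof. exact: reprK. Qed.

Lemma quo_piP x y : quo_pi x = quo_pi y <-> J (x - y).
Proof.
have E : (x - y \in ideal_pred) = (quo_pi x == quo_pi y).
  exact: Quotient.idealrBE.
split=> [/eqP|Jxy]; first by rewrite -E => /ideal_predP.
by apply/eqP; rewrite -E; apply/ideal_predP.
Qed.

Lemma quo_piD : {morph quo_pi : x y / x + y}.
Proof. exact: Quotient.pi_add. Qed.

Lemma quo_piB : {morph quo_pi : x y / x - y}.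
Proof.
move=> x y; rewrite quo_piD; congr (_ + _).
exact: Quotient.pi_opp.
Qed.

Definition quo_one : quo_ring := quo_pi 1.
Definition quo_mul (x y : quo_ring) : quo_ring :=
  quo_pi (quo_repr x * quo_repr y).

Lemma quo_piM x y : quo_mul (quo_pi x) (quo_pi y) = quo_pi (x * y).
Proof.
apply/quo_piP; set x' := quo_repr _; set y' := quo_repr _.
have hx : J (x' - x) by apply/quo_piP; rewrite quo_piK.
have hy : J (y' - y) by apply/quo_piP; rewrite quo_piK.
have -> : x' * y' - x * y = y' * (x' - x) + x * (y' - y).
  by rewrite !mulrBr [y' * x']mulrC [y' * x]mulrC addrA subrK.
by apply: idealD; apply: idealM.
Qed.

Lemma quo_mulA : associative quo_mul.
Proof.
by move=> x y z; rewrite -[x]quo_piK -[y]quo_piK -[z]quo_piK !quo_piM mulrA.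
Qed.

Lemma quo_mulC : commutative quo_mul.
Proof. by move=> x y; rewrite -[x]quo_piK -[y]quo_piK !quo_piM mulrC. Qed.

Lemma quo_mul1 : left_id quo_one quo_mul.
Proof. by move=> x; rewrite -[x]quo_piK quo_piM mul1r. Qed.

Lemma quo_mulDl : left_distributive quo_mul +%R.
Proof.
move=> x y z; rewrite -[x]quo_piK -[y]quo_piK -[z]quo_piK.
by rewrite -quo_piD !quo_piM -quo_piD mulrDl.
Qed.

HB.instance Definition _ := GRing.Zmodule_isComPzRing.Build quo_ring
  quo_mulA quo_mulC quo_mul1 quo_mulDl.

HB.instance Definition _ := GRing.isZmodMorphism.Build R quo_ring quo_pi
  quo_piB.

Lemma quo_pi_monoid_morphism : monoid_morphism quo_pi.
Proof. by split=> // x y; symmetry; exact: quo_piM. Qed.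

HB.instance Definition _ := GRing.isMonoidMorphism.Build R quo_ring quo_pi
  quo_pi_monoid_morphism.

(* The extension I(R/J) of an ideal I of R. *)
Definition quo_ideal (I : ideal R) : ideal quo_ring :=
  generated (quo_pi @` I%:I).

End QuotientRing.

Section Sequences.
Variable R : comPzRingType.

(* Both definitions test the i-th element (counted from 0) in the quotient by
   the preceding ones; for i = 0 this is the quotient by the zero ideal. *)
Definition regular_sequence (s : seq R) : Prop :=
  (forall i, (i < size s)%N ->
     nonzerodivisor (quo_pi (generated_by (take i s)) (nth 0 s i))) /\
  (1 : quo_ring (generated_by s)) <> 0.

Definition superficial_sequence (I : ideal R) (s : seq R) : Prop :=
  forall i, (i < size s)%N ->
    superficial (quo_ideal (generated_by (take i s)) I)
                (quo_pi (generated_by (take i s)) (nth 0 s i)).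

(* The depth of R with respect to M is the supremum of the lengths of the
   regular sequences of R contained in M. *)
Definition depth_ge (M : ideal R) (k : nat) : Prop :=
  exists s : seq R,
    [/\ regular_sequence s, forall x, x \in s -> M x & (k <= size s)%N].

Definition is_depth (M : ideal R) (k : nat) : Prop :=
  depth_ge M k /\ ~ depth_ge M k.+1.

Definition cohen_macaulay (m : ideal R) : Prop :=
  exists n, krull_dim R n /\ is_depth m n.

End Sequences.

(* G(I) is the ring of polynomials p over R with p`_n in I^n for all n (the
   Rees algebra of I) modulo the ideal of those with p`_n in I^(n+1) for all n,
   that is, the direct sum of the I^n / I^(n+1). *)
Section AssociatedGraded.
Variables (R : comNzRingType) (I : ideal R).

Definition rees_pred : {pred {poly R}} :=
  fun p => `[< forall n, (I ^i n) p`_n >].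

Lemma rees_predP (p : {poly R}) :
  reflect (forall n, (I ^i n) p`_n) (p \in rees_pred).
Proof. exact: asboolP. Qed.

Lemma rees_subring_closed : subring_closed rees_pred.
Proof.
split.
- apply/rees_predP => -[|n] //; rewrite coef1 mulr0n; apply: ideal0.
- move=> p q /rees_predP hp /rees_predP hq; apply/rees_predP => n.
  by rewrite coefB; apply: idealB.
- move=> p q /rees_predP hp /rees_predP hq; apply/rees_predP => n.
  rewrite coefM; apply: ideal_sum => i _.
  have := ideal_expM (hp i) (hq (n - i)%N); rewrite subnKC //.
  by rewrite -ltnS.
Qed.

HB.instance Definition _ :=
  GRing.isSubringClosed.Build {poly R} rees_pred rees_subring_closed.

Record rees := Rees { rees_poly :> {poly R}; _ : rees_poly \in rees_pred }.

HB.instance Definition _ := [isSub for rees_poly].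
HB.instance Definition _ := [Choice of rees by <:].
HB.instance Definition _ := [SubChoice_isSubComNzRing of rees by <:].

Definition rees_shift : ideal rees.
Proof.
exists (fun p : rees => forall n, (I ^i n.+1) (rees_poly p)`_n).
- by move=> n; rewrite coef0; apply: ideal0.
- by move=> p q hp hq n; rewrite coefD; apply: idealD.
- move=> p q hq n; rewrite coefM; apply: ideal_sum => i _.
  have /rees_predP hp := valP p.
  have := ideal_expM (hp i) (hq (n - i)%N); rewrite addnS subnKC //.
  by rewrite -ltnS.
Defined.

Definition assoc_graded : comPzRingType := quo_ring rees_shift.

(* For (R, m) local and I contained in m, the unique maximal homogeneous ideal
   of G(I), i.e. the direct sum of m/I and the I^n / I^(n+1) for n >= 1. *)
Definition graded_max (m : ideal R) : ideal assoc_graded :=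
  generated (quo_pi rees_shift @` [set p | m (rees_poly p)`_0]).

End AssociatedGraded.

Definition hilbert_coefs (R : comPzRingType) (d : nat) (J : ideal R)
    (e : nat -> int) : Prop :=
  exists n0, forall n, (n0 <= n)%N ->
    length unit_ideal (J ^i n) =
      (\sum_(i < d.+1) (-1) ^+ i * e i * ('C(n + d - 1 - i, d - i))%:Z)%:E.

(* [e] is meant to be the family of Hilbert coefficients of [J]. *)
Definition sectional_genus (R : comPzRingType) (J : ideal R) (e : nat -> int) :
    int :=
  fine (length unit_ideal J) - e 0%N + e 1%N.

(* Convergence of u 1 + u 2 + ... to the finite value S, in the discrete space
   of integers: the partial sums are eventually equal to S. *)
Definition series1_eq (u : nat -> \bar int) (S : int) : Prop :=
  exists n0, forall k, (n0 <= k)%N -> (\sum_(1 <= n < k) u n)%E = S%:E.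

(* Main.v *)
Require Import Defs.
From HB Require Import structures.
From mathcomp Require Import all_boot all_order all_algebra.
From mathcomp Require Import boolp classical_sets functions cardinality.
From mathcomp Require Import constructive_ereal.
From mathcomp Require Import ring zify.

(* Put a = (x_1, ..., x_(d-1)), y = x_d, e_i = e_i(I), t = - e_1(Q) and
   h(n) = l(R/(I^n + a)), so that e_0(Q) = e_0 and h(n) = e_0 n - e_1 for large
   n. Let s = l(R/Q) - e_0 be the length of (0 : y) in R/a, and s_n that of its
   intersection with I^n (R/a). The sum in (i) is
   h(1) - e_0 + e_1 + s_1 + s_2 + ..., and (i) says that
   s_0 + s_1 + ... <= t + (e_0 + t) t, with equality iff s = 0.

   As the x_i need not be superficial for Q, t may be smaller than the length
   of the torsion W of R/a. But
   - s <= t, and t = 0 if s = 0: compute l(R/Q^n) from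
     Q^(n+1) = a^(n+1) + y Q^n, where R/a^n is filtered by copies of R/a;
   - t >= e_0 m - e_1 - h(m) for all m: the layers of the filtration
     a^j Q^(n-j) of Q^n modulo I^(n+m), except the last, are generated by
     monomials killed by I^m + a, whence
     l(R/Q^n) >= l(R/I^(n+m)) - C(n+d-2, d-1) h(m) - O(n^(d-2)).
   For m >= e_0 - 1 one has I^(m+1) = y I^m modulo W, hence
   e_0 m - e_1 - h(m) = l(W n I^m), which is therefore at most t. As moreover
   W n I^(m+1) = I (W n I^m) for m >= e_0, these lengths decrease strictly to 0,
   and W n I^(e_0+t) = 0. So s_n <= s <= t, and s_n = 0 for n >= e_0 + t.

   In (ii), the initial forms of x_1, ..., x_(d-1) are a regular sequence of
   G(I): a failure of regularity of the highest possible degree would give a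
   socle element modulo the preceding ones, hence bound the depth of G(I). So
   a n I^(n+1) = a I^n, and every n with 1 <= n < r_Q(I) contributes at least 1
   to the sum in (i). *)

Set Implicit Arguments.
Unset Strict Implicit.
Unset Printing Implicit Defensive.

Import Order.TTheory GRing.Theory Num.Theory.
Local Open Scope classical_set_scope.
Local Open Scope ring_scope.

(** * Ideals *)

Arguments generated : simpl never.
Arguments generated_by : simpl never.
Arguments ideal_mul : simpl never.
Arguments ideal_exp : simpl never.

(** All modules that occur are quotients [N/L] of ideals, and one isomorphism carries nearly every
    length computation: multiplication by [u] identifies [N/(N cap (L : u))] with [(L + uN)/L].
    Module-theoretic steps thereby become identities between ideals. In (i), at most e_0 + t of the
    s_n are nonzero and none exceeds s <= t, so their sum is at most (e_0 + t) t already. The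
    further summand t is slack, which is why equality forces t = 0 and hence s = 0. Both bounds on t
    compare the coefficients of n^(d-1) in two functions of n; their terms of degree d cancel
    because e_0(Q) = e_0(I). Vanishing of s has to be matched with the Cohen-Macaulay property, and
    (ii) needs a depth argument in G(I). Both rest on one fact about a noetherian ring: a nonzero
    socle modulo one regular sequence gives one modulo any other of the same length. For (ii) it is
    applied in the Rees algebra, modulo the ideal that defines G(I), which is why Hilbert's basis
    theorem appears. *)

Section IdealCalculus.
Variable R : comPzRingType.
Implicit Types (I J K L M N A B C : ideal R) (x y u v : R) (n m : nat).

Lemma ideal_eq I J : (forall x, I x <-> J x) -> I = J.
Proof.
case: I J => [p p0 pD pM] [q q0 qD qM] /= h.
have e : p = q by apply/funext => x; apply/propext.
by subst q; congr Ideal; exact: Prop_irrelevance.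
Qed.

Definition isub I J := forall x, I x -> J x.

Lemma isub_refl I : isub I I. Proof. by []. Qed.

Lemma isub_trans J I K : isub I J -> isub J K -> isub I K.
Proof. by move=> h1 h2 x /h1/h2. Qed.

Lemma isub_anti I J : isub I J -> isub J I -> I = J.
Proof. by move=> h1 h2; apply: ideal_eq => x; split=> [/h1|/h2]. Qed.

Lemma ideal_set_inj I J : I%:I = J%:I -> I = J.
Proof. by move=> e; apply: ideal_eq => x; rewrite e. Qed.

Lemma ideal_mulr I x y : I x -> I (x * y).
Proof. by move=> Ix; rewrite mulrC; apply: idealM. Qed.

Lemma idealN I x : I x -> I (- x).
Proof. by move=> Ix; rewrite -mulN1r; apply: idealM. Qed.

Lemma idealDl I x y : I y -> I (x + y) -> I x.
Proof. by move=> Iy Ixy; rewrite -(addrK y x); apply: idealB. Qed.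

Definition iadd I J : ideal R.
Proof.
exists (fun x => exists y z, [/\ I y, J z & x = y + z]).
- by exists 0, 0; split; rewrite ?addr0 //; apply: ideal0.
- move=> _ _ [y [z [Iy Jz ->]]] [y' [z' [Iy' Jz' ->]]].
  by exists (y + y'), (z + z'); split; [exact: idealD | exact: idealD | ring].
- move=> a _ [y [z [Iy Jz ->]]]; exists (a * y), (a * z).
  by split; [exact: idealM | exact: idealM | ring].
Defined.

Definition icap I J : ideal R.
Proof.
exists (fun x => I x /\ J x).
- by split; apply: ideal0.
- by move=> x y [? ?] [? ?]; split; apply: idealD.
- by move=> a x [? ?]; split; apply: idealM.
Defined.

Definition icolon L u : ideal R.
Proof.
exists (fun r => L (u * r)).
- by rewrite mulr0; apply: ideal0.
- by move=> x y ? ?; rewrite mulrDr; apply: idealD.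
- by move=> a x ?; rewrite mulrCA; apply: idealM.
Defined.

Definition iscale u N : ideal R.
Proof.
exists (fun x => exists r, N r /\ x = u * r).
- by exists 0; rewrite mulr0; split=> //; apply: ideal0.
- move=> _ _ [r [Nr ->]] [r' [Nr' ->]]; exists (r + r'); rewrite mulrDr.
  by split=> //; apply: idealD.
- move=> a _ [r [Nr ->]]; exists (a * r); rewrite mulrCA.
  by split=> //; apply: idealM.
Defined.

Arguments iadd : simpl never.
Arguments icap : simpl never.
Arguments icolon : simpl never.
Arguments iscale : simpl never.

Definition iprin u := iscale u unit_ideal.

Definition izero : ideal R.
Proof.
exists (fun x => x = 0) => //.
- by move=> x y -> ->; rewrite addr0.
- by move=> a x ->; rewrite mulr0.
Defined.

Lemma iadd_subl I J : isub I (iadd I J).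
Proof. by move=> x Ix; exists x, 0; split; rewrite ?addr0 //; apply: ideal0. Qed.

Lemma iadd_subr I J : isub J (iadd I J).
Proof. by move=> x Jx; exists 0, x; split; rewrite ?add0r //; apply: ideal0. Qed.

Lemma iadd_min I J K : isub I K -> isub J K -> isub (iadd I J) K.
Proof. by move=> h1 h2 _ [y [z [/h1 Ky /h2 Kz ->]]]; apply: idealD. Qed.

Lemma iaddS I I' J J' : isub I I' -> isub J J' -> isub (iadd I J) (iadd I' J').
Proof.
by move=> h1 h2; apply: iadd_min => x h; [apply/iadd_subl/h1|apply/iadd_subr/h2].
Qed.

Lemma iaddC I J : iadd I J = iadd J I.
Proof.
by apply: isub_anti; apply: iadd_min; [exact: iadd_subr|exact: iadd_subl|
  exact: iadd_subr|exact: iadd_subl].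
Qed.

Lemma iaddA I J K : iadd I (iadd J K) = iadd (iadd I J) K.
Proof.
apply: isub_anti.
  apply: iadd_min; first by move=> x h; do 2 apply: iadd_subl.
  by apply: iaddS => //; exact: iadd_subr.
apply: iadd_min; first by apply: iaddS => //; exact: iadd_subl.
by move=> x h; do 2 apply: iadd_subr.
Qed.

Lemma iadd_idl I J : isub I J -> iadd I J = J.
Proof.
by move=> h; apply: isub_anti; [exact: iadd_min | exact: iadd_subr].
Qed.

Lemma iadd_idr I J : isub J I -> iadd I J = I.
Proof. by rewrite iaddC; exact: iadd_idl. Qed.

Lemma iadd0 I : iadd I izero = I.
Proof. by apply: iadd_idr => x ->; apply: ideal0. Qed.

Lemma isub_iunit I : isub I unit_ideal. Proof. by []. Qed.

Lemma icapC I J : icap I J = icap J I.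
Proof. by apply: ideal_eq => x; split=> -[]. Qed.

Lemma iprin_mem u : iprin u u.
Proof. by exists 1; rewrite mulr1. Qed.

Lemma iprin_min u I : I u -> isub (iprin u) I.
Proof. by move=> Iu _ [r [_ ->]]; apply: ideal_mulr. Qed.

Lemma iscaleS u N N' : isub N N' -> isub (iscale u N) (iscale u N').
Proof. by move=> h _ [r [/h Nr ->]]; exists r. Qed.

Lemma iscale_mem u N r : N r -> iscale u N (u * r).
Proof. by exists r. Qed.

Lemma iscale_sub u N : isub (iscale u N) N.
Proof. by move=> _ [r [Nr ->]]; apply: idealM. Qed.

Lemma iscaleM u v N : iscale u (iscale v N) = iscale (u * v) N.
Proof.
apply: ideal_eq => x; split.
  by move=> [_ [[s [Ns ->]] ->]]; exists s; rewrite mulrA.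
by move=> [s [Ns ->]]; exists (v * s); split; rewrite ?mulrA //; exists s.
Qed.

Lemma iscaleD u N M : iscale u (iadd N M) = iadd (iscale u N) (iscale u M).
Proof.
apply: ideal_eq => x; split.
  move=> [_ [[y [z [Ny Mz ->]]] ->]]; rewrite mulrDr.
  by exists (u * y), (u * z); split; [exists y|exists z|].
move=> [_ [_ [[y [Ny ->]] [z [Mz ->]] ->]]]; exists (y + z); rewrite mulrDr.
by split=> //; exists y, z.
Qed.

Lemma icolonE L u r : icolon L u r = L (u * r). Proof. by []. Qed.

Lemma icolonS u L M : isub L M -> isub (icolon L u) (icolon M u).
Proof. by move=> h r; apply: h. Qed.

Lemma icolon_sub L u : isub L (icolon L u).
Proof. by move=> r Lr; apply: idealM. Qed.

Lemma generated_min (S : set R) I : (forall x, S x -> I x) -> isub (generated S) I.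
Proof. by move=> h x; apply. Qed.

Lemma imul_mem I J x y : I x -> J y -> (I *i J) (x * y).
Proof. by move=> Ix Jy; apply: sub_generated; exists x, y. Qed.

Lemma imul_min I J K : (forall x y, I x -> J y -> K (x * y)) -> isub (I *i J) K.
Proof. by move=> h; apply: generated_min => _ [x [y [Ix Jy ->]]]; apply: h. Qed.

Lemma imulS I I' J J' : isub I I' -> isub J J' -> isub (I *i J) (I' *i J').
Proof. by move=> h1 h2; apply: imul_min => x y /h1 ? /h2 ?; apply: imul_mem. Qed.

Lemma imulC I J : I *i J = J *i I.
Proof.
by apply: isub_anti; apply: imul_min => x y ? ?; rewrite mulrC; apply: imul_mem.
Qed.

Lemma imulDl I J K : (iadd I J) *i K = iadd (I *i K) (J *i K).
Proof.
apply: isub_anti.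
  apply: imul_min => _ y [a [b [Ia Jb ->]]] Ky; rewrite mulrDl.
  by exists (a * y), (b * y); split=> //; apply: imul_mem.
by apply: iadd_min; apply: imulS => //; [exact: iadd_subl | exact: iadd_subr].
Qed.

Lemma imulDr I J K : K *i (iadd I J) = iadd (K *i I) (K *i J).
Proof. by rewrite ![K *i _]imulC imulDl. Qed.

Lemma imul_prin u I : iprin u *i I = iscale u I.
Proof.
apply: isub_anti.
  apply: imul_min => _ y [r [_ ->]] Iy; exists (r * y); rewrite mulrA.
  by split=> //; apply: idealM.
by move=> _ [r [Ir ->]]; apply: imul_mem => //; apply: iprin_mem.
Qed.

Lemma imul_scale u I J : iscale u I *i J = iscale u (I *i J).
Proof.
apply: isub_anti.
  apply: imul_min => _ y [r [Ir ->]] Jy; exists (r * y); rewrite mulrA.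
  by split=> //; apply: imul_mem.
move=> _ [r [IJr ->]].
suff h : isub (I *i J) (icolon (iscale u I *i J) u) by apply: h.
apply: imul_min => x y Ix Jy; rewrite icolonE mulrA; apply: imul_mem => //.
exact: iscale_mem.
Qed.

Lemma imul_subl I J : isub (I *i J) I.
Proof. by apply: imul_min => x y Ix _; apply: ideal_mulr. Qed.

Lemma imul_subr I J : isub (I *i J) J.
Proof. by rewrite imulC; apply: imul_subl. Qed.

Lemma imulA I J K : I *i (J *i K) = (I *i J) *i K.
Proof.
have h A B C : isub (A *i (B *i C)) ((A *i B) *i C).
  apply: imul_min => x y Ax BCy.
  suff h : isub (B *i C) (icolon ((A *i B) *i C) x) by apply: h.
  apply: imul_min => b c Bb Cc; rewrite icolonE mulrA.
  by apply: imul_mem => //; apply: imul_mem.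
apply: isub_anti; first exact: h.
by rewrite [_ *i K]imulC [I *i J]imulC [I *i (_ *i _)]imulC [J *i K]imulC; exact: h.
Qed.

Lemma imul1 I : unit_ideal *i I = I.
Proof.
apply: isub_anti; first exact: imul_subr.
by move=> x Ix; rewrite -(mul1r x); apply: imul_mem.
Qed.

Lemma iexpS I n : I ^i n.+1 = I *i I ^i n. Proof. by []. Qed.

Lemma iexp0 I : I ^i 0 = unit_ideal. Proof. by []. Qed.

Lemma iexp1 I : I ^i 1 = I.
Proof. by rewrite iexpS imulC imul1. Qed.

Lemma iexpD I m n : I ^i (m + n) = (I ^i m) *i (I ^i n).
Proof. by elim: m => [|m IH]; rewrite ?imul1 // addSn !iexpS IH imulA. Qed.

Lemma iexp_le I m n : (m <= n)%N -> isub (I ^i n) (I ^i m).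
Proof. by move=> /subnK <-; rewrite iexpD; apply: imul_subr. Qed.

Lemma iexpSub I J n : isub I J -> isub (I ^i n) (J ^i n).
Proof. by move=> h; elim: n => // n IH; rewrite !iexpS; apply: imulS. Qed.

Lemma iexpM I m n : I ^i (m * n) = (I ^i m) ^i n.
Proof. by elim: n => [|n IH]; rewrite ?muln0 // mulnS iexpD IH. Qed.

Lemma iexp_mem I x n : I x -> (I ^i n) (x ^+ n).
Proof. by move=> Ix; elim: n => // n IH; rewrite exprS iexpS; apply: imul_mem. Qed.

Lemma iexp_sub1 I n : (0 < n)%N -> isub (I ^i n) I.
Proof. by case: n => // n _; rewrite iexpS; apply: imul_subl. Qed.

Lemma iexpDadd A B m n : isub ((iadd A B) ^i (m + n)) (iadd (A ^i m) (B ^i n)).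
Proof.
elim: m n => [|m IHm] n; first by move=> x _; apply: iadd_subl.
elim: n => [|n IHn]; first by move=> x _; apply: iadd_subr.
rewrite addnS iexpS imulDl; apply: iadd_min.
  rewrite addSnnS; apply: isub_trans (imulS (@isub_refl A) (IHm n.+1)) _.
  rewrite imulDr -iexpS; apply: iaddS => //; exact: imul_subr.
apply: isub_trans (imulS (@isub_refl B) IHn) _.
by rewrite imulDr -iexpS; apply: iaddS => //; apply: imul_subr.
Qed.

Lemma iexp_add_prin A y n :
  (iadd A (iprin y)) ^i n.+1 = iadd (A ^i n.+1) (iscale y ((iadd A (iprin y)) ^i n)).
Proof.
set Q := iadd A _; apply: isub_anti; last first.
  apply: iadd_min; first by apply: iexpSub; apply: iadd_subl.
  rewrite iexpS -imul_prin; apply: imulS => //; exact: iadd_subr.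
elim: n => [|n IH]; first by rewrite !iexp1.
rewrite [X in isub X _]iexpS {1}/Q imulDl imul_prin; apply: iadd_min; last exact: iadd_subr.
apply: isub_trans (imulS (@isub_refl A) IH) _.
rewrite imulDr -iexpS; apply: iaddS => //.
rewrite imulC imul_scale imulC; apply: iscaleS.
by rewrite [X in isub _ X]iexpS; apply: imulS => //; exact: iadd_subl.
Qed.

Lemma gen_nil : generated_by (nil : seq R) = izero.
Proof.
apply: isub_anti; first by apply: generated_min.
by move=> x ->; apply: ideal0.
Qed.

Lemma gen_cons x (s : seq R) :
  generated_by (x :: s) = iadd (iprin x) (generated_by s).
Proof.
apply: isub_anti.
  apply: generated_min => y; rewrite /mkset inE => /orP[/eqP ->|ys].
    by apply: iadd_subl; apply: iprin_mem.
  by apply: iadd_subr; apply: sub_generated.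
apply: iadd_min.
  by apply: iprin_min; apply: sub_generated; rewrite /= inE eqxx.
by apply: generated_min => y ys; apply: sub_generated; rewrite /= inE ys orbT.
Qed.

Lemma gen_cat (s t : seq R) :
  generated_by (s ++ t) = iadd (generated_by s) (generated_by t).
Proof.
elim: s => [|x s IH]; first by rewrite gen_nil iaddC iadd0.
by rewrite cat_cons !gen_cons IH iaddA.
Qed.

Lemma gen_take (s : seq R) i : (i < size s)%N ->
  generated_by (take i.+1 s) = iadd (generated_by (take i s)) (iprin (nth 0 s i)).
Proof.
by move=> h; rewrite (take_nth 0 h) -cats1 gen_cat gen_cons gen_nil iadd0.
Qed.

Lemma gen_mem (s : seq R) x : x \in s -> generated_by s x.
Proof. by move=> xs; apply: sub_generated. Qed.

End IdealCalculus.
Arguments izero {R}.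
Arguments iadd : simpl never.
Arguments icap : simpl never.
Arguments icolon : simpl never.
Arguments iscale : simpl never.
Arguments izero : simpl never.

(** * Length *)

Definition between (R : comPzRingType) (N L : ideal R) : set (ideal R) :=
  [set J | L%:I `<=` J%:I /\ J%:I `<=` N%:I].

Definition haslen (R : comPzRingType) (N L : ideal R) n :=
  max_chain_length (between N L) n.

Definition fin (R : comPzRingType) (N L : ideal R) := exists n, haslen N L n.

(** The default 0 in the absence of a finite length makes equalities such as [len_scale]
    unconditional; elsewhere [fin] is carried along. *)
Definition len (R : comPzRingType) (N L : ideal R) : nat :=
  if pselect (fin N L) is left h then projT1 (cid h) else 0%N.

Section ChainTransport.
Variables (R R' : comPzRingType) (P : set (ideal R)) (P' : set (ideal R')).
Variables (f : ideal R -> ideal R').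

Lemma chain_transport n : (forall J, P J -> P' (f J)) ->
  (forall J J', P J -> P J' -> (isub (f J) (f J') <-> isub J J')) ->
  strict_chain P n -> strict_chain P' n.
Proof.
move=> fP fm [J [JP Jlt]]; exists (f \o J); split=> [i /JP/fP //|i hi].
have [h1 h2] := Jlt i hi.
have P1 := JP i (ltnW hi); have P2 := JP i.+1 hi.
split; first by apply/(fm _ _ P1 P2).
by move=> h; apply: h2; apply/(fm _ _ P2 P1).
Qed.
End ChainTransport.

(** Length depends only on the ordered set of intermediate ideals. The rings may differ, so that
    both multiplication maps and passage to a quotient ring are covered. *)
Lemma haslen_iso (R R' : comPzRingType) (N L : ideal R) (N' L' : ideal R')
    (f : ideal R -> ideal R') (g : ideal R' -> ideal R) n :
  (forall J, between N L J -> between N' L' (f J)) ->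
  (forall J, between N' L' J -> between N L (g J)) ->
  (forall J J', between N L J -> between N L J' -> isub J J' -> isub (f J) (f J')) ->
  (forall J J', between N' L' J -> between N' L' J' -> isub J J' -> isub (g J) (g J')) ->
  (forall J, between N L J -> g (f J) = J) ->
  (forall J, between N' L' J -> f (g J) = J) ->
  haslen N L n -> haslen N' L' n.
Proof.
move=> fP gP fm gm gf fg [ch mx]; split.
  apply: (chain_transport fP _ ch) => J J' hJ hJ'; split; last exact: fm.
  by move=> h; rewrite -(gf J) // -(gf J') //; apply: gm => //; apply: fP.
move=> k chk; apply: mx; apply: (chain_transport gP _ chk) => J J' hJ hJ'.
split; last exact: gm.
by move=> h; rewrite -(fg J) // -(fg J') //; apply: fm => //; apply: gP.
Qed.

Section Length.
Variable R : comPzRingType.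
Implicit Types (I J K L M N A B C : ideal R) (x y u v : R) (n m p q : nat).

Lemma haslen_uniq N L n m : haslen N L n -> haslen N L m -> n = m.
Proof. by move=> [h1 h2] [h3 h4]; apply/eqP; rewrite eqn_leq h4 //= h2. Qed.

Lemma lenP N L : fin N L -> haslen N L (len N L).
Proof. by rewrite /len => h; case: pselect => // h'; case: cid. Qed.

Lemma haslen_len N L n : haslen N L n -> len N L = n.
Proof. by move=> h; apply: (haslen_uniq _ h); apply: lenP; exists n. Qed.

Lemma length_len N L : fin N L -> length N L = (len N L)%:Z%:E.
Proof.
move=> h; rewrite /length; case: pselect => [h'|]; last by case.
by congr ((Posz _)%:E); apply: (haslen_uniq _ (lenP h)); case: cid.
Qed.

Lemma length_fin N L z : length N L = z%:E -> fin N L.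
Proof. by rewrite /length; case: pselect. Qed.

Lemma chain0 N L : isub L N -> strict_chain (between N L) 0.
Proof. by move=> h; exists (fun=> L); split=> // i _; split. Qed.

Lemma chain_between N L n : strict_chain (between N L) n -> isub L N.
Proof. by move=> [J [h _]] x Lx; have [h1 h2] := h 0%N isT; apply/h2/h1. Qed.

Lemma fin_sub N L : fin N L -> isub L N.
Proof. by move=> [n [/chain_between h _]]. Qed.

Lemma fin_bounded N L b : isub L N ->
  (forall k, strict_chain (between N L) k -> (k <= b)%N) -> fin N L /\ (len N L <= b)%N.
Proof.
move=> LN hb; pose P k := `[< strict_chain (between N L) k >].
have exP : exists k, P k by exists 0%N; apply/asboolP/chain0.
have ubP k : P k -> (k <= b)%N by move=> /asboolP /hb.
have [n /asboolP nP nmax] := ex_maxnP exP ubP.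
have h : haslen N L n by split=> // k /asboolP; apply: nmax.
by split; [exists n | rewrite (haslen_len h); apply: hb].
Qed.

Lemma chain_weaken (P P' : set (ideal R)) k : (forall J, P J -> P' J) ->
  strict_chain P k -> strict_chain P' k.
Proof. by move=> h; apply: (@chain_transport _ _ P P' id). Qed.

Lemma len_chain N L k : fin N L -> strict_chain (between N L) k -> (k <= len N L)%N.
Proof. by move=> /lenP [_ h] /h. Qed.

Lemma fin_mono N N' L L' : isub L L' -> isub L' N' -> isub N' N ->
  fin N L -> fin N' L' /\ (len N' L' <= len N L)%N.
Proof.
move=> h1 h2 h3 hf; apply: fin_bounded => // k ch; apply: len_chain => //.
apply: chain_weaken ch => J [a b]; split; first by move=> x /h1 /a.
by move=> x /b /h3.
Qed.

Lemma fin_id N : fin N N /\ len N N = 0%N.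
Proof.
suff [h1 h2] : fin N N /\ (len N N <= 0)%N by split=> //; apply/eqP; rewrite -leqn0.
apply: fin_bounded => // -[//|k] [J [JP /(_ 0%N isT) [_]]].
by case; move=> x; have [h _] := JP 0%N isT; have [_ h'] := JP 1%N isT => /h' /h.
Qed.

Lemma len_eq0 N L : fin N L -> len N L = 0%N -> N = L.
Proof.
move=> hf h0; apply: isub_anti; last exact: fin_sub.
apply: contrapT => hN.
suff : (1 <= len N L)%N by rewrite h0.
apply: len_chain => //; exists (fun i => if i is 0%N then L else N).
have LN := fin_sub hf.
by split=> [[|i] _|[|//] _]; split.
Qed.

(** The last term is prescribed so that chains can be extended at the top. *)
Definition chain_to (P : set (ideal R)) n E :=
  exists J : nat -> ideal R, [/\ forall i, (i <= n)%N -> P (J i),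
    forall i, (i < n)%N -> (J i)%:I `<` (J i.+1)%:I & J n = E].

Lemma chain_to_snoc P n E F : chain_to P n E -> P F -> isub E F -> ~ isub F E ->
  chain_to P n.+1 F.
Proof.
move=> [J [JP Jlt JE]] PF h1 h2; exists (fun i => if (i <= n)%N then J i else F).
split; last by rewrite ltnn.
  by move=> i _; case: ifP => // /JP.
move=> i; rewrite ltnS => hi; rewrite hi; case: ltnP => [hi'|ni]; first exact: Jlt.
by have -> : i = n by [apply/eqP; rewrite eqn_leq hi]; rewrite JE.
Qed.

Lemma chain_to_chain P n E : chain_to P n E -> strict_chain P n.
Proof. by move=> [J [h1 h2 _]]; exists J. Qed.

Lemma modular_sub A B M : isub A B -> isub (icap B M) A -> isub B (iadd A M) -> isub B A.
Proof.
move=> AB h1 h2 x Bx; have [a [z [Aa Mz e]]] := h2 x Bx.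
rewrite e; apply: idealD => //; apply: h1; split=> //.
have -> : z = x - a by rewrite e; ring.
by apply: idealB => //; apply: AB.
Qed.

(** By modularity a strict inclusion stays strict after adding [M] or after intersecting with [M],
    so each step of the chain survives in at least one of the two new chains. *)
Lemma chain_split N M L n : isub L M -> isub M N -> strict_chain (between N L) n ->
  exists p q, [/\ (n <= p + q)%N, strict_chain (between N M) p
    & strict_chain (between M L) q].
Proof.
move=> LM MN [J [JP Jlt]].
have Jin i : (i <= n)%N -> between N M (iadd (J i) M) /\ between M L (icap (J i) M).
  move=> /JP [h1 h2]; split; split.
  - by move=> x; apply: iadd_subr.
  - by move=> x; apply: iadd_min.
  - by move=> x Lx; split; [apply: h1 | apply: LM].
  - by move=> x [].
suff h k : (k <= n)%N -> exists p q, [/\ (k <= p + q)%N,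
    chain_to (between N M) p (iadd (J k) M) & chain_to (between M L) q (icap (J k) M)].
  have [p [q [h1 /chain_to_chain h2 /chain_to_chain h3]]] := h n (leqnn n).
  by exists p, q.
elim: k => [|k IH] hk.
  have [h1 h2] := Jin 0%N hk; exists 0%N, 0%N; split=> //.
    by exists (fun=> iadd (J 0%N) M).
  by exists (fun=> icap (J 0%N) M).
have [p [q [hpq cp cq]]] := IH (ltnW hk).
have [P1 P2] := Jin k.+1 hk; have [lt1 lt2] := Jlt k hk.
have s1 : isub (iadd (J k) M) (iadd (J k.+1) M) by apply: iaddS.
have s2 : isub (icap (J k) M) (icap (J k.+1) M) by move=> x [/lt1].
have [e1|n1] := pselect (isub (iadd (J k.+1) M) (iadd (J k) M)).
  have [e2|n2] := pselect (isub (icap (J k.+1) M) (icap (J k) M)).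
    case: lt2; apply: (@modular_sub _ _ M lt1); first by move=> x /e2 [].
    by move=> x h; apply/e1/iadd_subl.
  exists p, q.+1; split; [by rewrite addnS | | exact: chain_to_snoc cq P2 s2 n2].
  by rewrite -(isub_anti s1 e1).
have cp' := chain_to_snoc cp P1 s1 n1.
have [e2|n2] := pselect (isub (icap (J k.+1) M) (icap (J k) M)).
  by exists p.+1, q; split; rewrite -?(isub_anti s2 e2) // addSn.
exists p.+1, q.+1; split=> //; first by rewrite addSn addnS ltnS (leq_trans hpq) ?leqnSn.
exact: chain_to_snoc cq P2 s2 n2.
Qed.

Lemma chain_cat N M L p q : strict_chain (between N M) p -> strict_chain (between M L) q ->
  strict_chain (between N L) (p + q).
Proof.
move=> c1 c2; have MN := chain_between c1; have LM := chain_between c2.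
case: c1 c2 => [C [CP Clt]] [J [JP Jlt]].
exists (fun i => if (i <= q)%N then J i else C (i - q)%N); split=> i hi.
  case: leqP => hq.
    by have [h1 h2] := JP i hq; split=> // x /h2 /MN.
  have [|h1 h2] := CP (i - q)%N; first by rewrite leq_subLR addnC.
  by split=> // x /LM /h1.
case: (leqP i q) => hq; last first.
  rewrite leqNgt ltnS (ltnW hq) /= subSn ?(ltnW hq) //; apply: Clt.
  by rewrite ltn_subLR ?(ltnW hq) // addnC.
case: ltnP => hq'; first exact: Jlt.
have e : i = q by apply/eqP; rewrite eqn_leq hq.
have hp : (0 < p)%N by move: hi; rewrite e -{1}[q]add0n ltn_add2r.
subst i; rewrite subSnn; have [Lq1 qM] := JP q (leqnn q).
have [M0 _] := CP 0%N isT; have [h1 h2] := Clt 0%N hp.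
by split; [move=> x /qM /M0 /h1 | move=> h; apply: h2 => x /h /qM /M0].
Qed.

Lemma fin_add N M L : fin N M -> fin M L ->
  fin N L /\ len N L = (len N M + len M L)%N.
Proof.
move=> f1 f2; have MN := fin_sub f1; have LM := fin_sub f2.
suff h : haslen N L (len N M + len M L).
  by split; [exists (len N M + len M L)%N | exact: haslen_len].
split; first exact: (chain_cat (proj1 (lenP f1)) (proj1 (lenP f2))).
move=> k /(chain_split LM MN) [p [q [hk c1 c2]]].
by apply: (leq_trans hk); apply: leq_add; apply: len_chain.
Qed.

Lemma fin_cut M N L : isub L M -> isub M N -> fin N L ->
  [/\ fin N M, fin M L & len N L = (len N M + len M L)%N].
Proof.
move=> LM MN hf.
have [f1 _] := fin_mono LM MN (@isub_refl _ _) hf.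
have [f2 _] := fin_mono (@isub_refl _ _) LM MN hf.
by have [_ h] := fin_add f1 f2.
Qed.

(** Multiplication by [u] induces an isomorphism of [N/(N cap (L : u))] with [(L + uN)/L]; [f] and
    [g] are the resulting maps between submodules. For [u = 1] it is the second isomorphism
    theorem. *)
Lemma haslen_scale L u N n :
  haslen (iadd L (iscale u N)) L n <-> haslen N (icap N (icolon L u)) n.
Proof.
pose f J := icap N (icolon J u); pose g K := iadd L (iscale u K).
have fP J : between (iadd L (iscale u N)) L J -> between N (icap N (icolon L u)) (f J).
  by move=> [h1 h2]; split=> x [Nx] // Lx; split=> //; apply: h1.
have gP K : between N (icap N (icolon L u)) K -> between (iadd L (iscale u N)) L (g K).
  move=> [h1 h2]; split; first by move=> x; apply: iadd_subl.
  by move=> x; apply: iaddS => //; apply: iscaleS.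
have fm J J' : isub J J' -> isub (f J) (f J') by move=> h x [Nx /h].
have gm J J' : isub J J' -> isub (g J) (g J').
  by move=> h; apply: iaddS => //; apply: iscaleS.
have gf J : between (iadd L (iscale u N)) L J -> g (f J) = J.
  move=> [h1 h2]; apply: isub_anti.
    by apply: iadd_min => // _ [r [[_ Jr] ->]].
  move=> x Jx; have [l [_ [Ll [r [Nr ->]] e]]] := h2 x Jx.
  exists l, (u * r); split=> //; exists r; split=> //; split=> //.
  rewrite icolonE; have -> : u * r = x - l by rewrite e; ring.
  by apply: idealB => //; apply: h1.
have fg K : between N (icap N (icolon L u)) K -> f (g K) = K.
  move=> [h1 h2]; apply: isub_anti => [x [Nx [l [_ [Ll [k [Kk ->]] e]]]]|x Kx].
    rewrite -(subrK k x); apply: idealD => //; apply: h1; split.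
      by apply: idealB => //; apply: h2.
    by rewrite icolonE mulrBr e addrK.
  by split; [apply: h2 | apply: iadd_subr; apply: iscale_mem].
split; first by apply: (@haslen_iso _ _ _ _ _ _ f g) => // *; [exact: fm | exact: gm].
by apply: (@haslen_iso _ _ _ _ _ _ g f) => // *; [exact: gm | exact: fm].
Qed.

Lemma eq_haslen N L N' L' : (forall n, haslen N L n <-> haslen N' L' n) ->
  (fin N L <-> fin N' L') /\ len N L = len N' L'.
Proof.
move=> h; have e : fin N L <-> fin N' L'.
  by split=> -[n hn]; exists n; apply/h.
split=> //; have [hf|hf] := pselect (fin N L).
  by apply: haslen_len; apply/h; apply/lenP/e.
rewrite /len; case: pselect => // _; case: pselect => // hf'.
by case: hf; apply/e.
Qed.

Lemma len_scale L u N : let M := icap N (icolon L u) in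
  (fin (iadd L (iscale u N)) L <-> fin N M) /\ len (iadd L (iscale u N)) L = len N M.
Proof. by apply: eq_haslen => n; apply: haslen_scale. Qed.

Lemma iscale1 N : iscale 1 N = N.
Proof.
apply: ideal_eq => x; split=> [[r [Nr ->]]|Nx]; first by rewrite mul1r.
by exists x; rewrite mul1r.
Qed.

Lemma icolon1 N : icolon N 1 = N.
Proof. by apply: ideal_eq => x; rewrite icolonE mul1r. Qed.

Lemma len_iadd L N :
  (fin (iadd L N) L <-> fin N (icap N L)) /\ len (iadd L N) L = len N (icap N L).
Proof. by have := len_scale L 1 N; rewrite iscale1 icolon1. Qed.

Lemma len_scale2 L u M N : isub N M ->
  let N' := icap M (icolon (iadd L (iscale u N)) u) in
  (fin (iadd L (iscale u M)) (iadd L (iscale u N)) <-> fin M N') /\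
  len (iadd L (iscale u M)) (iadd L (iscale u N)) = len M N'.
Proof.
move=> NM; have := len_scale (iadd L (iscale u N)) u M.
suff -> : iadd (iadd L (iscale u N)) (iscale u M) = iadd L (iscale u M) by [].
by rewrite -iaddA -iscaleD (iadd_idl NM).
Qed.

End Length.

(** * Filtrations with cyclic quotients *)

Definition nzd (R : comPzRingType) (b : ideal R) (x : R) :=
  forall r, b (x * r) -> b r.

Section CyclicFiltrations.
Variable R : comPzRingType.
Implicit Types (a b c I J K L M N Q : ideal R) (x y u v : R) (n m p q : nat).

(** A chain descending from [b] to [c] in [n] steps, each with quotient [(c + uR)/c], isomorphic to
    [R/(c : u) = R/a]. Such chains of copies of [R/a] take the place of free [R/a]-modules. *)
Inductive filt a : ideal R -> ideal R -> nat -> Prop :=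
| Filt0 b : filt a b b 0
| FiltS b c u n : filt a b (iadd c (iprin u)) n -> icolon c u = a -> filt a b c n.+1.

Lemma filt_trans a b c c' n m : filt a b c n -> filt a c c' m -> filt a b c' (n + m).
Proof.
move=> h1 h2; elim: h2 h1 => [b'|b' c1 u p _ IH cu] h1; first by rewrite addn0.
by rewrite addnS; apply: (FiltS _ cu); apply: IH.
Qed.

Lemma filt_sub a b c n : filt a b c n -> isub c b.
Proof.
by elim=> [b'|b' c1 u p _ IH cu] x // cx; apply: IH; apply: iadd_subl.
Qed.

(** In the exact sequence [0 -> R/b -> R/c -> R/(c + uR) -> 0] the element [x] is regular on both
    ends, hence in the middle. *)
Lemma nzd_step b c u x : icolon c u = b -> nzd b x -> nzd (iadd c (iprin u)) x ->
  nzd c x.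
Proof.
move=> cu bx hx r cxr.
have [c0 [_ [c0c [v [_ ->]] e]]] := hx r (iadd_subl _ cxr).
rewrite e; apply: idealD => //; rewrite -icolonE cu; apply: bx; rewrite -cu icolonE.
have -> : u * (x * v) = x * r - x * c0 by rewrite e; ring.
by apply: idealB => //; apply: idealM.
Qed.

Lemma filt_nzd a b c n x : filt a b c n -> nzd a x -> nzd b x -> nzd c x.
Proof.
move=> h ax; elim: h => [//|b' c1 u p _ IH cu] bx.
by apply: (nzd_step cu) => //; apply: IH.
Qed.

(* [len R (c + yR) - len (c : y) c] is the Euler characteristic of [y] on [R/c];
   it is additive along the steps of the filtration. *)
Lemma filt_index a y c n :
  fin unit_ideal (iadd a (iprin y)) -> fin (icolon a y) a ->
  filt a unit_ideal c n ->
  [/\ fin unit_ideal (iadd c (iprin y)), fin (icolon c y) c &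
   (len unit_ideal (iadd c (iprin y)) + n * len (icolon a y) a =
    len (icolon c y) c + n * len unit_ideal (iadd a (iprin y)))%N].
Proof.
move=> fay faa; move e0 : unit_ideal => b0 h.
elim: h e0 => {b0 c n} [b|b c u n _ IH cu] hid.
  subst b; have -> : iadd unit_ideal (iprin y) = unit_ideal :> ideal R.
    exact/iadd_idr/isub_iunit.
  have -> : icolon unit_ideal y = unit_ideal :> ideal R by apply: isub_anti.
  by have [f0 l0] := fin_id (@unit_ideal R); split=> //; rewrite l0.
have {IH} [fby fbb E] := IH hid; subst b.
set b1 := iadd c (iprin u) in fby fbb E *.
set U := unit_ideal in fay fby E *.
pose cy := iadd c (iprin y); pose Z := icolon cy u.
have cb1 : isub c b1 by exact: iadd_subl.
have aZ : isub (iadd a (iprin y)) Z.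
  apply: iadd_min => r; rewrite /Z icolonE.
    by rewrite -cu icolonE => h; apply: iadd_subl.
  move=> [v [_ ->]]; apply: iadd_subr.
  by exists (u * v); split=> //; ring.
have [fUZ fZa LZ] := fin_cut aZ (@isub_iunit _ _) fay.
have e1 : iadd b1 (iprin y) = iadd cy (iscale u U).
  by rewrite /b1 /cy -!iaddA [iadd (iprin u) _]iaddC.
have [f1 l1] := len_scale cy u U.
have e2 : icap U Z = Z by apply: ideal_eq => r; split=> [[]|].
rewrite -e1 -/Z e2 in f1 l1.
have [fUc LUc] := fin_add fby (proj2 f1 fUZ).
pose cyb := iadd c (iscale y b1).
(* [X/cyb] is isomorphic to the image of the connecting map of the snake lemma, for multiplication
   by [y] on [0 -> R/a -> R/c -> R/b1 -> 0]. The descriptions [X1] and [X2] compute its length from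
   the kernel of [y] on [R/b1] and from the cokernel of [y] on [R/a]. *)
pose X := icap b1 cy.
have X1 : X = iadd cyb (iscale y (icolon b1 y)).
  apply: isub_anti.
    move=> x [b1x [c0 [_ [c0c [r [_ ->]] e]]]]; exists c0, (y * r); split=> //.
      exact: iadd_subl.
    exists r; split=> //; rewrite icolonE; have -> : y * r = x - c0 by rewrite e; ring.
    by apply: idealB => //; apply: cb1.
  apply: iadd_min.
    apply: iadd_min => x h; first by split; [apply: cb1 | apply: iadd_subl].
    split; first exact: iscale_sub h.
    by apply: iadd_subr; case: h => r [_ ->]; exists r.
  by move=> _ [r [b1r ->]]; split=> //; apply: iadd_subr; exists r.
have X2 : X = iadd cyb (iscale u Z).
  apply: isub_anti.
    move=> x [[c0 [_ [c0c [r [_ ->]] e]] cyx]]; exists c0, (u * r); split=> //.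
      exact: iadd_subl.
    exists r; split=> //; rewrite icolonE; have -> : u * r = x - c0 by rewrite e; ring.
    by apply: idealB => //; apply: iadd_subl.
  apply: iadd_min.
    apply: iadd_min => x h; first by split; [apply: cb1 | apply: iadd_subl].
    split; first exact: iscale_sub h.
    by apply: iadd_subr; case: h => r [_ ->]; exists r.
  by move=> _ [r [Zr ->]]; split=> //; apply: iadd_subr; exists r.
have k1 : icap (icolon b1 y) (icolon cyb y) = iadd b1 (icolon c y).
  apply: isub_anti.
    move=> r [b1r [c0 [_ [c0c [b0 [b0b ->]] e]]]]; exists b0, (r - b0).
    split; [by [] | | by ring].
    by rewrite icolonE mulrBr e addrK.
  apply: iadd_min => r h; split.
  - exact: idealM.
  - by apply: iadd_subr; exists r.
  - exact: cb1.
  - exact: iadd_subl.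
have k2 : icap Z (icolon cyb u) = iadd a (iprin y).
  apply: isub_anti; last first.
    move=> r ar; split; first exact: aZ.
    case: ar => a0 [_ [a0a [v [_ ->]] ->]]; rewrite icolonE mulrDr.
    exists (u * a0), (u * (y * v)); split=> //; first by rewrite -icolonE cu.
    by exists (u * v); split; [apply: iadd_subr; exists v | ring].
  move=> r [Zr [c0 [_ [c0c [_ [[c2 [_ [c2c [v [_ ->]] ->]]] ->]] e]]]].
  exists (r - y * v), (y * v); split; [|by exists v | by ring].
  rewrite -cu icolonE; have -> : u * (r - y * v) = c0 + y * c2.
    by rewrite mulrBr e; ring.
  by apply: idealD => //; apply: idealM.
have [f2 l2] := len_scale cyb y (icolon b1 y).
rewrite k1 -X1 in f2 l2.
have [f3 l3] := len_scale cyb u Z.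
rewrite k2 -X2 in f3 l3.
have sub1 : isub b1 (iadd b1 (icolon c y)) by exact: iadd_subl.
have sub2 : isub (iadd b1 (icolon c y)) (icolon b1 y).
  apply: iadd_min; first exact: icolon_sub.
  exact: icolonS.
have [fA fB LB] := fin_cut sub1 sub2 fbb.
have [f4 l4] := len_iadd b1 (icolon c y).
have s1 : isub c (icap (icolon c y) b1).
  by move=> r cr; split; [apply: idealM | apply: cb1].
have e3 : icap (icolon c y) b1 = iadd c (iscale u (icolon a y)).
  apply: isub_anti.
    move=> r [yr [c0 [_ [c0c [v [_ ->]] e]]]]; exists c0, (u * v); split=> //.
    exists v; split=> //; rewrite icolonE -cu icolonE.
    have -> : u * (y * v) = y * r - y * c0 by rewrite e; ring.
    by apply: idealB => //; apply: idealM.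
  apply: iadd_min => // _ [v [av ->]]; split; last by apply: iadd_subr; exists v.
  by rewrite icolonE mulrCA -icolonE cu.
have [f5 l5] := len_scale c u (icolon a y).
have e4 : icap (icolon a y) (icolon c u) = a.
  rewrite cu; apply: ideal_eq => r; split=> [[]//|ar]; split=> //.
  exact: idealM.
rewrite -e3 e4 in f5 l5.
have [f6 l6] := fin_add (proj1 f4 fB) (proj2 f5 faa).
split=> //; rewrite !mulSn -/cy; move: E LZ LUc LB l1 l2 l3 l4 l5 l6; rewrite /U; lia.
Qed.

(* If [x] is regular modulo [b], so is it on every [R/c] below; this gives
   quasi-regularity of [(b, x)] from that of [b]. *)
Lemma filt_shift_l b c0 c x K n : isub c0 K -> nzd b x -> nzd c0 x -> filt b c0 c n ->
  filt (iadd b (iprin x)) (iadd c0 (iscale x K)) (iadd c (iscale x K)) n.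
Proof.
move=> c0K bx c0x h; elim: h c0K c0x => [b'|b' c1 u p h IH cu] c0K c0x.
  exact: Filt0.
have uK : K u by apply: c0K; apply: (filt_sub h); apply: iadd_subr; apply: iprin_mem.
apply: (@FiltS _ _ _ u).
  by rewrite -iaddA [iadd _ (iprin u)]iaddC iaddA; apply: IH.
have c1x : nzd (iadd c1 (iprin u)) x by apply: filt_nzd h bx c0x.
apply: isub_anti.
  move=> r [c2 [_ [c2c [v [Kv ->]] e]]].
  have [|c3 [_ [c3c [w [_ ->]] e']]] := c1x v.
    have -> : x * v = u * r - c2 by rewrite e; ring.
    apply: idealB; first by apply: iadd_subr; exists r.
    exact: iadd_subl.
  exists (r - x * w), (x * w); split; [|by exists w | by ring].
  rewrite -cu icolonE; have -> : u * (r - x * w) = c2 + x * c3.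
    by rewrite mulrBr e e'; ring.
  by apply: idealD => //; apply: idealM.
apply: iadd_min => r.
  by rewrite -cu !icolonE => h'; apply: iadd_subl.
move=> [v [_ ->]]; rewrite icolonE; apply: iadd_subr; exists (u * v).
by split; [exact: ideal_mulr | ring].
Qed.

(** As [x] is regular modulo [b0], multiplication by [x] carries the cyclic quotients between [c0]
    and [c] over unchanged. *)
Lemma filt_shift_r a b0 x c0 c n : isub b0 c -> nzd b0 x -> filt a c0 c n ->
  filt a (iadd b0 (iscale x c0)) (iadd b0 (iscale x c)) n.
Proof.
move=> b0c b0x h; elim: h b0c => [b'|b' c1 u p h IH cu] b0c; first exact: Filt0.
apply: (@FiltS _ _ _ (x * u)).
  have -> : iadd (iadd b0 (iscale x c1)) (iprin (x * u)) =
            iadd b0 (iscale x (iadd c1 (iprin u))).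
    by rewrite iscaleD iaddA /iprin iscaleM.
  by apply: IH => r /b0c; apply: iadd_subl.
rewrite -cu; apply: ideal_eq => r; rewrite !icolonE; split; last first.
  by move=> h'; apply: iadd_subr; exists (u * r); split=> //; ring.
move=> [b1 [_ [b1b [v [cv ->]] e]]]; apply: (@idealDl _ _ _ (- v)).
  exact: idealN.
by apply/b0c/b0x; have -> : x * (u * r - v) = b1 by [rewrite mulrBr mulrA e; ring].
Qed.

(** A weak form of quasi-regularity: for a regular sequence [a^n/a^(n+1)] would be free over [R/a],
    and [rk n] is its rank. *)
Definition powers_filtered a (rk : nat -> nat) :=
  forall n, filt a (a ^i n) (a ^i n.+1) (rk n).

Lemma powers_filtered_sum a rk n : powers_filtered a rk ->
  filt a unit_ideal (a ^i n) (\sum_(j < n) rk j)%N.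
Proof.
move=> h; elim: n => [|n IH]; first by rewrite big_ord0; apply: Filt0.
by rewrite big_ord_recr; apply: filt_trans IH (h n).
Qed.

(** Between [a^(n+1) = b^(n+1) + x a^n] and [a^(n+2) = b^(n+2) + x a^(n+1)] lies
    [b^(n+1) + x a^(n+1)]. The upper layer is the shift by [x] of [a^n/a^(n+1)], the lower one comes
    from [b^(n+1)/b^(n+2)]. *)
Lemma powers_filtered_step b x rk : powers_filtered b rk -> nzd b x ->
  powers_filtered (iadd b (iprin x)) (fun n => \sum_(j < n.+1) rk j)%N.
Proof.
move=> h bx; set a := iadd b _.
have nz n : nzd (b ^i n) x.
  by apply: filt_nzd (powers_filtered_sum n h) bx _.
have second n : filt a (iadd (b ^i n) (iscale x (a ^i n)))
    (iadd (b ^i n.+1) (iscale x (a ^i n))) (rk n).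
  apply: filt_shift_l => //; exact: iexpSub (@iadd_subl _ _ _).
elim=> [|n IH].
  rewrite big_ord1; move: (second 0%N).
  by rewrite !iexp0 iexp1 [_ ^i 1]iexp1 -/(iprin x) -/a iadd_idr.
rewrite big_ord_recr /= {1}[a ^i n.+1]iexp_add_prin [a ^i n.+2]iexp_add_prin -/a.
apply: filt_trans (second n.+1).
apply: filt_shift_r => //; exact: iexpSub (@iadd_subl _ _ _).
Qed.

(** Each step [(c1 + uR)/c1] of the filtration meets [T] in at least the class of [u f], which is a
    copy of [f/a] because [(c1 : u) = a]. *)
Lemma len_filt_ge a b c n f T s : filt a b c n -> isub a f -> fin f a -> s = len f a ->
  fin (icap T b) (icap T c) -> (forall u r, b u -> f r -> T (u * r)) ->
  (n * s <= len (icap T b) (icap T c))%N.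
Proof.
move=> h af ff ->; elim: h => [//|b' c1 u p h IH cu] fT hT.
have cb : isub (iadd c1 (iprin u)) b' := filt_sub h.
have s1 : isub (icap T c1) (icap T (iadd c1 (iprin u))).
  by move=> r [? ?]; split=> //; apply: iadd_subl.
have s2 : isub (icap T (iadd c1 (iprin u))) (icap T b').
  by move=> r [? ?]; split=> //; apply: cb.
have [f1 f2 ->] := fin_cut s1 s2 fT.
rewrite mulSn addnC; apply: leq_add; first exact: IH.
have [f3 l3] := len_scale (icap T c1) u f.
have s3 : isub (iadd (icap T c1) (iscale u f)) (icap T (iadd c1 (iprin u))).
  apply: iadd_min => // _ [r [fr ->]]; split; last by apply: iadd_subr; exists r.
  by apply: hT => //; apply: cb; apply: iadd_subr; apply: iprin_mem.
have [f4 f5 ->] := fin_cut (@iadd_subl _ (icap T c1) (iscale u f)) s3 f2.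
apply: leq_trans (leq_addl _ _); rewrite l3.
have s4 : isub (icap f (icolon (icap T c1) u)) a.
  by move=> r [_ [_]]; rewrite -icolonE cu.
by have [f6 f7 ->] := fin_cut s4 af (proj1 f3 f5); rewrite leq_addr.
Qed.

End CyclicFiltrations.

(** * Powers of a parameter ideal *)

Section ParameterPowers.
Variable R : comPzRingType.
Implicit Types (a b c I J K L M N Q : ideal R) (x y u v : R) (n m p q : nat).
Local Notation U := (@unit_ideal R).

(** Here [Q^(n+1) = A + y Q^n]. The Euler characteristic of [y] on [R/A] is [N] times that on [R/a],
    and [(A + yR)/Q^(n+1)] is [R/(Q^n + (A : y))]. The correction [E/A] is the part of [(A : y)]
    that lies in [Q^n]. *)
Lemma len_power_step a y n (N : nat) : let Q := iadd a (iprin y) in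
  let A := a ^i n.+1 in let E := icap (icolon A y) (Q ^i n) in
  fin U Q -> fin (icolon a y) a -> filt a U A N -> fin U (Q ^i n) ->
  [/\ fin U (Q ^i n.+1), fin E A &
    (len U (Q ^i n.+1) + N * len (icolon a y) a =
     N * len U Q + len U (Q ^i n) + len E A)%N].
Proof.
move=> Q A E fQ fa hA fQn.
have [f1 f2 E1] := filt_index fQ fa hA.
have AE : isub A E.
  move=> r Ar; split; first exact: idealM.
  apply: (@iexp_le _ Q n n.+1) => //; move: r Ar.
  by apply: iexpSub; apply: iadd_subl.
have EA : isub E (icolon A y) by move=> r [].
have [f3 f4 E2] := fin_cut AE EA f2.
have QC : isub (Q ^i n) (iadd (Q ^i n) (icolon A y)) by exact: iadd_subl.
have [f5 f6 E3] := fin_cut QC (@isub_iunit _ _) fQn.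
have [f7 l7] := len_iadd (Q ^i n) (icolon A y).
rewrite -/E in f7 l7.
have [f8 l8] := @len_scale2 _ A y U (Q ^i n) (@isub_iunit _ _).
have e8 : icap U (icolon (iadd A (iscale y (Q ^i n))) y) =
          iadd (Q ^i n) (icolon A y).
  apply: isub_anti.
    move=> r [_ [c [_ [Ac [q [Qq ->]] e]]]]; exists q, (r - q); split=> //.
      by rewrite icolonE mulrBr e addrK.
    by ring.
  move=> r [q [c [Qq Ac ->]]]; split=> //; rewrite icolonE mulrDr.
  by exists (y * c), (y * q); split=> //; [exists q | rewrite addrC].
rewrite e8 in f8 l8.
have [f9 l9] := fin_add f1 (proj2 f8 f5).
rewrite -iexp_add_prin -/Q -/A in f9 l8 l9.
split=> //; rewrite l9; move: E1 E2 E3 l7 l8; rewrite -/Q -/A.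
by rewrite /iprin; lia.
Qed.

Lemma icap_idr a b : isub a b -> icap b a = a.
Proof. by move=> h; apply: ideal_eq => r; split=> [[]//|ar]; split=> //; apply: h. Qed.

Lemma icap_idl a b : isub a b -> icap a b = a.
Proof. by rewrite icapC; apply: icap_idr. Qed.

(** Since [(a : y) a^n] lies in [(a^(n+1) : y)], each of the [rk n] copies of [R/a] in [a^n/a^(n+1)]
    contributes at least [s] to the correction term of [len_power_step]. *)
Lemma len_power_ge a y rk e n : let Q := iadd a (iprin y) in
  let s := len (icolon a y) a in
  fin U Q -> fin (icolon a y) a -> powers_filtered a rk ->
  len U Q = (e + s)%N ->
  fin U (Q ^i n) /\
  (\sum_(m < n) (e * (\sum_(j < m.+1) rk j) + s * rk m) <= len U (Q ^i n))%N.
Proof.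
move=> Q s fQ fa hp he; elim: n => [|n [IHf IH]].
  by have [h1 h2] := fin_id U; rewrite big_ord0.
have [h1 h2 h3] := len_power_step fQ fa (powers_filtered_sum n.+1 hp) IHf.
split=> //; rewrite big_ord_recr /=.
rewrite -/Q -/s he in h2 h3.
set T := icolon (a ^i n.+1) y in h2 h3.
have hT u r : (a ^i n) u -> icolon a y r -> T (u * r).
  move=> anu ayr; rewrite /T icolonE mulrCA iexpS imulC.
  exact: imul_mem.
have aT : isub (a ^i n.+1) T by move=> r ar; apply: idealM.
have s1 : isub (a ^i n.+1) (icap T (a ^i n)).
  by move=> r ar; split; [apply: aT | apply: iexp_le ar].
have s2 : isub (icap T (a ^i n)) (icap T (Q ^i n)).
  by move=> r [h h']; split=> //; apply: (iexpSub _ h'); apply: iadd_subl.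
have [f1 f2 l1] := fin_cut s1 s2 h2.
have := @len_filt_ge _ a (a ^i n) (a ^i n.+1) (rk n) (icolon a y) T s (hp n)
  (@icolon_sub _ _ _) fa erefl.
rewrite (icap_idr aT) => /(_ f2 hT) l2.
move: h3 IH l1 l2; set X := (\sum_(m < n) _)%N; set S := (\sum_(j < n.+1) _)%N.
rewrite mulnDr; lia.
Qed.

Lemma nzd_colon a y : nzd a y -> icolon a y = a.
Proof.
by move=> h; apply: isub_anti; [move=> r; rewrite icolonE => /h | exact: icolon_sub].
Qed.

Lemma len_power_eq a y rk n : let Q := iadd a (iprin y) in
  fin U Q -> nzd a y -> powers_filtered a rk ->
  len U (Q ^i n) = (\sum_(m < n) len U Q * (\sum_(j < m.+1) rk j))%N.
Proof.
move=> Q fQ ay hp; have ea := nzd_colon ay.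
have [f0 l0] := fin_id a.
have fa : fin (icolon a y) a by rewrite ea.
have fQn m : fin U (Q ^i m).
  have [|//] := @len_power_ge a y rk (len U Q) m fQ fa hp.
  by rewrite ea l0 addn0.
elim: n => [|n IH]; first by rewrite big_ord0; have [_ ->] := fin_id U.
have hA := powers_filtered_sum n.+1 hp.
have [h1 h2 h3] := len_power_step fQ fa hA (fQn n).
rewrite big_ord_recr -IH; move: h3; rewrite ea l0 muln0 addn0 -/Q => ->.
have -> : icolon (a ^i n.+1) y = a ^i n.+1.
  by apply: nzd_colon; apply: filt_nzd hA ay _.
rewrite icap_idl; last first.
  apply: isub_trans (iexp_le (leqnSn n)); apply: iexpSub; exact: iadd_subl.
by have [_ ->] := fin_id (a ^i n.+1); rewrite addn0 addnC mulnC.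
Qed.

Definition powers_generated a (rk : nat -> nat) :=
  forall n, exists s : seq R, size s = rk n /\ a ^i n = generated_by s.

Lemma gen_scale x (s : seq R) :
  generated_by [seq x * u | u <- s] = iscale x (generated_by s).
Proof.
elim: s => [|u s IH].
  rewrite /= gen_nil; apply: ideal_eq => r; split=> [->|[_ [-> ->]]].
    by exists 0; rewrite mulr0.
  by rewrite mulr0.
by rewrite /= !gen_cons iscaleD IH /iprin iscaleM.
Qed.

Lemma powers_generated_step b x rk : powers_generated b rk ->
  powers_generated (iadd b (iprin x)) (fun n => \sum_(j < n.+1) rk j)%N.
Proof.
move=> h; elim=> [|n [s [hs IH]]].
  have [s [hs e]] := h 0%N; exists s; split; first by rewrite big_ord1.
  by rewrite -e !iexp0.
have [t [ht e]] := h n.+1; exists ([seq x * u | u <- s] ++ t); split.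
  by rewrite size_cat size_map hs ht [RHS]big_ord_recr.
by rewrite iexp_add_prin IH e gen_cat gen_scale iaddC.
Qed.

(** Each generator [u] adds a cyclic module killed by [T], hence a quotient of [R/T]. *)
Lemma len_add_gens J (T : ideal R) (s : seq R) : fin U T ->
  (forall u, u \in s -> isub T (icolon J u)) ->
  fin (iadd J (generated_by s)) J /\
  (len (iadd J (generated_by s)) J <= size s * len U T)%N.
Proof.
move=> fT; elim: s J => [|u s IH] J hs.
  by rewrite gen_nil iadd0; have [h1 ->] := fin_id J.
have [v|f1 l1] := IH (iadd J (iprin u)).
  move=> vs; apply: (isub_trans (hs v _)); first by rewrite inE vs orbT.
  exact/icolonS/iadd_subl.
have [f2 l2] := len_scale J u U.
have h : isub T (icap U (icolon J u)).
  by move=> r Tr; split=> //; apply: hs Tr; rewrite inE eqxx.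
have [f3 f4 l3] := fin_cut h (@isub_iunit _ _) fT.
have [f5 l5] := fin_add f1 (proj2 f2 f3).
rewrite -/(iprin u) -iaddA -gen_cons in f5 l5 l1.
split=> //; rewrite l5 /= mulSn addnC; apply: leq_add => //.
by rewrite /iprin l2 l3 leq_addr.
Qed.

Lemma iexp_add_prin2 a y n : let Q := iadd a (iprin y) in
  Q ^i n.+1 = iadd (a *i (Q ^i n)) (iprin (y ^+ n.+1)).
Proof.
move=> Q; have yQ : Q y by apply: iadd_subr; apply: iprin_mem.
apply: isub_anti; last first.
  apply: iadd_min; last by apply: iprin_min; apply: iexp_mem.
  by rewrite iexpS; apply: imulS => //; apply: iadd_subl.
elim: n => [|n IH].
  rewrite iexp1 iexp0 imulC imul1 expr1; exact: isub_refl.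
rewrite [X in isub X _]iexpS {1}/Q imulDl; apply: iadd_min; first exact: iadd_subl.
apply: isub_trans (imulS (@isub_refl _ _) IH) _.
rewrite imulDr; apply: iaddS.
  rewrite imulC -imulA; apply: imulS => //; rewrite imulC [X in isub _ X]iexpS.
  by apply: imulS => //; apply: iadd_subr.
by rewrite imul_prin /iprin iscaleM -exprS.
Qed.

(* The layers of the filtration [a^j Q^(n-j)] of [Q^n] modulo [I^(n+m)] are
   generated by the monomials [x^alpha y^(n-j)] with [|alpha| = j], which are
   killed by [I^m] and, unless [j = n], by [a], since
   [x_i x^alpha y^(n-j) = y (x_i x^alpha y^(n-j-1))]. *)
Lemma len_power_le a y I rk n m : let Q := iadd a (iprin y) in
  isub Q I -> powers_generated a rk -> fin U (I ^i (n + m)) -> fin U (Q ^i n) ->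
  (len U (I ^i (n + m)) <= len U (Q ^i n) +
    (\sum_(j < n) rk j) * len U (iadd (I ^i m) a) + rk n * len U (I ^i m))%N.
Proof.
move=> Q QI hg fJ fQ; set J := I ^i (n + m) in fJ *.
have aI : isub a I by apply: isub_trans QI; apply: iadd_subl.
have yI : I y by apply: QI; apply: iadd_subr; apply: iprin_mem.
have JIm : isub J (I ^i m) by apply: iexp_le; rewrite leq_addl.
have [fIm _ _] := fin_cut JIm (@isub_iunit _ _) fJ.
have [fIa _ _] := fin_cut (@iadd_subl _ _ a) (@isub_iunit _ _) fIm.
set h := len U (iadd _ a).
suff main l j : (l + j = n)%N ->
    (len (iadd J ((a ^i j) *i (Q ^i l))) J <=
     (\sum_(j <= i < n) rk i) * h + rk n * len U (I ^i m))%N.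
  have := main n 0%N; rewrite addn0 => /(_ erefl); rewrite imul1 big_mkord => l1.
  have [f1 f2 ->] := fin_cut (@iadd_subl _ J (Q ^i n)) (@isub_iunit _ _) fJ.
  rewrite -addnA; apply: leq_add => //.
  by have [f3 _ ->] := fin_cut (@iadd_subr _ J (Q ^i n)) (@isub_iunit _ _) fQ;
    rewrite leq_addr.
elim: l j => [|l IH] j hj.
  rewrite add0n in hj; subst j.
  have [s [hs e]] := hg n; rewrite imulC imul1 e -hs.
  have [u us|_ l1] := @len_add_gens J (I ^i m) s fIm.
    move=> r Ir; rewrite icolonE; rewrite /J iexpD; apply: imul_mem => //.
    by apply: (iexpSub aI); rewrite e; apply: gen_mem.
  by apply: leq_trans l1 _; rewrite leq_addl.
have hj' : (l + j.+1 = n)%N by rewrite addnS -addSn.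
have jn : (j < n)%N by rewrite -hj' addnS ltnS leq_addl.
rewrite big_ltn // mulnDl -addnA; set F := iadd J _.
pose F' := iadd J (a ^i j.+1 *i Q ^i l).
have [s [hs e]] := hg j.
have eF : F = iadd F' (generated_by [seq y ^+ l.+1 * u | u <- s]).
  rewrite /F /F' -iaddA; congr (iadd _ _).
  rewrite gen_scale -e iexp_add_prin2 -/Q imulDr imulA; congr (iadd _ _).
    by rewrite iexpS [a *i _]imulC.
  by rewrite imulC imul_prin.
have [|u|f1 l1] := @len_add_gens F' (iadd (I ^i m) a) [seq y ^+ l.+1 * u | u <- s].
- exact: fIa.
- move=> /mapP [v vs ->]; have av : (a ^i j) v by rewrite e; apply: gen_mem.
  apply: iadd_min => r hr; rewrite icolonE.
    apply: iadd_subl; rewrite /J -hj iexpD; apply: imul_mem => //.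
    by rewrite iexpD; apply: imul_mem; [exact: iexp_mem | exact: iexpSub av].
  apply: iadd_subr; have -> : y ^+ l.+1 * v * r = (r * v) * y ^+ l.+1 by ring.
  apply: imul_mem; first by rewrite iexpS; apply: imul_mem.
  apply: (@iexp_le _ _ l l.+1) => //; apply: iexp_mem; apply: iadd_subr.
  exact: iprin_mem.
have IHj := IH j.+1 hj'.
have F'J : isub J F' by exact: iadd_subl.
have [f2 f3 _] := fin_cut F'J (@isub_iunit _ _) fJ.
rewrite -eF in f1 l1.
have [_ ->] := fin_add f1 f3.
by apply: leq_add; [rewrite -hs -(size_map (fun u => y ^+ l.+1 * u)) | exact: IHj].
Qed.

End ParameterPowers.

(** * Hilbert functions and superficial elements *)

Section Noetherian.
Variable R : comPzRingType.
Hypothesis noeth : noetherian R.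
Implicit Types (a b I J K L B C : ideal R) (x y u v : R) (n p q : nat).

(** Otherwise choice builds a strictly increasing sequence; its union is finitely generated, hence
    reached at a finite stage. *)
Lemma noeth_max (P : ideal R -> Prop) J0 : P J0 ->
  exists K, [/\ P K, isub J0 K & forall K', P K' -> isub K K' -> isub K' K].
Proof.
move=> P0; apply: contrapT => hno.
pose T := {K : ideal R | P K /\ isub J0 K}.
have step (t : T) : {t' : T | isub (sval t) (sval t') /\ ~ isub (sval t') (sval t)}.
  apply: cid; apply: contrapT => h; apply: hno; exists (sval t).
  case: t h => K [PK J0K] /= h; split=> // K' PK' KK'; apply: contrapT => nK.
  have q : P K' /\ isub J0 K' by split=> //; apply: isub_trans KK'.
  by apply: h; exists (exist _ K' q).
pose t0 : T := exist _ J0 (conj P0 (@isub_refl _ J0)).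
pose f n := sval (iter n (fun t => sval (step t)) t0).
have fS n : isub (f n) (f n.+1) /\ ~ isub (f n.+1) (f n).
  by rewrite /f iterS; case: (step _).
have fm n m : (n <= m)%N -> isub (f n) (f m).
  move=> /subnK <-; elim: (m - n)%N => // k IH.
  by apply: isub_trans IH _; case: (fS (k + n)%N).
have [V VE] : exists V : ideal R, forall x, V x <-> exists n, f n x.
  pose W x := exists n, f n x.
  have W0 : W 0 by exists 0%N; apply: ideal0.
  have WD x y : W x -> W y -> W (x + y).
    move=> [n fx] [m fy]; exists (maxn n m); apply: idealD.
      by apply: fm fx; rewrite leq_maxl.
    by apply: fm fy; rewrite leq_maxr.
  have WM z x : W x -> W (z * x) by move=> [n fx]; exists n; apply: idealM.
  by exists (Ideal W0 WD WM).
have [s /ideal_set_inj Vs] := noeth V.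
have [n hn] : exists n, forall x, x \in s -> f n x.
  have : forall x, x \in s -> exists n, f n x.
    by move=> x xs; apply/VE; rewrite Vs; apply: gen_mem.
  elim: s {Vs} => [|x s IH] hs; first by exists 0%N.
  have [|n hn] := IH; first by move=> z zs; apply: hs; rewrite inE zs orbT.
  have [m fx] := hs x (mem_head _ _); exists (maxn n m) => z.
  rewrite inE => /orP[/eqP ->|/hn fz]; first by apply: fm fx; rewrite leq_maxr.
  by apply: fm fz; rewrite leq_maxl.
have [_] := fS n; apply => x fx; have : V x by apply/VE; exists n.+1.
by rewrite Vs; apply: (generated_min (I := f n)).
Qed.

Lemma iexp_gen_sub (s : seq R) K : (forall x, x \in s -> exists n, K (x ^+ n)) ->
  exists N, isub ((generated_by s) ^i N) K.
Proof.
elim: s => [|x s IH] hs.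
  exists 1%N; rewrite iexp1 gen_nil => _ ->; exact: ideal0.
have [|N hN] := IH; first by move=> z zs; apply: hs; rewrite inE zs orbT.
have [n hn] := hs x (mem_head _ _).
exists (n + N)%N; rewrite gen_cons.
apply: isub_trans (@iexpDadd _ _ _ _ _) _; apply: iadd_min => //.
have e m : (iprin x) ^i m = iprin (x ^+ m).
  elim: m => [|m IHm]; first by rewrite /iprin expr0 iscale1.
  by rewrite iexpS IHm imul_prin /iprin iscaleM exprS.
by rewrite e; apply: iprin_min.
Qed.

Lemma iexp_sub_of_radical (m I : ideal R) : (forall x, m x -> exists n, I (x ^+ n)) ->
  exists N, isub (m ^i N) I.
Proof.
move=> rad; have [s /ideal_set_inj e] := noeth m; rewrite e; apply: iexp_gen_sub.
by move=> x xs; apply: rad; rewrite e; apply: gen_mem.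
Qed.

(* If [K] is maximal among the ideals containing [C] with [K n B = C], then
   [(K : u^m)] being stationary shows that each [u] in [I] has a power in [K]. *)
Lemma artin_rees I B C n : isub C B -> isub ((I ^i n) *i B) C ->
  exists N, isub (icap (iadd (I ^i N) C) B) C.
Proof.
move=> CB IBC.
have [|K [[CK KBC] _ Kmax]] :=
  @noeth_max (fun K => isub C K /\ isub (icap K B) C) C.
  by split=> // x [].
suff [N hN] : exists N, isub (I ^i N) K.
  exists N => x [xN xB]; apply: KBC; split=> //; move: xN; exact: iadd_min.
have [s /ideal_set_inj e] := noeth I; rewrite e; apply: iexp_gen_sub => u us.
have Iu : I u by rewrite e; apply: gen_mem.
have [|L [[m ->] _ Lmax]] :=
  @noeth_max (fun L => exists m, L = icolon K (u ^+ m)) (icolon K (u ^+ 0)).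
  by exists 0%N.
exists m; pose K' := iadd K (iprin (u ^+ m)).
suff h : isub K' K by apply: h; apply: iadd_subr; apply: iprin_mem.
apply: Kmax; last exact: iadd_subl.
split; first by apply: isub_trans CK _; apply: iadd_subl.
move=> x [[k [_ [Kk [r [_ ->]] e1]]] Bx]; apply: KBC; split=> //; rewrite e1.
apply: idealD => //.
suff : icolon K (u ^+ m) r by [].
apply: (Lmax (icolon K (u ^+ (n + m)))); first by exists (n + m)%N.
  by move=> z; rewrite !icolonE exprD -mulrA => h; apply: idealM.
rewrite icolonE.
have -> : u ^+ (n + m) * r = u ^+ n * x - u ^+ n * k by rewrite e1 exprD; ring.
apply: idealB; last exact: idealM.
by apply/CK/IBC/imul_mem => //; apply: iexp_mem.
Qed.

Definition superf I b x := exists c, forall n, (c <= n)%N ->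
  isub (icap (icolon (iadd (I ^i n.+1) b) x) (iadd (I ^i c) b)) (iadd (I ^i n) b).

Lemma superf_colon I b x : nzd b x -> I x -> superf I b x -> exists n0, forall n,
  (n0 <= n)%N -> icolon (iadd (I ^i n.+1) b) x = iadd (I ^i n) b.
Proof.
move=> bx Ix [c hc].
pose B := iadd b (iprin x); pose C := iadd b (iscale x (I ^i c)).
have [||N hN] := @artin_rees I B C c.
- by apply: iaddS => //; apply: iscaleS.
- rewrite imulDr; apply: iaddS; first exact: imul_subr.
  by rewrite imulC imul_prin.
exists (maxn c N) => n; rewrite geq_max => /andP[cn Nn].
apply: isub_anti => [r xr|].
  apply: hc => //; split=> //.
  have [|b0 [_ [bb0 [v [Iv ->]] e]]] := hN (x * r).
    split; last by apply: iadd_subr; exists r.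
    move: xr; rewrite icolonE; apply: iaddS; last exact: iadd_subl.
    by apply: iexp_le; apply: leq_trans (leqnSn _).
  rewrite -(subrK v r); exists v, (r - v); split; [by [] | | by ring].
  by apply: bx; rewrite mulrBr e addrK.
apply: iadd_min => r h; rewrite icolonE; last first.
  by apply: iadd_subr; apply: idealM.
by apply: iadd_subl; rewrite iexpS; apply: imul_mem.
Qed.

End Noetherian.

(** * Hilbert polynomials and orders of growth *)

Definition hilbF d (c : nat -> int) n : int :=
  \sum_(i < d.+1) (-1) ^+ i * c i * ('C(n + d - 1 - i, d - i))%:Z.

Lemma hilbF_diff d c n : hilbF d.+1 c n.+1 - hilbF d.+1 c n = hilbF d c n.+1.
Proof.
rewrite /hilbF !(big_ord_recr d.+1) /= subnn !bin0 opprD addrACA subrr addr0.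
rewrite -sumrB; apply: eq_bigr => i _; rewrite -mulrBr; congr (_ * _).
have hi : (i <= d)%N by rewrite -ltnS.
have -> : (n.+1 + d.+1 - 1 - i = (n + d - i).+1)%N by lia.
have -> : (n + d.+1 - 1 - i = n + d - i)%N by lia.
have -> : (n.+1 + d - 1 - i = n + d - i)%N by lia.
by rewrite subSn // binS PoszD addrC addKr.
Qed.

Definition hil (R : comPzRingType) (I b : ideal R) d c := exists n0, forall n,
  (n0 <= n)%N -> fin unit_ideal (iadd (I ^i n) b) /\
    (len unit_ideal (iadd (I ^i n) b))%:Z = hilbF d c n.

(** The length of [R/(I^(n+1) + b + xR)] is that of [R/(I^(n+1) + b)] minus that of [R/(I^n + b)].
    Cutting by [x] thus takes a first difference, which keeps every coefficient but the last. *)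
Lemma hil_step (R : comPzRingType) (I b : ideal R) x d c n0 :
  (forall n, (n0 <= n)%N -> icolon (iadd (I ^i n.+1) b) x = iadd (I ^i n) b) ->
  hil I b d.+1 c -> hil I (iadd b (iprin x)) d c.
Proof.
move=> hcol [n1 h1]; exists (maxn n0 n1).+1 => -[//|n]; rewrite ltnS geq_max.
move=> /andP[hn0 hn1].
have [f1 l1] := h1 _ hn1; have [f2 l2] := h1 _ (leqW hn1).
have [f3 f4 l3] := fin_cut (@iadd_subl _ (iadd (I ^i n.+1) b) (iprin x))
  (@isub_iunit _ _) f2.
have [f5 l5] := len_scale (iadd (I ^i n.+1) b) x unit_ideal.
rewrite iaddA; split=> //.
rewrite -hilbF_diff -l1 -l2 l3 /iprin l5 hcol //.
have -> : icap unit_ideal (iadd (I ^i n) b) = iadd (I ^i n) b.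
  by apply: icap_idr; apply: isub_iunit.
by rewrite PoszD addrK.
Qed.

(* [low k f] means [f n = O(n^(k-1))], with the convention that it means
   [f n = 0] for large [n] when [k = 0]. *)
Definition low k (f : nat -> int) := exists C n0 : nat, forall n, (n0 <= n)%N ->
  `|f n| * n%:Z <= (C * n ^ k)%N%:Z.

Lemma low0 k : low k (fun=> 0).
Proof. by exists 0%N, 0%N => n _; rewrite normr0 mul0r. Qed.

Lemma low_add k f g : low k f -> low k g -> low k (fun n => f n + g n).
Proof.
move=> [C [n0 hf]] [D [n1 hg]]; exists (C + D)%N, (maxn n0 n1) => n.
rewrite geq_max => /andP[/hf h1 /hg h2].
rewrite mulnDl PoszD; apply: le_trans (lerD h1 h2); rewrite -mulrDl.
by apply: ler_wpM2r => //; apply: ler_normD.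
Qed.

Lemma low_scale k f z : low k f -> low k (fun n => z * f n).
Proof.
move=> [C [n0 hf]]; exists (`|z|%N * C)%N, n0 => n /hf h.
rewrite normrM -mulrA -mulnA PoszM abszE; exact: ler_wpM2l.
Qed.

Lemma low_sum k m (f : nat -> nat -> int) : (forall i, (i < m)%N -> low k (f i)) ->
  low k (fun n => \sum_(i < m) f i n).
Proof.
elim: m => [|m IH] h.
  by have := low0 k; rewrite /low => -[C [n0 hh]]; exists C, n0 => n hn; rewrite big_ord0; apply: hh.
have [|C [n0 hh]] := @low_add k (fun n => \sum_(i < m) f i n) (f m) (IH _) (h m (leqnn _)).
  by move=> i hi; apply: h; apply: leqW.
by exists C, n0 => n hn; rewrite big_ord_recr; apply: hh.
Qed.

Lemma low_eq k f g n1 : (forall n, (n1 <= n)%N -> f n = g n) -> low k f -> low k g.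
Proof.
move=> e [C [n0 h]]; exists C, (maxn n0 n1) => n; rewrite geq_max => /andP[h0 h1].
by rewrite -e //; apply: h.
Qed.

Lemma leq_bin_exp n j : ('C(n, j) <= n ^ j)%N.
Proof.
apply: leq_trans (_ : 'C(n, j) * j`! <= _)%N; first by rewrite leq_pmulr ?fact_gt0.
rewrite bin_ffact; elim: j n => [|j IH] n; first by rewrite ffactn0.
rewrite ffactnS expnS; case: n => [|n]; first by rewrite mul0n.
apply: leq_mul => //; apply: (leq_trans (IH n)).
by case: j {IH} => // j; rewrite leq_exp2r // leqnSn.
Qed.

Lemma low_bin k c j : (j < k)%N -> low k (fun n => ('C(n + c, j))%:Z).
Proof.
move=> jk; exists (c.+1 ^ j)%N, 1%N => n n1.
rewrite ger0_norm // -PoszM lez_nat.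
apply: leq_trans (_ : (n + c) ^ j * n <= _)%N.
  by rewrite leq_mul2r leq_bin_exp orbT.
apply: leq_trans (_ : (c.+1 * n) ^ j * n <= _)%N.
  rewrite leq_mul2r; apply/orP; right.
  case: j {jk} => // j; rewrite leq_exp2r // mulSn leq_add2l.
  by rewrite leq_pmulr.
by rewrite expnMn -mulnA leq_mul2l -expnSr leq_pexp2l ?orbT.
Qed.

Lemma leq_exp_bin n k : (n ^ k <= k`! * 'C(n + k - 1, k))%N.
Proof.
rewrite mulnC bin_ffact; case: k => // k; rewrite addnS subSS subn0.
elim: k => [|k IH]; first by rewrite addn0 expn1 ffactn1.
rewrite expnSr addnS ffactnS /= mulnC; apply: leq_mul; last exact: IH.
by rewrite leqW // leq_addr.
Qed.

(** If [c <= -1], the binomial, at least [n^k/k!], is bounded by [|f n|], which is at most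
    [C n^(k-1)]; this fails for [n > C k!]. All comparisons of Hilbert coefficients go through this
    lemma. *)
Lemma lead_ge0 k c f : low k f ->
  (exists n0, forall n, (n0 <= n)%N -> 0 <= c * ('C(n + k - 1, k))%:Z + f n) -> 0 <= c.
Proof.
move=> [C [n0 hf]] [n1 h1]; rewrite leNgt; apply/negP => c0.
pose n := maxn (maxn n0 n1) (C * k`!).+1.
have hn0 : (n0 <= n)%N by rewrite /n; lia.
have hn1 : (n1 <= n)%N by rewrite /n; lia.
have hn2 : (C * k`! < n)%N by rewrite /n; lia.
have n_gt0 : (0 < n)%N by apply: leq_ltn_trans hn2.
have H1 := hf n hn0; have H2 := h1 n hn1; have H3 := leq_exp_bin n k.
have H4 : ('C(n + k - 1, k))%:Z <= `|f n|.
  apply: le_trans (ler_norm _); nia.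
have H5 : ('C(n + k - 1, k) * n <= C * n ^ k)%N.
  rewrite -lez_nat PoszM; apply: le_trans H1; exact: ler_wpM2r.
have H6 : (n * n ^ k <= (C * k`!) * n ^ k)%N.
  apply: leq_trans (_ : n * (k`! * 'C(n + k - 1, k)) <= _)%N.
    by rewrite leq_mul2l H3 orbT.
  have -> : (n * (k`! * 'C(n + k - 1, k)) = k`! * ('C(n + k - 1, k) * n))%N by lia.
  have -> : (C * k`! * n ^ k = k`! * (C * n ^ k))%N by lia.
  by rewrite leq_mul2l H5 orbT.
move: H6; rewrite leq_mul2r expn_eq0 -leqn0 leqNgt n_gt0 /= => H6.
by move: hn2; rewrite ltnNge H6.
Qed.

(** * The one-dimensional quotient *)

Section ReductionOfPowers.
Variable R : comPzRingType.
Implicit Types (a b I J K L B C Q : ideal R) (x y u v : R) (n p q r : nat).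

Lemma reduction_powers Q I r n : Q *i (I ^i r) = I ^i r.+1 ->
  I ^i (n + r) = (Q ^i n) *i (I ^i r).
Proof.
move=> h; elim: n => [|n IH]; first by rewrite imul1.
by rewrite addSn iexpS IH iexpS [I *i _]imulC -imulA [_ *i I]imulC -iexpS -h imulA
  [_ *i Q]imulC.
Qed.

Lemma reduction_powersS Q I r n : Q *i (I ^i r) = I ^i r.+1 -> (r <= n)%N ->
  Q *i (I ^i n) = I ^i n.+1.
Proof.
move=> h /subnK <-; rewrite -addSn !(reduction_powers _ h) iexpS imulA //.
Qed.

(** At most [len X Y] inclusions are strict, and no strict inclusion follows a stationary one, so
    all strict inclusions occur before index [len X Y]. *)
Lemma chain_stable (X Y : ideal R) (D : nat -> ideal R) l : fin X Y ->
  (forall j, (j <= l)%N -> isub Y (D j) /\ isub (D j) X) ->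
  (forall j, (j < l)%N -> isub (D j) (D j.+1)) ->
  (forall j, (j.+1 < l)%N -> isub (D j.+1) (D j) -> isub (D j.+2) (D j.+1)) ->
  D l = X -> (len X Y <= l)%N -> isub X (D (len X Y)).
Proof.
move=> fXY Dbt Dm Dst DX hl.
have mono i j : (i <= j)%N -> (j <= l)%N -> isub (D i) (D j).
  move=> /subnK <-; elim: (j - i)%N => [_|k IH hk]; first exact: isub_refl.
  by apply: isub_trans (IH (ltnW hk)) _; apply: Dm.
have stab j : (j < l)%N -> isub (D j.+1) (D j) -> isub X (D j).
  move=> jl hj; have {}jl : (j <= l)%N := ltnW jl.
  suff h k : (j + k < l)%N ->
      isub (D (j + k).+1) (D (j + k)%N) /\ isub (D (j + k).+1) (D j).
    rewrite -DX; case: (ltngtP j l) jl => // [jl _|-> _]; last exact: isub_refl.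
    have [|_] := h (l - j).-1; first by lia.
    by have -> : (j + (l - j).-1).+1 = l by lia.
  elim: k => [|k IH] hk; first by rewrite addn0.
  have [|h1 h2] := IH; first by lia.
  have h3 : isub (D (j + k).+2) (D (j + k).+1) by apply: Dst => //; lia.
  by rewrite addnS; split=> //; apply: isub_trans h3 h2.
have [[j jlen hj]|hno] := pselect (exists2 j, (j < len X Y)%N & isub (D j.+1) (D j)).
  apply: isub_trans (stab j _ hj) _; first exact: leq_trans hl.
  by apply: mono => //; apply: ltnW.
apply: contrapT => nX.
have ch k : (k <= len X Y)%N -> chain_to (between X Y) k (D k).
  elim: k => [|k IH] hk; first by exists (fun=> D 0%N); split=> // i _; apply: Dbt.
  apply: chain_to_snoc (IH (ltnW hk)) _ _ _; first by apply: Dbt; apply: leq_trans hl.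
    by apply: Dm; apply: leq_trans hl.
  by move=> h; apply: hno; exists k.
have XP : between X Y X by split=> //; apply: fin_sub fXY.
have [_ DlX] := Dbt _ hl.
have := len_chain fXY (chain_to_chain (chain_to_snoc (ch _ (leqnn _)) XP DlX nX)).
by rewrite ltnn.
Qed.

End ReductionOfPowers.

(** * Multiplicity and torsion of [R/a] *)

Section OneDimensional.
Variable R : comPzRingType.
Hypothesis noeth : noetherian R.
Variables (a I : ideal R) (y : R) (r : nat).
Local Notation U := (@unit_ideal R).
Let Q := iadd a (iprin y).
Hypothesis QI : isub Q I.
Hypothesis red : Q *i (I ^i r) = I ^i r.+1.
Let h n := len U (iadd (I ^i n) a).
Hypothesis finh : forall n, fin U (iadd (I ^i n) a).
Variables (e e1 : int) (n1 : nat).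
Hypothesis hE : forall n, (n1 <= n)%N -> (h n)%:Z = e * n%:Z - e1.

Let aI : isub a I. Proof. by apply: isub_trans QI; apply: iadd_subl. Qed.
Let Iy : I y. Proof. by apply: QI; apply: iadd_subr; apply: iprin_mem. Qed.

(** [W] is the stationary value of [(a : y^k)], so [W/a] is the torsion of [R/a]. It is killed by a
    power of [I], since [I^(k+r) = Q^k I^r] and [Q^k] lies in [a + y^k R]; by Artin-Rees it
    therefore meets large powers of [I] trivially. *)
Lemma saturation : exists W N, [/\ isub (icolon a y) W, nzd W y,
  isub (icap (iadd (I ^i N) a) W) a & isub (I ^i N *i W) a].
Proof.
have [|W [[k ->] _ Wmax]] := @noeth_max _ noeth
    (fun L => exists k, L = icolon a (y ^+ k)) (icolon a (y ^+ 0)).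
  by exists 0%N.
have sW k' : isub (icolon a (y ^+ (k' + k))) (icolon a (y ^+ k)).
  apply: Wmax; first by exists (k' + k)%N.
  by move=> u; rewrite !icolonE exprD -mulrA => hu; apply: idealM.
exists (icolon a (y ^+ k)).
have kill : isub ((I ^i (k + r)) *i icolon a (y ^+ k)) a.
  rewrite (reduction_powers k red) -imulA [_ *i icolon _ _]imulC imulA.
  apply: isub_trans (@imul_subl _ _ _) _.
  have QE : isub (Q ^i k) (iadd a (iprin (y ^+ k))).
    case: (k) => [|k']; last by rewrite iexp_add_prin2; apply: iaddS => //; exact: imul_subl.
    by rewrite expr0 /iprin iscale1; apply: iadd_subr.
  apply: imul_min => u v /QE [b [_ [ab [z [_ ->]] ->]]] hv; rewrite mulrDl.
  by apply: idealD; [exact: ideal_mulr | rewrite mulrAC; apply: ideal_mulr].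
have aW : isub a (icolon a (y ^+ k)) by exact: icolon_sub.
have [N hN] := artin_rees noeth aW kill.
exists (maxn N (k + r)); split.
- move=> u; rewrite icolonE => hu; apply: (sW 1%N); rewrite icolonE exprD expr1.
  by have -> : y * y ^+ k * u = y ^+ k * (y * u) by [ring]; apply: idealM.
- move=> u; rewrite icolonE => hu; apply: (sW 1%N); rewrite icolonE exprD expr1.
  by have -> : y * y ^+ k * u = y ^+ k * (y * u) by [ring].
- move=> u [hu hW]; apply: hN; split=> //; move: u hu {hW}.
  by apply: iaddS => //; apply: iexp_le; rewrite leq_maxl.
- by apply: isub_trans kill; apply: imulS => //; apply: iexp_le; rewrite leq_maxr.
Qed.

Section Saturated.
Variables (W : ideal R) (N0 : nat).
Hypothesis sW : isub (icolon a y) W.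
Hypothesis nzW : nzd W y.
Hypothesis W0 : isub (icap (iadd (I ^i N0) a) W) a.
Hypothesis IW : isub (I ^i N0 *i W) a.

Let aW : isub a W. Proof. by apply: isub_trans sW; apply: icolon_sub. Qed.

Lemma nzd_exp k : nzd W (y ^+ k).
Proof.
elim: k => [|k IH] u; first by rewrite mul1r.
by rewrite exprS -mulrA => /nzW /IH.
Qed.

(** This is the multiplicity, by [eps_e]. The function [sg] is tractable because [y] is regular
    modulo [W]; up to the constant [len W a] it differs from [h] by [om]. *)
Let eps := len U (iadd W (iprin y)).
Let Wn n := icap W (iadd (I ^i n) a).
Let om n := len (Wn n) a.
Let sg n := len U (iadd (I ^i n) W).

Lemma Wn_large n : (N0 <= n)%N -> Wn n = a.
Proof.
move=> hn; apply: isub_anti => [u [Wu hu]|u au].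
  by apply: W0; split=> //; move: hu; apply: iaddS => //; apply: iexp_le.
by split; [apply: aW | apply: iadd_subr].
Qed.

Lemma fin_Wa : fin W a.
Proof.
have [f _] := len_iadd (iadd (I ^i N0) a) W.
have fN := finh N0.
have [_ f2 _] := fin_cut (@iadd_subl _ _ W) (@isub_iunit _ _) fN.
by move: (proj1 f f2); rewrite -/(Wn N0) Wn_large.
Qed.

Lemma a_Wn n : isub a (Wn n).
Proof. by move=> u au; split; [apply: aW | apply: iadd_subr]. Qed.

Lemma sat_split n : [/\ fin (Wn n) a, fin U (iadd (I ^i n) W) &
  (h n + om n = sg n + len W a)%N].
Proof.
have [f1 l1] := len_iadd (iadd (I ^i n) a) W.
have e1' : iadd (iadd (I ^i n) a) W = iadd (I ^i n) W by rewrite -iaddA (iadd_idl aW).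
rewrite e1' -/(Wn n) in f1 l1.
have s1 : isub (iadd (I ^i n) a) (iadd (I ^i n) W) by apply: iaddS.
have [f2 f3 l2] := fin_cut s1 (@isub_iunit _ _) (finh n).
have s2 : isub (Wn n) W by move=> u [].
have [f4 f5 l3] := fin_cut (@a_Wn n) s2 fin_Wa.
by split=> //; rewrite /h /sg /om l2 l3 l1; lia.
Qed.

Lemma colon_yIn n : icap U (icolon (iadd W (iscale y (I ^i n))) y) = iadd (I ^i n) W.
Proof.
apply: isub_anti => u.
  move=> [_ [b [_ [Wb [v [Iv ->]] e0]]]]; exists v, (u - v); split=> //; last by ring.
  by apply: nzW; rewrite mulrBr e0 addrK.
move=> [v [b [Iv Wb ->]]]; split=> //; rewrite icolonE mulrDr addrC.
by exists (y * b), (y * v); split=> //; [exact: idealM | exists v].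
Qed.

Lemma sg_step n : isub (I ^i n.+1) (iadd W (iscale y (I ^i n))) ->
  sg n.+1 = (eps + sg n)%N.
Proof.
move=> hn.
have e0 : iadd (I ^i n.+1) W = iadd W (iscale y (I ^i n)).
  apply: isub_anti; first by apply: iadd_min => //; exact: iadd_subl.
  rewrite iaddC; apply: iaddS => //; rewrite -imul_prin iexpS; apply: imulS => //.
  exact: iprin_min.
have [f1 l1] := @len_scale2 _ W y U (I ^i n) (@isub_iunit _ _).
rewrite colon_yIn in f1 l1.
have [_ fn _] := sat_split n.+1.
have s1 : isub (iadd W (iscale y (I ^i n))) (iadd W (iprin y)).
  by apply: iaddS => //; apply: iscaleS.
rewrite /sg e0; rewrite e0 in fn.
have [f2 f3 ->] := fin_cut s1 (@isub_iunit _ _) fn.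
by rewrite /eps /iprin l1.
Qed.

Lemma red_step n : (r <= n)%N -> isub (I ^i n.+1) (iadd W (iscale y (I ^i n))).
Proof.
move=> rn; rewrite -(reduction_powersS red rn) imulDl imul_prin; apply: iaddS => //.
by apply: isub_trans aW; apply: imul_subl.
Qed.

Lemma om_large n : (N0 <= n)%N -> om n = 0%N.
Proof. by move=> hn; rewrite /om Wn_large //; have [_ ->] := fin_id a. Qed.

Lemma eps_e : e = eps%:Z.
Proof.
pose n := maxn n1 (maxn N0 r).
have h1 := hE (_ : n1 <= n)%N; have h2 := hE (_ : n1 <= n.+1)%N.
have {}h1 : (h n)%:Z = e * n%:Z - e1 by apply: h1; rewrite /n; lia.
have {}h2 : (h n.+1)%:Z = e * n.+1%:Z - e1 by apply: h2; rewrite /n; lia.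
have [_ _ h3] := sat_split n; have [_ _ h4] := sat_split n.+1.
rewrite om_large in h3; last by rewrite /n; lia.
rewrite om_large in h4; last by rewrite /n; lia.
have h5 : sg n.+1 = (eps + sg n)%N by apply/sg_step/red_step; rewrite /n; lia.
lia.
Qed.

(* Modulo [W], the images of [y^(N-j) I^j] in [I^N / y I^N], a module of length
   [eps], increase until they become stationary. *)
Lemma power_form_large N : (r <= N)%N -> (eps <= N)%N ->
  isub (I ^i N) (iadd W (iscale (y ^+ (N - eps.-1)) (I ^i eps.-1))).
Proof.
move=> rN eN; set i := eps.-1; have iN : (i <= N)%N by rewrite /i; lia.
pose Y := iadd W (iscale y (I ^i N)).
pose X := iadd W (I ^i N).
pose G j := iadd Y (iscale (y ^+ (N - j)) (I ^i j)).
(* With [Y] in front, at most [eps] inclusions of the chain are strict, and [D eps] is [G eps.-1]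
   for positive [eps]: hence the exponent [eps.-1]. *)
pose D j := if j is j'.+1 then G j' else Y.
have GX j : (j <= N)%N -> isub (G j) X.
  move=> jN; apply: iadd_min; first by apply: iaddS => //; apply: iscale_sub.
  move=> u h'; apply: iadd_subr; move: u h'; rewrite -imul_prin -{2}(subnK jN) iexpD.
  by apply: imulS => //; apply: iprin_min; apply: iexp_mem.
have eX : iadd (I ^i N) W = X by rewrite iaddC.
have YX : isub Y X by apply: iaddS => //; apply: iscale_sub.
have eY : iadd (I ^i N.+1) W = Y.
  apply: isub_anti; first by apply: iadd_min; [exact: red_step | exact: iadd_subl].
  rewrite iaddC; apply: iaddS => //; rewrite -imul_prin iexpS; apply: imulS => //.
  exact: iprin_min.
have [_ fY _] := sat_split N.+1; rewrite eY in fY.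
have [f1 f2 l1] := fin_cut YX (@isub_iunit _ _) fY.
have lXY : len X Y = eps.
  by have := sg_step (red_step rN); rewrite /sg eY eX; lia.
have IY : isub (I *i Y) (iadd W (iscale y Y)).
  rewrite imulDr; apply: iadd_min.
    by apply: isub_trans (@imul_subr _ _ _) _; apply: iadd_subl.
  rewrite imulC imul_scale imulC -iexpS.
  by move=> u h'; apply: iadd_subr; move: u h'; apply: iscaleS; exact: red_step.
have cancel_y u (Z : ideal R) : isub W Z -> iadd W (iscale y Z) (y * u) -> Z u.
  move=> WZ [b [_ [Wb [v [Zv ->]] e0]]]; rewrite -(subrK v u); apply: idealD => //.
  by apply/WZ/nzW; rewrite mulrBr e0 addrK.
have Wsub j : isub W (G j) by move=> u h'; do 2 apply: iadd_subl.
(* Stationarity propagates: [y^(N-j) I^(j+1)] lies in [I Z], hence in [W + y G_j], and cancelling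
   one [y] modulo [W] puts [y^(N-j-1) I^(j+1)] into [G_j]. *)
have stepG Z j : (j < N)%N -> isub (iscale (y ^+ (N - j)) (I ^i j)) Z ->
    isub (I *i Z) (iadd W (iscale y (G j))) -> isub (G j.+1) (G j).
  move=> jN hZ hIZ; apply: iadd_min; first exact: iadd_subl.
  move=> _ [u [Iu ->]]; apply: cancel_y; first exact: Wsub.
  rewrite mulrA -exprS -subSn // subSS.
  suff : isub (I ^i j.+1) (icolon (iadd W (iscale y (G j))) (y ^+ (N - j))) by apply.
  rewrite iexpS; apply: imul_min => b c Ib Ic; rewrite icolonE mulrCA.
  by apply: hIZ; apply: imul_mem => //; apply: hZ; apply: iscale_mem.
have := @chain_stable _ X Y D N.+1 f2; rewrite lXY => /(_ _ _ _ _ _) hst.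
have Xi : isub X (G i).
  have : isub X (D eps).
    apply: hst.
    - case=> [|j] hj; first by split.
      by split; [exact: iadd_subl | apply: GX].
    - case=> [|j] hj; first exact: iadd_subl.
      have {}hj : (j < N)%N by [].
      apply: iaddS => // _ [u [Iu ->]]; rewrite -(subnSK hj) exprSr -mulrA.
      by apply: iscale_mem; rewrite iexpS; apply: imul_mem.
    - case=> [|j] hj hD.
        apply: (stepG Y) => //; first by apply: isub_trans hD; exact: iadd_subr.
        apply: isub_trans IY _; apply: iaddS => //; apply: iscaleS; exact: iadd_subl.
      have {}hj : (j.+1 < N)%N by [].
      apply: (stepG (G j)) => //.
        by apply: isub_trans hD; exact: iadd_subr.
      rewrite imulDr; apply: iadd_min.
        apply: isub_trans IY _; apply: iaddS => //; apply: iscaleS; exact: iadd_subl.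
      rewrite imulC imul_scale imulC -iexpS => u h'; apply: iadd_subr.
      move: u h'; rewrite -(subnSK (ltnW hj)) exprS -iscaleM.
      by apply: iscaleS; exact: iadd_subr.
    - rewrite /D /G subnn expr0 iscale1; apply: isub_anti; last first.
        by apply: iadd_min; [move=> u hu; do 2 apply: iadd_subl | exact: iadd_subr].
      by apply: iadd_min; [exact: YX | exact: iadd_subr].
    - exact: leqW.
  rewrite /i; case: (eps) => [|k] //=.
  by move=> hX; apply: isub_trans hX _; exact: iadd_subl.
(* The inclusion of [I^N] in [W + y^(N-i) I^i + y I^N] is substituted into itself, until at
   [k = N - i] the last term is absorbed by the middle one. *)
have iter k : isub (I ^i N) (iadd (iadd W (iscale (y ^+ (N - i)) (I ^i i)))
    (iscale (y ^+ k) (I ^i N))).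
  elim: k => [|k IH]; first by rewrite expr0 iscale1; apply: iadd_subr.
  apply: isub_trans IH _; apply: iadd_min; first exact: iadd_subl.
  move=> _ [u [Iu ->]].
  have [_ [_ [[b [_ [Wb [v [Iv ->]] ->]]] [z [Iz ->]] ->]]] := Xi u (iadd_subr _ Iu).
  rewrite !mulrDr -addrA addrCA.
  apply: idealD; last apply: idealD.
  - by apply: iadd_subr; exists v; rewrite exprSr mulrA.
  - by do 2 apply: iadd_subl; apply: idealM.
  - by apply: iadd_subl; apply: iadd_subr; rewrite mulrCA; apply: iscale_mem; apply: idealM.
apply: isub_trans (iter (N - i)%N) _; apply: iadd_min => // u h'; apply: iadd_subr.
by move: u h'; apply: iscaleS; apply: iexp_le.
Qed.

(** The case of a large exponent [N] is brought down to [n] by multiplying with [y^(N-n)] and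
    cancelling it modulo [W]. *)
Lemma power_form n : (eps.-1 <= n)%N ->
  isub (I ^i n) (iadd W (iscale (y ^+ (n - eps.-1)) (I ^i eps.-1))).
Proof.
move=> hn u Iu; pose N := maxn n (maxn r eps).
have nN : (n <= N)%N by rewrite /N; lia.
have [|||b [_ [Wb [v [Iv ->]] e0]]] := @power_form_large N _ _ (y ^+ (N - n) * u).
- by rewrite /N; lia.
- by rewrite /N; lia.
- by rewrite -(subnK nN) iexpD addnK; apply: imul_mem => //; apply: iexp_mem.
exists (u - y ^+ (n - eps.-1) * v), (y ^+ (n - eps.-1) * v).
split; [|by exists v | by ring].
apply: (@nzd_exp (N - n)); rewrite mulrBr e0 mulrA -exprD.
by have -> : (N - n + (n - eps.-1) = N - eps.-1)%N by [lia]; rewrite addrK.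
Qed.

Lemma power_step n : (eps.-1 <= n)%N -> isub (I ^i n.+1) (iadd W (iscale y (I ^i n))).
Proof.
move=> hn; apply: isub_trans (power_form (leqW hn)) _; apply: iaddS => //.
rewrite subSn // exprS -iscaleM; apply: iscaleS.
rewrite -imul_prin -{2}(subnK hn) iexpD; apply: imulS => //.
by apply: iprin_min; apply: iexp_mem.
Qed.

Lemma sg_formula n k : (eps.-1 <= n)%N -> sg (k + n)%N = (k * eps + sg n)%N.
Proof.
move=> hn; elim: k => [|k IH]; first by [].
rewrite addSn sg_step ?IH; first by rewrite mulSn addnA.
by apply: power_step; apply: leq_trans hn _; rewrite leq_addl.
Qed.

Lemma om_formula m : (eps.-1 <= m)%N -> (h m + om m)%:Z = e * m%:Z - e1.
Proof.
move=> hm; pose k := maxn n1 N0.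
have h1 : (h (k + m)%N)%:Z = e * (k + m)%:Z - e1 by apply: hE; rewrite /k; lia.
have [_ _ h3] := sat_split (k + m)%N; have [_ _ h4] := sat_split m.
rewrite om_large in h3; last by rewrite /k; lia.
have := sg_formula k hm; have := eps_e; nia.
Qed.

Lemma fin_colon_a : fin (icolon a y) a.
Proof. by have [_ h1 _] := fin_cut (@icolon_sub _ a y) sW fin_Wa. Qed.

(** On the module [W/a] of finite length, the kernel [(a : y)/a] and the cokernel of [y] have the
    same length, and the cokernel is isomorphic to [(W + yR)/Q]. *)
Lemma len_Q : fin U Q /\ len U Q = (eps + len (icolon a y) a)%N.
Proof.
have fQ : fin U Q.
  have s1 : isub (iadd (I ^i r.+1) a) Q.
    by rewrite -red; apply: iadd_min; [exact: imul_subl | exact: iadd_subl].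
  by have [f _ _] := fin_cut s1 (@isub_iunit _ _) (finh r.+1).
split=> //.
have s1 : isub Q (iadd W (iprin y)) by apply: iaddS.
have [f1 f2 ->] := fin_cut s1 (@isub_iunit _ _) fQ.
congr (_ + _)%N.
have [f3 l3] := len_iadd Q W.
have e3 : iadd Q W = iadd W (iprin y).
  by rewrite /Q -iaddA [iadd (iprin y) W]iaddC iaddA (iadd_idl aW).
have e4 : icap W Q = iadd a (iscale y W).
  apply: isub_anti.
    move=> u [Wu [b [_ [ab [v [_ ->]] e0]]]]; exists b, (y * v); split=> //.
    exists v; split=> //; apply: nzW; have -> : y * v = u - b by rewrite e0; ring.
    by apply: idealB => //; apply: aW.
  apply: iadd_min => u hu; first by split; [apply: aW | apply: iadd_subl].
  split; first exact: iscale_sub hu.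
  by apply: iadd_subr; case: hu => v [_ ->]; exists v.
rewrite e3 e4 in f3 l3; rewrite l3.
have s2 : isub a (iadd a (iscale y W)) by exact: iadd_subl.
have s3 : isub (iadd a (iscale y W)) W by apply: iadd_min => //; exact: iscale_sub.
have [f4 f5 l4] := fin_cut s2 s3 fin_Wa.
have [f6 l6] := len_scale a y W.
have [f7 f8 l7] := fin_cut (@icolon_sub _ a y) sW fin_Wa.
by move: l6 l4 l7; rewrite (icap_idr sW); lia.
Qed.

(** For [n >= 1], multiply [I^n = (W cap I^n) + y I^(n-1)], valid modulo nothing but the choice of
    summands in [power_step], by [I]. An element of [W] in [I^(n+1)] becomes one of [I (W cap I^n)]
    plus some [y z] with [z] in [I^n], and [z] is in [W] because [y] is regular modulo [W]. *)
Lemma Wn_step n : (eps <= n)%N -> isub (Wn n.+1) (iadd (I *i Wn n) a).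
Proof.
case: n => [|n] hn.
  (* The case [n = 0] forces [eps = 0]; then [W + yR] is the whole ring and 1 can be decomposed. *)
  have e0 : U = iadd W (iprin y).
    have [fQ _] := len_Q.
    have [f1 _ _] := fin_cut (iaddS aW (@isub_refl _ (iprin y))) (@isub_iunit _ _) fQ.
    by apply: len_eq0 => //; apply/eqP; rewrite -leqn0.
  have : iadd W (iprin y) 1 by rewrite -e0.
  move=> [f [_ [Wf [v [_ ->]] e2]]] u [Wu Iu].
  have W0u b : W b -> Wn 0 b by move=> Wb; split=> //; apply: iadd_subl.
  rewrite -(mulr1 u) e2 mulrDr; apply: idealD; last first.
    apply: iadd_subl; have -> : u * (y * v) = y * (u * v) by ring.
    by apply: imul_mem => //; apply: W0u; apply: ideal_mulr.
  case: Iu => b [c [Ib ac ->]]; rewrite mulrDl; apply: idealD.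
    by apply: iadd_subl; apply: imul_mem; [rewrite iexp1 in Ib | apply: W0u].
  by apply: iadd_subr; apply: ideal_mulr.
move=> u [Wu [b [c [Ib ac e0]]]].
have s1 : isub (I ^i n.+1) (iadd (icap W (I ^i n.+1)) (iscale y (I ^i n))).
  move=> v Iv; have [|w [_ [Ww [z [Iz ->]] e2]]] := @power_step n _ v Iv; first by lia.
  exists w, (y * z); split=> //; last by exists z.
  split=> //; have -> : w = v - y * z by rewrite e2; ring.
  by apply: idealB => //; rewrite iexpS; apply: imul_mem.
have s2 : isub (I ^i n.+2) (iadd (I *i icap W (I ^i n.+1)) (iscale y (I ^i n.+1))).
  rewrite iexpS; apply: isub_trans (imulS (@isub_refl _ _) s1) _.
  rewrite imulDr; apply: iaddS => //.
  by rewrite imulC imul_scale imulC -iexpS.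
have [w [_ [Iw [z [Iz ->]] e2]]] := s2 _ Ib.
have Ww : W w.
  by move: w Iw {e2}; apply: imul_min => ? ? _ [Wv _]; apply: idealM.
have Wz : W z.
  apply: nzW; have -> : y * z = u - c - w by rewrite e0 e2; ring.
  by do 2 (apply: idealB => //); apply: aW.
rewrite e0; apply: idealD; last exact: iadd_subr.
apply: iadd_subl; rewrite e2; apply: idealD.
  by move: w Iw {e2 Ww}; apply: imulS => // v [Wv Iv]; split=> //; apply: iadd_subl.
by apply: imul_mem => //; split=> //; apply: iadd_subl.
Qed.

Lemma Wn_sub n : isub (Wn n.+1) (Wn n).
Proof. by move=> u [Wu hu]; split=> //; move: hu; apply: iaddS => //; apply: iexp_le. Qed.

(** By [Wn_step], [W_n] lies in [I W_n + a]. Iteration puts it in [I^N0 W + a = a], so nilpotence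
    replaces Nakayama's lemma. *)
Lemma Wn_stable n : (eps <= n)%N -> isub (Wn n) (Wn n.+1) -> Wn n = a.
Proof.
move=> hn hs; apply: isub_anti; last exact: a_Wn.
have h1 : isub (Wn n) (iadd (I *i Wn n) a).
  by apply: isub_trans hs (Wn_step hn).
have iterk k : isub (Wn n) (iadd (I ^i k *i Wn n) a).
  elim: k => [|k IH]; first by rewrite iexp0 imul1; apply: iadd_subl.
  apply: isub_trans IH _; apply: iadd_min; last exact: iadd_subr.
  apply: isub_trans (imulS (@isub_refl _ _) h1) _; rewrite imulDr; apply: iaddS.
    by rewrite imulA [_ *i I]imulC -iexpS.
  exact: imul_subr.
apply: isub_trans (iterk N0) _; apply: iadd_min => //.
by apply: isub_trans IW; apply: imulS => // u [].
Qed.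

Lemma Wn_zero t n : (om eps <= t)%N -> (eps + t <= n)%N -> Wn n = a.
Proof.
move=> ht hn.
have down k : (om (eps + k)%N <= t - k)%N /\ (om (eps + k)%N = 0%N -> Wn (eps + k)%N = a).
  have z k' : om (eps + k')%N = 0%N -> Wn (eps + k')%N = a.
    by move=> h0; have [f _ _] := sat_split (eps + k')%N; apply: len_eq0.
  split; last exact: z.
  elim: k => [|k IH]; first by rewrite addn0 subn0.
  have [f1 _ _] := sat_split (eps + k)%N.
  have [f2 f3 l1] := fin_cut (@a_Wn (eps + k).+1) (@Wn_sub (eps + k)%N) f1.
  have [h0|hpos] := posnP (len (Wn (eps + k)%N) (Wn (eps + k).+1)).
    have e0 := len_eq0 f2 h0.
    have ea : Wn (eps + k)%N = a by apply: Wn_stable; rewrite ?leq_addr // -e0.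
    by rewrite addnS /om -e0 ea; have [_ ->] := fin_id a.
  move: IH; rewrite addnS /om l1 -/(om (eps + k).+1); lia.
have [h1 h2] := down t; rewrite subnn leqn0 in h1.
have {h2} e0 : Wn (eps + t)%N = a by apply/h2/eqP.
apply: isub_anti; last exact: a_Wn.
rewrite -[X in isub _ X]e0 => u [Wu hu]; split=> //; move: hu; apply: iaddS => //; exact: iexp_le.
Qed.

(** Modulo [a] the ideal [Q I^n] is [y I^n], and [(a + yR)/(a + y I^n)] is isomorphic to
    [R/(I^n + (a : y))]. *)
Lemma colon_layer n : fin (iadd (I ^i n.+1) a) (iadd (Q *i I ^i n) a) /\
  (eps + h n + len (icap (icolon a y) (iadd (I ^i n) a)) a =
   len (iadd (I ^i n.+1) a) (iadd (Q *i I ^i n) a) + h n.+1)%N.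
Proof.
have e0 : iadd (Q *i I ^i n) a = iadd a (iscale y (I ^i n)).
  rewrite imulDl imul_prin -iaddA [iadd (iscale _ _) a]iaddC iaddA.
  by rewrite (iadd_idl (@imul_subl _ a (I ^i n))).
have [fQ lQ] := len_Q.
have [f1 l1] := @len_scale2 _ a y U (I ^i n) (@isub_iunit _ _).
have e1' : icap U (icolon (iadd a (iscale y (I ^i n))) y) =
          iadd (iadd (I ^i n) a) (icolon a y).
  apply: isub_anti => u.
    move=> [_ [b [_ [ab [v [Iv ->]] e2]]]]; exists v, (u - v); split=> //.
    - exact: iadd_subl.
    - by rewrite icolonE mulrBr e2 addrK.
    - by ring.
  move=> [_ [c [[v [b [Iv ab ->]]] ac ->]]]; split=> //; rewrite icolonE.
  exists (y * b + y * c), (y * v); split; last by ring.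
    by apply: idealD => //; apply: idealM.
  by exists v.
rewrite e1' in f1 l1.
have [f2 f3 l2] := fin_cut (@iadd_subl _ (iadd (I ^i n) a) (icolon a y))
  (@isub_iunit _ _) (finh n).
have [f4 l4] := len_iadd (iadd (I ^i n) a) (icolon a y).
have s1 : isub a (icap (icolon a y) (iadd (I ^i n) a)).
  by move=> u au; split; [apply: idealM | apply: iadd_subr].
have s2 : isub (icap (icolon a y) (iadd (I ^i n) a)) (icolon a y) by move=> u [].
have [f5 f6 l5] := fin_cut s1 s2 fin_colon_a.
have [f7 l7] := fin_add fQ (proj2 f1 f2).
have s3 : isub (iadd a (iscale y (I ^i n))) (iadd (I ^i n.+1) a).
  rewrite iaddC; apply: iaddS => //; rewrite -imul_prin iexpS; apply: imulS => //.
  exact: iprin_min.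
have [f8 f9 l8] := fin_cut s3 (@isub_iunit _ _) f7.
rewrite e0; split=> //; move: lQ l1 l2 l4 l5 l7 l8; rewrite /h /Q /iprin; lia.
Qed.

End Saturated.

(** The torsion [W] stays hidden. In the last clause [t] is any bound for [e_0 m - e_1 - h(m)]; it
    is used at [m = eps], where this number is the length [om eps]. *)
Theorem one_dim : exists eps : nat, [/\ e = eps%:Z,
  fin (icolon a y) a, fin U Q /\ len U Q = (eps + len (icolon a y) a)%N,
  forall n, fin (iadd (I ^i n.+1) a) (iadd (Q *i I ^i n) a) /\
    (eps + h n + len (icap (icolon a y) (iadd (I ^i n) a)) a =
     len (iadd (I ^i n.+1) a) (iadd (Q *i I ^i n) a) + h n.+1)%N &
  forall t : nat, (forall m : nat, e * m%:Z - e1 - (h m)%:Z <= t%:Z) ->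
    forall n, (eps + t <= n)%N -> icap (icolon a y) (iadd (I ^i n) a) = a].
Proof.
have [W [N [sW nzW W0 IW]]] := saturation.
exists (len U (iadd W (iprin y))); split.
- exact: (eps_e sW nzW W0).
- exact: (fin_colon_a sW W0).
- exact: (len_Q sW nzW W0).
- by move=> n; exact: (colon_layer sW nzW W0).
move=> t ht n hn; apply: isub_anti => u; last first.
  by move=> au; split; [apply: idealM | apply: iadd_subr].
move=> [ayu hu]; rewrite -(@Wn_zero W N sW nzW W0 IW t n) //; first by split=> //; apply: sW.
rewrite -lez_nat; set E := len U _.
have := @om_formula W N sW nzW W0 E (leq_pred _); have := ht E; lia.
Qed.

End OneDimensional.

(** * Growth of Hilbert functions *)

(** The number of monomials of degree [n] in [i] variables, defined by the recursion that
    [powers_filtered_step] and [powers_generated_step] produce. *)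
Fixpoint rkf i n : nat :=
  if i is i'.+1 then (\sum_(j < n.+1) rkf i' j)%N else (n == 0%N).

Lemma rkfE i n : rkf i n = 'C(n + i - 1, n).
Proof.
elim: i n => [|i IH] n; first by case: n => [|n] //=; rewrite addn0 subn1 bin_small.
rewrite /=; under eq_bigr do rewrite IH.
rewrite addnS subn1 /=; elim: n => [|n IHn]; first by rewrite big_ord1 !bin0.
by rewrite big_ord_recr IHn /= addSn subn1 /= binS addnC.
Qed.

Lemma rkfS_sum i n : (\sum_(j < n.+1) rkf i j)%N = 'C(n + i, i).
Proof.
by rewrite -/(rkf i.+1 n) rkfE addnS subn1 /= -[LHS]bin_sub ?leq_addr // addKn.
Qed.

Lemma rkf_sum i n : (0 < n)%N -> (\sum_(j < n) rkf i j)%N = 'C(n + i - 1, i).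
Proof. by case: n => // n _; rewrite rkfS_sum addSn subn1. Qed.

Lemma rkf_sum2 i n : (\sum_(m < n) \sum_(j < m.+1) rkf i j)%N = 'C(n + i, i.+1).
Proof.
elim: n => [|n IH]; first by rewrite big_ord0 bin_small.
by rewrite big_ord_recr IH rkfS_sum addSn binS.
Qed.

Section RegularSequencePowers.
Variable R : comPzRingType.

Lemma izero_exp n : (@izero R) ^i n.+1 = izero.
Proof. by apply: isub_anti; [exact: iexp_sub1 | move=> x ->; apply: ideal0]. Qed.

Lemma izero_filtered : powers_filtered (@izero R) (rkf 0).
Proof.
case=> [|n]; last by rewrite !izero_exp; apply: Filt0.
rewrite izero_exp iexp0; apply: (@FiltS _ _ _ _ 1); last exact: icolon1.
have -> : iadd izero (iprin 1) = unit_ideal :> ideal R; last exact: Filt0.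
by rewrite iaddC iadd0 /iprin iscale1.
Qed.

Lemma izero_generated : powers_generated (@izero R) (rkf 0).
Proof.
case=> [|n]; last by exists [::]; split=> //; rewrite izero_exp gen_nil.
exists [:: 1]; split=> //.
by rewrite gen_cons gen_nil iadd0 /iprin iscale1.
Qed.

Lemma regular_powers (s : seq R) :
  (forall i, (i < size s)%N -> nzd (generated_by (take i s)) (nth 0 s i)) ->
  powers_filtered (generated_by s) (rkf (size s)) /\
  powers_generated (generated_by s) (rkf (size s)).
Proof.
move=> hs; suff h i : (i <= size s)%N ->
    powers_filtered (generated_by (take i s)) (rkf i) /\
    powers_generated (generated_by (take i s)) (rkf i).
  by have := h (size s) (leqnn _); rewrite take_size.
elim: i => [|i IH] hi.
  by rewrite take0 gen_nil; split; [exact: izero_filtered | exact: izero_generated].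
have [h1 h2] := IH (ltnW hi); rewrite gen_take //; split.
  by apply: powers_filtered_step => //; apply: hs.
exact: powers_generated_step.
Qed.

End RegularSequencePowers.

Lemma low_dom k (f g : nat -> int) n1 :
  (forall n, (n1 <= n)%N -> `|f n| <= `|g n|) -> low k g -> low k f.
Proof.
move=> e [C [n0 h]]; exists C, (maxn n0 n1) => n; rewrite geq_max => /andP[h0 h1].
by apply: le_trans (h n h0); apply: ler_wpM2r => //; apply: e.
Qed.

Lemma low_shift k f m : low k f -> low k (fun n => f (n + m)%N).
Proof.
move=> [C [n0 h]]; exists (C * m.+1 ^ k)%N, n0.+1 => n hn.
have hn0 : (n0 <= n + m)%N by lia.
apply: le_trans (_ : `|f (n + m)%N| * (n + m)%:Z <= _).
  by apply: ler_wpM2l => //; rewrite lez_nat leq_addr.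
apply: (le_trans (h _ hn0)); rewrite lez_nat -mulnA leq_mul2l; apply/orP; right.
rewrite -expnMn; case: k {h} => // k; rewrite leq_exp2r //; nia.
Qed.

Lemma low_bin_shift k c m :
  low k (fun n => ('C(n + m + c, k))%:Z - ('C(n + c, k))%:Z).
Proof.
elim: m => [|m IH].
  by apply: (@low_eq k (fun=> 0) _ 0) (low0 k) => n _; rewrite addn0 subrr.
case: k IH => [|k] IH.
  by apply: (@low_eq 0 (fun=> 0) _ 0) (low0 0) => n _; rewrite !bin0 subrr.
have h2 : low k.+1 (fun n => ('C(n + (m + c), k))%:Z) by apply: low_bin.
apply: (@low_eq _ _ _ 0) (low_add IH h2) => n _.
by rewrite addnS addSn binS PoszD -addnA; ring.
Qed.

Lemma low_bin_pred k m :
  low k (fun n => ('C(n + m + k - 1, k))%:Z - ('C(n + k - 1, k))%:Z).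
Proof.
case: k => [|k].
  by apply: (@low_eq 0 (fun=> 0) _ 0) (low0 0) => n _; rewrite !bin0 subrr.
by apply: (@low_eq _ _ _ 0) (low_bin_shift k.+1 k m) => n _; rewrite !addnS !subn1.
Qed.

Lemma low_rkf k : low k (fun n => (rkf k n)%:Z).
Proof.
case: k => [|k].
  by apply: (@low_eq 0 (fun=> 0) _ 1) (low0 0) => -[].
apply: (@low_eq _ _ _ 0) (@low_bin k.+1 k k (leqnn _)) => n _.
by rewrite rkfE addnS subn1 /= -[in RHS]bin_sub ?leq_addr // addKn.
Qed.

Lemma lowS k f : low k f -> low k.+1 f.
Proof.
move=> [C [n0 h]]; exists C, n0.+1 => n hn; apply: le_trans (h n (ltnW hn)) _.
by rewrite lez_nat expnS; apply: leq_mul => //; rewrite leq_pmull //; lia.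
Qed.

Definition hilb_tail k c n : int :=
  hilbF k.+1 c n - (c 0%N * ('C(n + k, k.+1))%:Z - c 1%N * ('C(n + k - 1, k))%:Z).

Lemma hilb_tail_low k c : low k (hilb_tail k c).
Proof.
pose g i n : int := (-1) ^+ i.+2 * c i.+2 * ('C(n + k.+1 - 1 - i.+2, k.+1 - i.+2))%:Z.
have hg : low k (fun n => \sum_(i < k) g i n).
  apply: low_sum => i ik; rewrite /g; apply: low_scale.
  apply: (@low_dom k _ (fun n => ('C(n + k, k.+1 - i.+2))%:Z) 0) => [n _|].
    rewrite !ger0_norm // lez_nat; apply: leq_bin2l; lia.
  by apply: low_bin; lia.
apply: (@low_eq _ _ _ 0) hg => n _.
rewrite /hilb_tail /hilbF big_ord_recl big_ord_recl /= expr0 expr1 !mul1r !subn0.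
have -> : (n + k.+1 - 1 = n + k)%N by lia.
rewrite !subn1 /= /bump /=.
have -> : (n + k).-1 = (n + k - 1)%N by lia.
set S := (X in _ = _ + (_ + X) - _); have -> : S = \sum_(i < k) g i n by
  apply: eq_bigr => i _; rewrite /g /bump /=; congr (_ * _ * ('C(_, _))%:Z); lia.
by ring.
Qed.

Lemma hilbF_tail k c n : hilbF k.+1 c n =
  c 0%N * ('C(n + k, k.+1))%:Z - c 1%N * ('C(n + k - 1, k))%:Z + hilb_tail k c n.
Proof. by rewrite /hilb_tail; ring. Qed.

(** Pascal's rule is used [m] times, each increment being at least [C(n+k-1, k)]. In [chern_lower]
    this yields the summand [e_0 m]. *)
Lemma bin_shift_ge n m k :
  ('C(n + k, k.+1) + m * 'C(n + k - 1, k) <= 'C(n + m + k, k.+1))%N.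
Proof.
elim: m => [|m IH]; first by rewrite mul0n !addn0.
have h : ('C(n + k - 1, k) <= 'C(n + m + k, k))%N by apply: leq_bin2l; lia.
by rewrite addnS addSn binS mulSn; lia.
Qed.

Lemma hilbF1 c n : hilbF 1 c n = c 0%N * n%:Z - c 1%N.
Proof.
by rewrite /hilbF big_ord_recl big_ord1 /= !subn0 addnK bin1 !subn1 /= /bump /= bin0; ring.
Qed.

(** * Comparison of Hilbert coefficients and the inequality of (i) *)

Section Core.
Variable R : comPzRingType.
Hypothesis noeth : noetherian R.
Variables (I : ideal R) (xs : seq R) (y : R) (r : nat) (eI eQ : nat -> int).
Local Notation U := (@unit_ideal R).
Local Notation k := (size xs).
Let a := generated_by xs.
Let Q := iadd a (iprin y).
Hypothesis QI : isub Q I.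
Hypothesis red : Q *i (I ^i r) = I ^i r.+1.
Hypothesis reg : forall i, (i < k)%N -> nzd (generated_by (take i xs)) (nth 0 xs i).
Hypothesis sup : forall i, (i < k)%N ->
  superf I (generated_by (take i xs)) (nth 0 xs i).
Hypothesis hI : hil I izero k.+1 eI.
Hypothesis hQ : hil Q izero k.+1 eQ.

Let h n := len U (iadd (I ^i n) a).
Let s := len (icolon a y) a.
Let sn n := len (icap (icolon a y) (iadd (I ^i n) a)) a.
Let v n := len (iadd (I ^i n.+1) a) (iadd (Q *i I ^i n) a).

Let aI : isub a I. Proof. by apply: isub_trans QI; apply: iadd_subl. Qed.

(** Each of the superficial regular elements lowers the dimension by one, and [e_0] and [e_1]
    survive. *)
Lemma hil_a : hil I a 1 eI.
Proof.
suff hh i : (i <= k)%N -> hil I (generated_by (take i xs)) (k.+1 - i) eI.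
  by have := hh k (leqnn _); rewrite take_size subSnn.
elim: i => [|i IH] ik; first by rewrite take0 gen_nil subn0.
have Ix : I (nth 0 xs i).
  by apply: aI; apply: gen_mem; apply: mem_nth.
have [n0 hn0] := superf_colon noeth (reg ik) Ix (sup ik).
rewrite gen_take //; apply: (hil_step hn0).
have -> : ((k.+1 - i.+1).+1 = k.+1 - i)%N by lia.
exact: IH (ltnW ik).
Qed.

Lemma fin_In n : fin U (I ^i n).
Proof.
have [n0 hn0] := hI; pose N := maxn n0 n.
have [|f _] := hn0 N; first by rewrite leq_maxl.
rewrite iadd0 in f; have hs : isub (I ^i N) (I ^i n) by apply: iexp_le; rewrite leq_maxr.
by have [f' _ _] := fin_cut hs (@isub_iunit _ _) f.
Qed.

Lemma finh n : fin U (iadd (I ^i n) a).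
Proof. by have [f _ _] := fin_cut (@iadd_subl _ _ a) (@isub_iunit _ _) (fin_In n). Qed.

Lemma fin_Qn n : fin U (Q ^i n).
Proof.
have hs : isub (I ^i (n + r)) (Q ^i n).
  by rewrite (reduction_powers _ red); apply: imul_subl.
by have [f _ _] := fin_cut hs (@isub_iunit _ _) (fin_In (n + r)).
Qed.

Lemma lenI_large : exists n0, forall n, (n0 <= n)%N ->
  (len U (I ^i n))%:Z = hilbF k.+1 eI n.
Proof. by have [n0 H] := hI; exists n0 => n /H [_]; rewrite iadd0. Qed.

Lemma lenQ_large : exists n0, forall n, (n0 <= n)%N ->
  (len U (Q ^i n))%:Z = hilbF k.+1 eQ n.
Proof. by have [n0 H] := hQ; exists n0 => n /H [_]; rewrite iadd0. Qed.

Lemma h_large : exists n0, forall n, (n0 <= n)%N ->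
  (h n)%:Z = eI 0%N * n%:Z - eI 1%N.
Proof. by have [n0 H] := hil_a; exists n0 => n /H [_ ->]; rewrite hilbF1. Qed.

(** [I^(n+r)] lies in [Q^n] and [Q^n] in [I^n]; the shift by [r] does not affect the coefficient of
    [n^(k+1)]. *)
Lemma multiplicity_eq : eQ 0%N = eI 0%N.
Proof.
have [nI HI] := lenI_large; have [nQ HQ] := lenQ_large.
apply/eqP; rewrite eq_le; apply/andP; split; rewrite -subr_ge0.
  pose f n : int := eI 0%N * (('C(n + r + k, k.+1))%:Z - ('C(n + k, k.+1))%:Z)
     + (- eI 1%N) * ('C(n + r + k - 1, k))%:Z + hilb_tail k eI (n + r)%N
     + eQ 1%N * ('C(n + k - 1, k))%:Z + (-1) * hilb_tail k eQ n.
  have lb (m : nat) : low k.+1 (fun n => ('C(n + m + k - 1, k))%:Z).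
    apply: (@low_dom _ _ (fun n => ('C(n + (m + k), k))%:Z) 0) => [n _|].
      by rewrite !ger0_norm // lez_nat; apply: leq_bin2l; lia.
    exact: low_bin.
  apply: (@lead_ge0 k.+1 _ f).
    apply: low_add; first apply: low_add; first apply: low_add; first apply: low_add.
    - by apply: low_scale; apply: low_bin_shift.
    - exact: low_scale.
    - by apply: lowS; apply: (@low_shift k (hilb_tail k eI)); exact: hilb_tail_low.
    - apply: low_scale; apply: (@low_eq _ _ _ 0) (lb 0%N) => n _; by rewrite addn0.
    - by apply: low_scale; apply: lowS; exact: hilb_tail_low.
  exists (maxn nI nQ) => n; rewrite geq_max => /andP[hnI hnQ].
  have hs : isub (I ^i (n + r)) (Q ^i n).
    by rewrite (reduction_powers _ red); apply: imul_subl.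
  have [_ _ l1] := fin_cut hs (@isub_iunit _ _) (fin_In (n + r)).
  have e1 := HI (n + r)%N (leq_trans hnI (leq_addr _ _)); have e2 := HQ n hnQ.
  have : (len U (Q ^i n))%:Z <= (len U (I ^i (n + r)))%:Z by rewrite lez_nat l1 leq_addr.
  rewrite e1 e2 !hilbF_tail -subr_ge0 /f.
  have -> : (n + k.+1 - 1 = n + k)%N by lia.
  by congr (_ <= _); ring.
pose f n : int := (- eQ 1%N + eI 1%N) * ('C(n + k - 1, k))%:Z
   + hilb_tail k eQ n + (-1) * hilb_tail k eI n.
apply: (@lead_ge0 k.+1 _ f).
  apply: low_add; first apply: low_add.
  - apply: low_scale; apply: (@low_dom _ _ (fun n => ('C(n + k, k))%:Z) 0) => [n _|].
      by rewrite !ger0_norm // lez_nat; apply: leq_bin2l; lia.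
    exact: low_bin.
  - by apply: lowS; exact: hilb_tail_low.
  - by apply: low_scale; apply: lowS; exact: hilb_tail_low.
exists (maxn nI nQ) => n; rewrite geq_max => /andP[hnI hnQ].
have hs : isub (Q ^i n) (I ^i n) by apply: iexpSub.
have [_ _ l1] := fin_cut hs (@isub_iunit _ _) (fin_Qn n).
have e1 := HI n hnI; have e2 := HQ n hnQ.
have : (len U (I ^i n))%:Z <= (len U (Q ^i n))%:Z by rewrite lez_nat l1 leq_addr.
rewrite e1 e2 !hilbF_tail -subr_ge0 /f.
  have -> : (n + k.+1 - 1 = n + k)%N by lia.
by congr (_ <= _); ring.
Qed.

(* Comparison of the coefficients of [n^k] in [len_power_le]; the [xs] need not be
   superficial for [Q], so that [eQ 1] cannot be computed modulo [a]. *)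
Lemma chern_lower m : 0 <= eI 0%N ->
  eI 0%N * m%:Z - eI 1%N - (h m)%:Z <= - eQ 1%N.
Proof.
move=> e_ge0; rewrite -subr_ge0.
have [nI HI] := lenI_large; have [nQ HQ] := lenQ_large.
have [_ hg] := regular_powers reg.
pose D n : int := ('C(n + m + k - 1, k))%:Z - ('C(n + k - 1, k))%:Z.
pose f n : int := hilb_tail k eQ n + (-1) * hilb_tail k eI (n + m)%N
  + eI 1%N * D n + (len U (I ^i m))%:Z * (rkf k n)%:Z.
apply: (@lead_ge0 k _ f).
  apply: low_add; first apply: low_add; first apply: low_add.
  - exact: hilb_tail_low.
  - by apply: low_scale; apply: (@low_shift k (hilb_tail k eI)); exact: hilb_tail_low.
  - by apply: low_scale; exact: low_bin_pred.
  - by apply: low_scale; exact: low_rkf.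
exists (maxn nI nQ).+1 => n hn.
have hnI : (nI <= n + m)%N by lia.
have hnQ : (nQ <= n)%N by lia.
have e1 := HI _ hnI; have e2 := HQ _ hnQ.
have := @len_power_le _ a y I (rkf k) n m QI hg (fin_In _) (fin_Qn n).
rewrite -/Q rkf_sum; last by lia.
have := bin_shift_ge n m k.
rewrite -!lez_nat !PoszD !PoszM e1 e2 !hilbF_tail multiplicity_eq -/(h m) /f /D.
set A := ('C(n + m + k, _))%:Z; set B := ('C(n + k, _))%:Z.
set C := ('C(n + m + k - 1, _))%:Z; set E := ('C(n + k - 1, _))%:Z.
move=> h1 h2; rewrite -subr_ge0 in h1; rewrite -subr_ge0 in h2.
apply: le_trans (addr_ge0 h2 (mulr_ge0 e_ge0 h1)) _.
by rewrite le_eqVlt; apply/orP; left; apply/eqP; ring.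
Qed.

(* Comparison of the coefficients of [n^k] in [len_power_ge]. *)
Lemma torsion_le (eps : nat) : eI 0%N = eps%:Z -> fin U Q -> fin (icolon a y) a ->
  len U Q = (eps + s)%N -> s%:Z <= - eQ 1%N.
Proof.
move=> eE fQ fa lQ; rewrite -subr_ge0.
have [nQ HQ] := lenQ_large; have [hf _] := regular_powers reg.
apply: (@lead_ge0 k _ (hilb_tail k eQ)); first exact: hilb_tail_low.
exists nQ.+1 => n hn; have e2 := HQ n (ltnW hn).
have [_] := len_power_ge n fQ fa hf lQ.
rewrite big_split /= -!big_distrr /= rkf_sum2 rkf_sum; last by lia.
rewrite -lez_nat e2 hilbF_tail multiplicity_eq eE PoszD !PoszM; lia.
Qed.

(** For [y] regular modulo [a] the length of [R/Q^n] is exactly [eps] times [C(n+k, k+1)], so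
    [lead_ge0] applies to [eQ 1] and to its negative. *)
Lemma chern_eq0 (eps : nat) : eI 0%N = eps%:Z -> fin U Q -> nzd a y ->
  len U Q = eps -> eQ 1%N = 0.
Proof.
move=> eE fQ ay lQ.
have [nQ HQ] := lenQ_large; have [hf _] := regular_powers reg.
have E n : (nQ <= n)%N -> eQ 1%N * ('C(n + k - 1, k))%:Z - hilb_tail k eQ n = 0.
  move=> /HQ; rewrite (len_power_eq _ fQ ay hf) -big_distrr /= rkf_sum2 lQ.
  rewrite hilbF_tail multiplicity_eq eE PoszM; lia.
apply/eqP; rewrite eq_le -oppr_ge0; apply/andP; split.
  apply: (@lead_ge0 k _ (hilb_tail k eQ)); first exact: hilb_tail_low.
  by exists nQ => n /E; lia.
apply: (@lead_ge0 k _ (fun n => (-1) * hilb_tail k eQ n)).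
  by apply: low_scale; exact: hilb_tail_low.
by exists nQ => n /E; lia.
Qed.

Theorem core_bound :
  let B : int := (len U I)%:Z - eI 0%N + eI 1%N - ((len U Q)%:Z - eQ 0%N + eQ 1%N)
     - (eI 0%N - eQ 1%N) * eQ 1%N in
  (forall n, fin (iadd (I ^i n.+1) a) (iadd (Q *i I ^i n) a)) /\
  exists S : nat, [/\ exists n0, forall N, (n0 <= N)%N -> (\sum_(1 <= n < N) v n)%N = S,
    S%:Z <= B & S%:Z = B <-> nzd a y].
Proof.
move=> B.
have [nh hh] := h_large.
have [eps [eE fa [fQ lQ] vE snE]] := one_dim noeth QI red finh hh.
split; first by move=> n; have [] := vE n.
have e_ge0 : 0 <= eI 0%N by rewrite eE.
have st : s%:Z <= - eQ 1%N := torsion_le eE fQ fa lQ.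
pose t := `|eQ 1%N|%N.
have tE : eQ 1%N = - t%:Z.
  by rewrite /t abszE ler0_norm ?opprK // -oppr_ge0; apply: le_trans st.
have hst : (s <= t)%N by rewrite -lez_nat; apply: le_trans st _; rewrite tE opprK.
have sn0 n : (eps + t <= n)%N -> sn n = 0%N.
  move=> hn; rewrite /sn (snE t) //; first by have [_ ->] := fin_id a.
  by move=> m; apply: le_trans (chern_lower m e_ge0) _; rewrite tE opprK.
have sn_le n : (sn n <= s)%N.
  have s1 : isub a (icap (icolon a y) (iadd (I ^i n) a)).
    by move=> u au; split; [apply: idealM | apply: iadd_subr].
  have s2 : isub (icap (icolon a y) (iadd (I ^i n) a)) (icolon a y) by move=> u [].
  by have [_ _] := fin_cut s1 s2 fa; rewrite /sn /s => ->; rewrite leq_addl.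
have sn_0 : sn 0 = s.
  by rewrite /sn iexp0 icap_idl // => u _; apply: iadd_subl.
pose T := (\sum_(0 <= n < eps + t) sn n)%N.
have TE N : (eps + t <= N)%N -> (\sum_(0 <= n < N) sn n)%N = T.
  move=> hN; rewrite (big_cat_nat (leq0n _) hN) /= [X in (_ + X)%N]big_nat_cond.
  rewrite [X in (_ + X)%N]big1 ?addn0 // => n; rewrite andbT => /andP[hn _]; exact: sn0.
have T_le : (T <= (eps + t) * s)%N.
  have -> : ((eps + t) * s = \sum_(0 <= n < eps + t) s)%N.
    by rewrite sum_nat_const_nat subn0.
  by apply: leq_sum => n _.
(* The layer identity [vE], summed over [n = 1, ..., N]; the values of [h] telescope. *)
have tel N : (\sum_(1 <= n < N.+1) v n + h N.+1)%N =
    (eps * N + h 1 + \sum_(1 <= n < N.+1) sn n)%N.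
  elim: N => [|N IH]; first by rewrite !big_geq // muln0 add0n addn0.
  rewrite !(@big_nat_recr _ _ _ N.+1) //=.
  have [_ ] := vE N.+1; rewrite -/(sn N.+1) -/(v N.+1) -/(h N.+1) -/(h N.+2) => e0.
  by move: IH e0; lia.
have h1E : h 1 = len U I by rewrite /h iexp1 (iadd_idr aI).
have snT N : (eps + t <= N)%N -> (s + \sum_(1 <= n < N.+1) sn n)%N = T.
  by move=> hN; rewrite -(TE N.+1) ?(leqW hN) // [in RHS]big_ltn // sn_0.
pose N0 := maxn nh (eps + t).
pose S := (\sum_(1 <= n < N0.+1) v n)%N.
have SE N : (N0 <= N)%N ->
    (\sum_(1 <= n < N.+1) v n)%:Z = (len U I)%:Z - eI 0%N + eI 1%N + T%:Z - s%:Z :> int.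
  move=> hN; have := tel N; have := snT N; have := hh N.+1.
  rewrite h1E eE => q1 q2 q3.
  have {}q1 := q1 (leq_trans (leq_trans (leq_maxl _ _) hN) (leqnSn _)).
  have {}q2 := q2 (leq_trans (leq_maxr _ _) hN).
  by move: q1 q2 q3; nia.
(* Together with [SE] this gives [B - S = t + (eps + t) t - T], which is at least [t] because
   [T <= (eps + t) s] and [s <= t]. *)
have BE : B = (len U I)%:Z - eI 0%N + eI 1%N - s%:Z + t%:Z + (eps%:Z + t%:Z) * t%:Z.
  by rewrite /B multiplicity_eq tE lQ eE PoszD; ring.
exists S; have S0 := SE N0 (leqnn _); rewrite -/S in S0; split.
- exists N0.+1 => -[//|N] hN; apply/eqP; rewrite -eqz_nat; apply/eqP.
  by rewrite S0; apply: SE.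
- by rewrite S0 BE; nia.
split.
  rewrite S0 BE => e0.
  have t0 : t = 0%N by nia.
  have s0 : s = 0%N by apply/eqP; rewrite -leqn0 -t0.
  by have ea := len_eq0 fa s0; move=> u; rewrite -icolonE ea.
move=> ay.
have s0 : s = 0%N by rewrite /s nzd_colon //; have [_ ->] := fin_id a.
have t0 : t = 0%N.
  by rewrite /t (chern_eq0 eE fQ ay) // lQ -/s s0 addn0.
have T0 : T = 0%N by apply/eqP; rewrite -leqn0; apply: leq_trans T_le _; rewrite s0 muln0.
by rewrite S0 BE T0 s0 t0; ring.
Qed.

End Core.

(** * Regular sequences and socles *)

Lemma In_mem (T : eqType) (x : T) (s : seq T) : List.In x s <-> x \in s.
Proof.
elim: s => [|z s IH] //=; rewrite inE; split=> [[->|/IH ->]|]; rewrite ?eqxx ?orbT //.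
by move=> /orP[/eqP ->|/IH]; [left | right].
Qed.

Lemma In_map (T T' : Type) (f : T -> T') (s : seq T) y :
  List.In y [seq f x | x <- s] <-> exists x, f x = y /\ List.In x s.
Proof. exact: List.in_map_iff. Qed.

Lemma In_cat (T : Type) (s t : seq T) x :
  List.In x (s ++ t) <-> List.In x s \/ List.In x t.
Proof. exact: List.in_app_iff. Qed.

Section Grade.
Variable R : comPzRingType.
Hypothesis noeth : noetherian R.
Implicit Types (b I J K L P : ideal R) (x y u v w z : R) (n i j : nat) (xs zs : seq R).

Lemma noeth_generators (S : set R) : exists s : seq R,
  (forall x, x \in s -> S x) /\ isub (generated S) (generated_by s).
Proof.
have [|K [[s [sS ->]] _ Kmax]] := @noeth_max _ noeth
    (fun K => exists s : seq R, (forall x, x \in s -> S x) /\ K = generated_by s)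
    (generated_by [::]).
  by exists [::].
exists s; split=> //; apply: generated_min => x Sx.
apply: (Kmax (generated_by (x :: s))).
- by exists (x :: s); split=> // z; rewrite inE => /orP[/eqP ->|/sS].
- by rewrite gen_cons; exact: iadd_subr.
- by apply: gen_mem; rewrite inE eqxx.
Qed.

Lemma prime_prod P (Js : seq (ideal R)) : prime_ideal P ->
  (forall J, List.In J Js -> ~ isub J P) ->
  exists v, ~ P v /\ forall J, List.In J Js -> J v.
Proof.
move=> [P1 Pp]; elim: Js => [|J Js IH] hJ; first by exists 1.
have [|v [Pv hv]] := IH; first by move=> K hK; apply: hJ; right.
have [z [Jz Pz]] : exists z, J z /\ ~ P z.
  apply: contrapT => hno; apply: (hJ J); first by left.
  by move=> z Jz; apply: contrapT => Pz; apply: hno; exists z.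
exists (z * v); split; first by move=> /Pp [].
move=> K [<-|/hv Kv]; [exact: ideal_mulr | exact: idealM].
Qed.

Lemma prime_avoidance (M : ideal R) (Ps : seq (ideal R)) :
  (forall P, List.In P Ps -> prime_ideal P /\ ~ isub M P) ->
  exists w, M w /\ forall P, List.In P Ps -> ~ P w.
Proof.
move: {2}(size Ps) (leqnn (size Ps)) => n; elim: n Ps => [|n IH] [|P Ps] //= hs hP.
- by exists 0; split=> //; exact: ideal0.
- by exists 0; split=> //; exact: ideal0.
have [|w [Mw hw]] := IH Ps hs; first by move=> P' h; apply: hP; right.
have [Pw|nPw] := pselect (P w); last first.
  by exists w; split=> // P' [<-|/hw].
have [PP MP] := hP P (or_introl erefl).
have [[P' inP' P'P]|hno] := pselect (exists2 P', List.In P' Ps & isub P' P).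
  have [l1 [l2 e]] := List.in_split _ _ inP'.
  have [||w' [Mw' hw']] := IH (P :: l1 ++ l2).
  - by move: hs; rewrite e /= !size_cat /= addnS.
  - move=> P2 [<-|h]; first by [].
    apply: hP; right; rewrite e; apply/In_cat.
    by case: ((In_cat _ _ _).1 h); [left | right; right].
  exists w'; split=> // P2 [<-|]; first by apply: hw'; left.
  rewrite e => h; case: ((In_cat _ _ _).1 h) => [h1|[<-|h1]].
  - by apply: hw'; right; apply/In_cat; left.
  - by move=> /P'P; apply: hw'; left.
  - by apply: hw'; right; apply/In_cat; right.
have [J [<- //|inJ] JP|v [Pv hv]] := @prime_prod P (M :: Ps) PP.
  by apply: hno; exists J.
exists (w + v); split; first by apply: idealD => //; apply: hv; left.
move=> P2 [<-|inP2] h; first by apply: Pv; apply: (@idealDl _ P _ w) => //; rewrite addrC.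
by apply: (hw P2 inP2); apply: idealDl h; apply: hv; right.
Qed.

Variable M : ideal R.

(** Nonzero socle of [R/b] with respect to [M]. By [nzd_nsoc] and [common_nzd], its absence means
    that [M] contains an element regular modulo [b]. *)
Definition soc b := exists u, ~ b u /\ forall c, M c -> b (c * u).

Lemma nzd_nsoc b x : M x -> nzd b x -> ~ soc b.
Proof. by move=> Mx bx [u [bu hu]]; apply: bu; apply: bx; apply: hu. Qed.

(* The zero divisors modulo [b] are covered by the maximal annihilators, which
   are prime and, the ideal generated by their elements being finitely
   generated, finite in number. *)
Lemma zero_divisors_primes b : ~ soc b -> exists Ps : seq (ideal R),
  (forall P, List.In P Ps -> prime_ideal P /\ ~ isub M P) /\
  forall w, (forall P, List.In P Ps -> ~ P w) -> nzd b w.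
Proof.
move=> nsoc.
pose S u := ~ b u /\ forall v, ~ b v -> isub (icolon b u) (icolon b v) ->
  isub (icolon b v) (icolon b u).
have Sprime u : S u -> prime_ideal (icolon b u).
  move=> [bu umax]; split; first by rewrite icolonE mulr1.
  move=> x y; rewrite icolonE => hxy.
  have [byu|nbyu] := pselect (b (u * y)); [by right | left].
  apply: (umax (u * y) nbyu); last by rewrite icolonE mulrAC -mulrA.
  by move=> r; rewrite !icolonE mulrAC; apply: ideal_mulr.
have Smax v : ~ b v -> exists u, S u /\ isub (icolon b v) (icolon b u).
  move=> bv; have [|L [[u [bu ->]] vu umax]] := @noeth_max _ noeth
      (fun L => exists u, ~ b u /\ L = icolon b u) (icolon b v).
    by exists v.
  exists u; split=> //; split=> // v' bv'; apply: umax; by exists v'.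
have [s [sS Ss]] := @noeth_generators S.
exists [seq icolon b u | u <- s]; split=> [P|w hw r bwr].
  move=> /In_map [u [<- us]].
  have Su : S u by apply/sS/In_mem.
  split; first exact: Sprime.
  move=> Mu; apply: nsoc; exists u; split; first by case: Su.
  by move=> c /Mu; rewrite icolonE [u * c]mulrC.
apply: contrapT => br; have [u [Su ru]] := Smax r br.
have wu : icolon b u w by apply: ru; rewrite icolonE [r * w]mulrC.
have [[z zs zu]|hno] := pselect (exists2 z, List.In z s & isub (icolon b z) (icolon b u)).
  apply: (hw (icolon b z)); first by apply/In_map; exists z.
  have [bz zmax] : S z by apply/sS/In_mem.
  by apply: (zmax u) => //; case: Su.
have [J /In_map [z [<- zs]] hz|v [Pv hv]] :=
  @prime_prod (icolon b u) [seq icolon b u | u <- s] (Sprime u Su).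
  by apply: hno; exists z.
apply: Pv; rewrite icolonE mulrC.
suff h : isub (generated_by s) (icolon b v).
  by rewrite -icolonE; apply/h/Ss; apply: sub_generated.
apply: generated_min => z zs; rewrite icolonE mulrC -icolonE; apply: hv.
by apply/In_map; exists z; split=> //; apply/In_mem.
Qed.

Lemma common_nzd (bs : seq (ideal R)) : (forall b, List.In b bs -> ~ soc b) ->
  exists w, M w /\ forall b, List.In b bs -> nzd b w.
Proof.
move=> hbs; suff [Ps [h1 h2]] : exists Ps : seq (ideal R),
    (forall P, List.In P Ps -> prime_ideal P /\ ~ isub M P) /\
    forall w, (forall P, List.In P Ps -> ~ P w) -> forall b, List.In b bs -> nzd b w.
  by have [w [Mw hw]] := prime_avoidance h1; exists w; split=> //; apply: h2.
elim: bs hbs => [|b bs IH] hbs; first by exists [::].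
have [|Ps [h1 h2]] := IH; first by move=> b' h; apply: hbs; right.
have [|Qs [h3 h4]] := @zero_divisors_primes b; first by apply: hbs; left.
exists (Qs ++ Ps); split=> [P h|w hw b' [<-|hb']].
- by case: ((In_cat _ _ _).1 h) => [/h3|/h1].
- by apply: h4 => P hP; apply: hw; apply/In_cat; left.
- by apply: h2 hb' => P hP; apply: hw; apply/In_cat; right.
Qed.

(** The socle of [R/(b + xR)] is [Ext^1(R/M, R/b)], which does not depend on [x]. Explicitly, [u]
    corresponds to the [v] with [w u = x v] modulo [b]. *)
Lemma soc_exchange b x w : M x -> M w -> nzd b x -> nzd b w ->
  soc (iadd b (iprin x)) -> soc (iadd b (iprin w)).
Proof.
move=> Mx Mw bx bw [u [nu hu]].
have [b0 [_ [bb0 [v [_ ->]] e]]] := hu w Mw.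
exists v; split.
  move=> [b1 [_ [bb1 [v' [_ ->]] e1]]]; apply: nu.
  exists (u - x * v'), (x * v'); split; [|by exists v' | by ring].
  apply: bw; have -> : w * (u - x * v') = b0 + x * b1.
    by rewrite mulrBr e e1; ring.
  by apply: idealD => //; apply: idealM.
move=> c Mc; have [b1 [_ [bb1 [w1 [_ ->]] e1]]] := hu c Mc.
exists (c * v - w * w1), (w * w1); split; [|by exists w1 | by ring].
apply: bx; have -> : x * (c * v - w * w1) = w * b1 - c * b0.
  have -> : x * (c * v - w * w1) = c * (x * v) - w * (x * w1) by ring.
  have -> : x * v = w * u - b0 by rewrite e; ring.
  have -> : x * w1 = c * u - b1 by rewrite e1; ring.
  by ring.
by apply: idealB; apply: idealM.
Qed.

(** One half of the regularity of the permuted sequence [w, x]; the other half, regularity of [w]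
    modulo [b], is secured in [soc_transfer] by the choice of [w]. *)
Lemma nzd_swap b x w : nzd b x -> nzd (iadd b (iprin x)) w ->
  nzd (iadd b (iprin w)) x.
Proof.
move=> bx bw u [b0 [_ [bb0 [v [_ ->]] e]]].
have [|b1 [_ [bb1 [v' [_ ->]] e1]]] := bw v.
  exists (- b0), (x * u); split; [exact: idealN | by exists u | by rewrite e; ring].
exists (u - w * v'), (w * v'); split; [|by exists v' | by ring].
apply: bx; have -> : x * (u - w * v') = b0 + w * b1.
  by rewrite mulrBr e e1; ring.
by apply: idealD => //; apply: idealM.
Qed.

Definition regular_mod b n xs := (n <= size xs)%N /\ forall i, (i < n)%N ->
  M (nth 0 xs i) /\ nzd (iadd b (generated_by (take i xs))) (nth 0 xs i).

Lemma gen_take_add b xs i : (i < size xs)%N ->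
  iadd b (generated_by (take i.+1 xs)) =
  iadd (iadd b (generated_by (take i xs))) (iprin (nth 0 xs i)).
Proof. by move=> h; rewrite gen_take // iaddA. Qed.

(* Both sequences can be made to start with a common element [w]: it may replace
   the last element of either sequence, and then be moved to the front. *)
Lemma soc_transfer n b xs zs : regular_mod b n xs -> regular_mod b n zs ->
  soc (iadd b (generated_by (take n xs))) -> soc (iadd b (generated_by (take n zs))).
Proof.
elim: n b => [|n IH] b [sx hx] [sz hz]; first by rewrite !take0.
pose bs ts := [seq iadd b (generated_by (take i ts)) | i <- iota 0 n.+1].
have nsoc ts : (forall i, (i < n.+1)%N -> M (nth 0 ts i) /\
    nzd (iadd b (generated_by (take i ts))) (nth 0 ts i)) ->
    forall b', List.In b' (bs ts) -> ~ soc b'.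
  move=> ht b' /In_map [i [<- hi]].
  by move/In_mem: hi; rewrite mem_iota add0n => /ht [Mi ni]; apply: (nzd_nsoc Mi ni).
have [|w [Mw hw]] := @common_nzd (bs xs ++ bs zs).
  by move=> b' h; case: ((In_cat _ _ _).1 h) => h'; [apply: (nsoc xs) | apply: (nsoc zs)].
have inbs ts i : (i < n.+1)%N -> List.In (iadd b (generated_by (take i ts))) (bs ts).
  move=> hi; rewrite /bs; apply/In_map; exists i; split=> //.
  by apply/In_mem; rewrite mem_iota.
have wx i : (i < n.+1)%N -> nzd (iadd b (generated_by (take i xs))) w.
  by move=> hi; apply: hw; apply/In_cat; left; apply: inbs.
have wz i : (i < n.+1)%N -> nzd (iadd b (generated_by (take i zs))) w.
  by move=> hi; apply: hw; apply/In_cat; right; apply: inbs.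
have comm ts i : iadd (iadd b (iprin w)) (generated_by (take i ts)) =
                 iadd (iadd b (generated_by (take i ts))) (iprin w).
  by rewrite -!iaddA [iadd (iprin w) _]iaddC.
have shift ts : (n < size ts)%N -> (forall i, (i < n.+1)%N -> M (nth 0 ts i) /\
    nzd (iadd b (generated_by (take i ts))) (nth 0 ts i)) ->
    (forall i, (i < n.+1)%N -> nzd (iadd b (generated_by (take i ts))) w) ->
    regular_mod (iadd b (iprin w)) n ts.
  move=> hs ht hwt; split; first exact: ltnW.
  move=> i hi; have [Mi ni] := ht i (ltnW hi); split=> //.
  rewrite comm; apply: nzd_swap => //; rewrite -gen_take_add; last exact: ltn_trans hs.
  exact: hwt.
have [Mx nx] := hx n (leqnn _); have [Mz nz] := hz n (leqnn _).
rewrite !gen_take_add // => h1.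
have h2 := soc_exchange Mx Mw nx (wx n (leqnn _)) h1.
rewrite -comm in h2.
have h3 := IH _ (shift xs sx hx wx) (shift zs sz hz wz) h2.
rewrite comm in h3.
exact: soc_exchange Mw Mz (wz n (leqnn _)) nz h3.
Qed.

(** In a longer [zs], the entry after the first [size xs] ones would be regular on a quotient that
    has a nonzero socle by [soc_transfer]. *)
Lemma regular_size_le b xs zs : regular_mod b (size xs) xs ->
  soc (iadd b (generated_by xs)) -> regular_mod b (size zs) zs ->
  (size zs <= size xs)%N.
Proof.
move=> hx sx [_ hz]; rewrite leqNgt; apply/negP => lt.
have hz' : regular_mod b (size xs) zs.
  by split; [exact: ltnW | move=> i hi; apply: hz; apply: ltn_trans lt].
have [Mz nz] := hz _ lt.
apply: (nzd_nsoc Mz nz); apply: soc_transfer hx hz' _.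
by rewrite take_size.
Qed.

Lemma soc_of_nilpotent b f N : ~ b f -> isub (M ^i N) (icolon b f) ->
  exists c, ~ b (c * f) /\ forall z, M z -> b (z * (c * f)).
Proof.
elim: N f => [|N IH] f bf hN.
  by case: bf; rewrite -(mulr1 f) -icolonE; apply: hN.
have [[z [Mz bz]]|hno] := pselect (exists z, M z /\ ~ b (z * f)).
  have [|c [h1 h2]] := IH (z * f) bz.
    move=> r hr; rewrite icolonE; have -> : z * f * r = f * (z * r) by ring.
    by rewrite -icolonE; apply: hN; rewrite iexpS; apply: imul_mem.
  by exists (c * z); rewrite -mulrA.
exists 1; rewrite mul1r; split=> // z Mz; apply: contrapT => bz.
by apply: hno; exists z.
Qed.

(** [P'] is maximal among the ideals that contain [b] and avoid the multiplicative set of all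
    [z^i c] with [c] outside [P]. As [z] is regular modulo [b], the ideal [b] itself avoids this
    set. *)
Lemma smaller_prime b P z : nzd b z -> isub b P -> prime_ideal P ->
  exists P', [/\ prime_ideal P', isub b P', isub P' P & ~ P' z].
Proof.
move=> bz bP [P1 Pp].
have nzdX i r : b (z ^+ i * r) -> b r.
  by elim: i => [|i IH]; rewrite ?mul1r // exprS -mulrA => /bz /IH.
pose ok K := isub b K /\ forall i c, K (z ^+ i * c) -> P c.
have [|K [[bK Kok] _ Kmax]] := @noeth_max _ noeth ok b.
  by split=> // i c /nzdX /bP.
have out x : ~ K x -> exists i c k r, [/\ ~ P c, K k & z ^+ i * c = k + x * r].
  move=> Kx; apply: contrapT => hno; apply: Kx.
  apply: (Kmax (iadd K (iprin x))); last by apply: iadd_subr; apply: iprin_mem.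
    split; first by move=> u /bK; apply: iadd_subl.
    move=> i c [k [_ [Kk [r [_ ->]] e]]]; apply: contrapT => Pc.
    by apply: hno; exists i, c, k, r.
  exact: iadd_subl.
exists K; split=> //.
- split; first by move=> K1; apply: P1; apply: (Kok 0%N); rewrite mulr1.
  move=> x y Kxy; apply: contrapT => /not_orP [/out [i [c [k [r [Pc Kk e]]]]]].
  move=> /out [j [c' [k' [r' [Pc' Kk' e']]]]].
  suff : P (c * c') by move=> /Pp [].
  apply: (Kok (i + j)%N); have -> : z ^+ (i + j) * (c * c') =
      (z ^+ i * c) * (z ^+ j * c') by rewrite exprD; ring.
  rewrite e e'; have -> : (k + x * r) * (k' + y * r') =
      k * (k' + y * r') + (x * r * k' + x * y * (r * r')) by ring.
  apply: idealD; first exact: ideal_mulr.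
  by apply: idealD; [exact: idealM | exact: ideal_mulr].
- by move=> c Kc; apply: (Kok 0%N); rewrite mul1r.
- by move=> Kz; apply: P1; apply: (Kok 1%N); rewrite mulr1.
Qed.

(** Each regular element is avoided by a prime strictly below the previous one. This is the
    inequality between depth and dimension. *)
Lemma regular_prime_chain zs P n : (n <= size zs)%N ->
  (forall i, (i < n)%N -> nzd (generated_by (take i zs)) (nth 0 zs i)) ->
  prime_ideal P -> isub (generated_by (take n zs)) P ->
  chain_to (@prime_ideal R) n P.
Proof.
elim: n P => [|n IH] P hn hz PP hP; first by exists (fun=> P).
rewrite gen_take // in hP.
have [|P' [PP' h1 h2 h3]] := smaller_prime (hz n (leqnn _)) _ PP.
  by move=> u hu; apply: hP; apply: iadd_subl.
have c1 : chain_to (@prime_ideal R) n P'.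
  by apply: IH => //; [exact: ltnW | move=> i hi; apply: hz; apply: ltnW].
apply: chain_to_snoc c1 PP h2 _ => h; apply: h3; apply: h.
by apply: hP; apply: iadd_subr; apply: iprin_mem.
Qed.

End Grade.

(** * Quotient rings *)

Section Quotients.
Variables (R : comPzRingType) (a : ideal R).
Implicit Types (b I J K : ideal R) (x y : R) (N L : ideal (quo_ring a)).
Local Notation pi := (quo_pi a).

Lemma quo_pi_eq0 x : pi x = 0 <-> a x.
Proof. by rewrite -(raddf0 pi) quo_piP subr0. Qed.

Lemma quo_pi_surj (z : quo_ring a) : exists x, z = pi x.
Proof. by exists (quo_repr z); rewrite quo_piK. Qed.

Definition ipre N : ideal R.
Proof.
exists (fun x => N (pi x)).
- by rewrite raddf0; apply: ideal0.
- by move=> x y; rewrite raddfD; apply: idealD.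
- by move=> c x; rewrite rmorphM; apply: idealM.
Defined.

Arguments ipre : simpl never.

Lemma ipreE N x : ipre N x = N (pi x). Proof. by []. Qed.

Lemma quo_idealP J x : quo_ideal a J (pi x) <-> iadd J a x.
Proof.
split=> [|[j [z [Jj az ->]]]]; last first.
  rewrite raddfD /= (proj2 (quo_pi_eq0 z) az) addr0.
  by apply: sub_generated; exists j.
pose W (z : quo_ring a) := exists2 j, J j & z = pi j.
have W0 : W 0 by exists 0; [exact: ideal0 | rewrite raddf0].
have WD u v : W u -> W v -> W (u + v).
  by move=> [j Jj ->] [j' Jj' ->]; exists (j + j'); [exact: idealD | rewrite raddfD].
have WM u v : W v -> W (u * v).
  move=> [j Jj ->]; have [c ->] := quo_pi_surj u.
  by exists (c * j); [exact: idealM | rewrite rmorphM].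
have : isub (quo_ideal a J) (Ideal W0 WD WM).
  by apply: generated_min => _ [j Jj <-]; exists j.
move=> /[apply] -[j Jj /quo_piP axj]; exists j, (x - j); split=> //; ring.
Qed.

Lemma ipre_quo J : ipre (quo_ideal a J) = iadd J a.
Proof. by apply: ideal_eq => x; apply: quo_idealP. Qed.

Lemma ipre_inj N L : isub (ipre N) (ipre L) -> isub N L.
Proof. by move=> h z; have [x ->] := quo_pi_surj z => /h. Qed.

Lemma a_ipre N : isub a (ipre N).
Proof. by move=> x /quo_pi_eq0 e; rewrite ipreE e; apply: ideal0. Qed.

Lemma quo_ipre N : quo_ideal a (ipre N) = N.
Proof.
by apply: isub_anti; apply: ipre_inj; rewrite ipre_quo iadd_idr //; exact: a_ipre.
Qed.

Lemma haslen_quo N L n :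
  haslen N L n <-> haslen (ipre N) (ipre L) n.
Proof.
have pm (J J' : ideal (quo_ring a)) : isub J J' -> isub (ipre J) (ipre J').
  by move=> h x; apply: h.
have qm J J' : isub J J' -> isub (quo_ideal a J) (quo_ideal a J').
  by move=> h; apply: ipre_inj; rewrite !ipre_quo; apply: iaddS.
have P1 (J : ideal (quo_ring a)) : between N L J -> between (ipre N) (ipre L) (ipre J).
  by move=> [h1 h2]; split=> x; [apply: h1 | apply: h2].
have P2 K : between (ipre N) (ipre L) K -> between N L (quo_ideal a K).
  move=> [h1 h2]; split; apply: ipre_inj; rewrite ipre_quo.
    by move=> x /h1; apply: iadd_subl.
  by apply: iadd_min => //; exact: a_ipre.
have P3 K : between (ipre N) (ipre L) K -> ipre (quo_ideal a K) = K.
  move=> [h1 _]; rewrite ipre_quo iadd_idr // => x ax; apply: h1; exact: a_ipre.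
split.
  apply: (@haslen_iso _ _ _ _ _ _ ipre (quo_ideal a)) => // *;
    [exact: pm | exact: qm | exact: quo_ipre].
apply: (@haslen_iso _ _ _ _ _ _ (quo_ideal a) ipre) => // *;
  [exact: qm | exact: pm | exact: quo_ipre].
Qed.

Lemma length_quo N L : fin (ipre N) (ipre L) ->
  length N L = (len (ipre N) (ipre L))%:Z%:E.
Proof.
move=> h; have [n hn] := h; have hn' := proj2 (haslen_quo N L n) hn.
by rewrite length_len; [rewrite (haslen_len hn) (haslen_len hn') | exists n].
Qed.

Lemma quo_ideal_mul I J : quo_ideal a (I *i J) = quo_ideal a I *i quo_ideal a J.
Proof.
apply: isub_anti.
  apply: generated_min => _ [z IJz <-]; rewrite -ipreE; move: z IJz.
  apply: imul_min => x y Ix Jy; rewrite ipreE rmorphM.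
  by apply: imul_mem; apply/quo_idealP/iadd_subl.
apply: imul_min => u v; have [x ->] := quo_pi_surj u; have [y ->] := quo_pi_surj v.
move=> /quo_idealP [i [z [Ii az ->]]] /quo_idealP [j [w [Jj aw ->]]].
rewrite -rmorphM; apply/quo_idealP.
have -> : (i + z) * (j + w) = i * j + (i * w + z * (j + w)) by ring.
exists (i * j), (i * w + z * (j + w)); split=> //; first exact: imul_mem.
by apply: idealD; [exact: idealM | exact: ideal_mulr].
Qed.

Lemma quo_ideal_unit : quo_ideal a unit_ideal = unit_ideal.
Proof.
apply: isub_anti => // z _; have [x ->] := quo_pi_surj z.
by apply/quo_idealP/iadd_subl.
Qed.

Lemma quo_ideal_exp I n : quo_ideal a (I ^i n) = (quo_ideal a I) ^i n.
Proof.
elim: n => [|n IH]; first exact: quo_ideal_unit.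
by rewrite !iexpS quo_ideal_mul IH.
Qed.

Lemma nonzerodivisor_quo x : nonzerodivisor (pi x) <-> nzd a x.
Proof.
split=> [h r /quo_pi_eq0|h z].
  by rewrite rmorphM => /h /quo_pi_eq0.
by have [r ->] := quo_pi_surj z; rewrite -rmorphM => /quo_pi_eq0 /h /quo_pi_eq0.
Qed.

Lemma superficial_quo I x : superficial (quo_ideal a I) (pi x) -> superf I a x.
Proof.
move=> [_ _ [c [_ hc]]]; exists c => n cn r [xr hr].
have E := hc n cn.
apply/quo_idealP; rewrite quo_ideal_exp -E; split; last by rewrite -quo_ideal_exp; apply/quo_idealP.
by rewrite /mkset -rmorphM -quo_ideal_exp; apply/quo_idealP; rewrite mulrC.
Qed.

End Quotients.

Lemma regular_sequenceP (R : comPzRingType) (s : seq R) : regular_sequence s <->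
  (forall i, (i < size s)%N -> nzd (generated_by (take i s)) (nth 0 s i)) /\
  ~ generated_by s 1.
Proof.
have e : (1 : quo_ring (generated_by s)) = quo_pi (generated_by s) 1 by [].
split=> -[h1 h2]; split.
- by move=> i /h1 /nonzerodivisor_quo.
- by move=> h; apply: h2; rewrite e; apply/quo_pi_eq0.
- by move=> i /h1 ?; apply/nonzerodivisor_quo.
- by rewrite e => /quo_pi_eq0.
Qed.

Lemma hilbert_coefs_hil (R : comPzRingType) d (J : ideal R) e :
  hilbert_coefs d J e -> hil J izero d e.
Proof.
move=> [n0 h]; exists n0 => n /h h'; rewrite iadd0.
have f := length_fin h'; split=> //.
by move: h'; rewrite length_len // => -[].
Qed.

Lemma sum_EFin (u : nat -> nat) N :
  (\sum_(1 <= n < N) (u n)%:Z%:E)%E = ((\sum_(1 <= n < N) u n)%N%:Z)%:E.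
Proof.
elim: N => [|N IH]; first by rewrite !big_geq.
case: N IH => [|N] IH; first by rewrite !big_geq.
by rewrite [LHS]big_nat_recr //= IH [in RHS]big_nat_recr.
Qed.

(** * The Rees algebra *)

Lemma noetherian_surj (S S' : comPzRingType) (f : {rmorphism S -> S'}) :
  (forall z, exists x, f x = z) -> noetherian S -> noetherian S'.
Proof.
move=> fs noeth J.
pose W x := J (f x).
have W0 : W 0 by rewrite /W rmorph0; apply: ideal0.
have WD x y : W x -> W y -> W (x + y) by rewrite /W rmorphD; apply: idealD.
have WM x y : W y -> W (x * y) by rewrite /W rmorphM; apply: idealM.
have [s /ideal_set_inj e] := noeth (Ideal W0 WD WM).
exists [seq f x | x <- s]; congr ideal_set; apply: isub_anti.
  move=> z; have [x <-] := fs z => Jx.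
  have : Ideal W0 WD WM x by [].
  rewrite e; move: x {Jx} => x hx.
  pose V x := generated_by [seq f x | x <- s] (f x).
  have V0 : V 0 by rewrite /V rmorph0; apply: ideal0.
  have VD u v : V u -> V v -> V (u + v) by rewrite /V rmorphD; apply: idealD.
  have VM u v : V v -> V (u * v) by rewrite /V rmorphM; apply: idealM.
  apply: (@generated_min _ _ (Ideal V0 VD VM) _ x hx) => u us.
  by apply: gen_mem; apply: map_f.
apply: generated_min => _ /mapP [x xs ->].
by have : Ideal W0 WD WM x by [rewrite e; apply: gen_mem].
Qed.

(** * Hilbert's basis theorem *)

Section HilbertBasis.
Variable R : comNzRingType.
Hypothesis noeth : noetherian R.
Implicit Types (p q : {poly R}) (c : R) (n : nat).
Variable J : ideal {poly R}.

(** The degree of [p] may be below [n]: this admits [c = 0], so that these coefficients form an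
    ideal. *)
Let lead n c := exists p, [/\ J p, (size p <= n.+1)%N & p`_n = c].

Let lead0 n : lead n 0.
Proof. by exists 0; split; rewrite ?size_poly0 ?coef0 //; apply: ideal0. Qed.

Let leadD n c c' : lead n c -> lead n c' -> lead n (c + c').
Proof.
move=> [p [Jp sp <-]] [q [Jq sq <-]]; exists (p + q); split; rewrite ?coefD //.
  exact: idealD.
by apply: leq_trans (size_polyD _ _) _; rewrite geq_max sp.
Qed.

Let leadM n u c : lead n c -> lead n (u * c).
Proof.
move=> [p [Jp sp <-]]; exists (u%:P * p); split; rewrite ?coefCM //.
  exact: idealM.
by rewrite mul_polyC; apply: leq_trans (size_scale_leq _ _) _.
Qed.

Let L n := Ideal (@lead0 n) (@leadD n) (@leadM n).

Lemma lead_shift n i c : L n c -> L (i + n) c.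
Proof.
move=> [p [Jp sp <-]]; exists ('X^i * p); split.
- exact: idealM.
- by apply: leq_trans (size_polyMleq _ _) _; rewrite size_polyXn addSn /= -addnS leq_add2l.
- by rewrite coefXnM ltnNge leq_addr /= addKn.
Qed.

Lemma lead_generators n : exists T : seq {poly R}, (forall p, p \in T -> J p) /\
  forall c, L n c -> exists q, [/\ generated_by T q, (size q <= n.+1)%N & q`_n = c].
Proof.
have [s /ideal_set_inj e] := noeth (L n); rewrite e.
have : forall c, c \in s -> L n c by move=> c cs; rewrite e; apply: gen_mem.
elim: s {e} => [|x s IH] hs.
  exists [::]; split=> // c; rewrite gen_nil => ->; exists 0.
  by rewrite size_poly0 coef0; split=> //; apply: ideal0.
have [|T [TJ hT]] := IH; first by move=> c cs; apply: hs; rewrite inE cs orbT.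
have [p [Jp sp px]] := hs x (mem_head _ _).
exists (p :: T); split; first by move=> q; rewrite inE => /orP[/eqP ->|/TJ].
move=> c; rewrite !gen_cons => -[_ [d [[r [_ ->]] /hT [q [Tq sq <-]] ->]]].
exists (p * r%:P + q); split.
- by exists (p * r%:P), q; split=> //; exists r%:P.
- apply: leq_trans (size_polyD _ _) _; rewrite geq_max sq andbT mulrC mul_polyC.
  exact: leq_trans (size_scale_leq _ _) _.
- by rewrite coefD coefMC px.
Qed.

Lemma ideal_poly_fg : exists s : seq {poly R}, J%:I = (generated_by s)%:I.
Proof.
have [|K [[N ->] _ Nmax]] := @noeth_max _ noeth (fun K => exists n, K = L n) (L 0).
  by exists 0%N.
have gens m : exists T : seq {poly R}, (forall p, p \in T -> J p) /\
    forall n, (n < m)%N -> forall c, L n c ->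
      exists q, [/\ generated_by T q, (size q <= n.+1)%N & q`_n = c].
  elim: m => [|m [T [TJ hT]]]; first by exists [::].
  have [T' [TJ' hT']] := lead_generators m.
  exists (T ++ T'); split=> [p|n]; first by rewrite mem_cat => /orP[/TJ|/TJ'].
  rewrite ltnS leq_eqVlt => /orP[/eqP -> c /hT'|nm c /(hT n nm)] [q [Tq sq qc]].
    by exists q; split=> //; rewrite gen_cat; apply: iadd_subr.
  by exists q; split=> //; rewrite gen_cat; apply: iadd_subl.
have [T [TJ hT]] := gens N.+1; exists T; congr ideal_set; apply: isub_anti; last first.
  by apply: generated_min.
suff h n p : (size p <= n)%N -> J p -> generated_by T p by move=> p; apply: h (leqnn _).
elim: n p => [|n IH] p sp Jp.
  by move: sp; rewrite leqn0 size_poly_eq0 => /eqP ->; apply: ideal0.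
suff [q [Tq sq qn]] : exists q, [/\ generated_by T q, (size q <= n.+1)%N & q`_n = p`_n].
  rewrite -[p](subrK q); apply: idealD => //; apply: IH; last first.
    by apply: idealB => //; move: q Tq {sq qn}; apply: generated_min.
  have spq : (size (p - q)%R <= n.+1)%N.
    by apply: leq_trans (size_polyD _ _) _; rewrite size_polyN geq_max sp.
  apply/leq_sizeP => j; rewrite leq_eqVlt => /orP[/eqP <-|nj]; first by rewrite coefB qn subrr.
  by move/leq_sizeP: spq; apply.
have Ln : L n p`_n by exists p.
have [nN|Nn] := leqP n N; first exact: hT.
have LN : L N p`_n.
  apply: Nmax Ln; first by exists n.
  by move=> c; rewrite -(subnK (ltnW Nn)); apply: lead_shift.
have [q [Tq sq qN]] := hT N (leqnn _) _ LN; exists ('X^(n - N) * q); split.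
- exact: idealM.
- apply: leq_trans (size_polyMleq _ _) _; rewrite size_polyXn addSn /=.
  by rewrite -(subnK (ltnW Nn)) addnK -addnS leq_add2l.
- by rewrite coefXnM ltnNge leq_subr /= subKn ?(ltnW Nn).
Qed.

End HilbertBasis.

Lemma noetherian_poly (R : comNzRingType) : noetherian R -> noetherian {poly R}.
Proof. by move=> h J; apply: ideal_poly_fg. Qed.

Section Rees.
Variables (R : comNzRingType) (I : ideal R).
Implicit Types (c u v x : R) (n i j : nat) (p q : rees I).

Lemma rees_coef p n : (I ^i n) (rees_poly p)`_n.
Proof. by have /rees_predP := valP p. Qed.

(** The default value is 0 when [c] is not in [I^n]. *)
Definition mono n c : rees I := insubd 0 (c *: 'X^n).

Lemma monoE n c : (I ^i n) c -> rees_poly (mono n c) = c *: 'X^n.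
Proof.
move=> Ic; rewrite /mono -[rees_poly _]/(val _) val_insubd; case: ifP => // /negP [].
apply/rees_predP => j; rewrite coefZ coefXn; case: eqP => [->|_].
  by rewrite mulr1.
by rewrite mulr0; apply: ideal0.
Qed.

Lemma rees_inj p q : rees_poly p = rees_poly q -> p = q.
Proof. by move=> e; apply: val_inj. Qed.

Lemma rees_polyD p q : rees_poly (p + q) = rees_poly p + rees_poly q.
Proof. by []. Qed.

Lemma rees_polyM p q : rees_poly (p * q) = rees_poly p * rees_poly q.
Proof. by []. Qed.

Lemma rees_poly_sum m (F : 'I_m -> rees I) :
  rees_poly (\sum_(i < m) F i) = \sum_(i < m) rees_poly (F i).
Proof. by apply: (big_morph (@rees_poly R I)). Qed.

Lemma rees_sum p : p = \sum_(i < size (rees_poly p)) mono i (rees_poly p)`_i.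
Proof.
apply: rees_inj; rewrite rees_poly_sum -[LHS]coefK poly_def.
by apply: eq_bigr => i _; rewrite monoE //; apply: rees_coef.
Qed.

Lemma monoM m n u v : (I ^i m) u -> (I ^i n) v ->
  mono (m + n) (u * v) = mono m u * mono n v.
Proof.
move=> Iu Iv; apply: rees_inj; rewrite rees_polyM !monoE //; last exact: ideal_expM.
by rewrite -scalerAl -scalerAr scalerA exprD.
Qed.

Lemma monoD n u v : (I ^i n) u -> (I ^i n) v -> mono n (u + v) = mono n u + mono n v.
Proof.
move=> Iu Iv; apply: rees_inj; rewrite rees_polyD !monoE ?scalerDl //.
exact: idealD.
Qed.

Lemma mono0 n : mono n 0 = 0.
Proof. by apply: rees_inj; rewrite monoE ?scale0r //; apply: ideal0. Qed.

Definition rees_const c : rees I := mono 0 c.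

Lemma rees_constE c : rees_poly (rees_const c) = c%:P.
Proof. by rewrite monoE // expr0 alg_polyC. Qed.

Lemma rees_const_zmod : zmod_morphism rees_const.
Proof.
move=> u v; apply: rees_inj; rewrite rees_constE.
have -> : rees_poly (rees_const u - rees_const v) =
          rees_poly (rees_const u) - rees_poly (rees_const v) by [].
by rewrite !rees_constE polyCB.
Qed.

Lemma rees_const_monoid : monoid_morphism rees_const.
Proof.
split; first by apply: rees_inj; rewrite rees_constE.
by move=> u v; apply: rees_inj; rewrite rees_polyM !rees_constE polyCM.
Qed.

HB.instance Definition _ :=
  GRing.isZmodMorphism.Build R (rees I) rees_const rees_const_zmod.
HB.instance Definition _ :=
  GRing.isMonoidMorphism.Build R (rees I) rees_const rees_const_monoid.

(** Variables are adjoined one at a time, so the basis theorem for one variable suffices. The image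
    need only contain the constants and the generators of degree one. *)
Lemma rees_presentation (s : seq R) : noetherian R -> (forall b, b \in s -> I b) ->
  exists (S : comNzRingType) (f : {rmorphism S -> rees I}),
    [/\ noetherian S, forall c, exists z, f z = rees_const c &
        forall b, b \in s -> exists z, f z = mono 1 b].
Proof.
move=> noeth; elim: s => [|b s IH] hs.
  by exists R, rees_const; split=> // c; exists c.
have [|S [f [noeS fc fs]]] := IH; first by move=> c cs; apply: hs; rewrite inE cs orbT.
have cfu : commr_rmorph f (mono 1 b) by move=> z; exact: mulrC.
exists {poly S}, (horner_morph cfu); split.
- exact: noetherian_poly.
- by move=> c; have [x <-] := fc c; exists x%:P; exact: horner_morphC.
- move=> c; rewrite inE => /orP[/eqP ->|/fs [x <-]].
    by exists 'X; exact: horner_morphX.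
  by exists x%:P; exact: horner_morphC.
Qed.

Lemma noetherian_rees : noetherian R -> noetherian (rees I).
Proof.
move=> noeth; have [s /ideal_set_inj e] := noeth I.
have [|S [f [noeS fc fs]]] := @rees_presentation s noeth.
  by move=> b bs; rewrite e; apply: gen_mem.
apply: (noetherian_surj (f := f)) noeS.
pose W n c := (I ^i n) c /\ exists z, f z = mono n c.
have W0 n : W n 0.
  by split; [exact: ideal0 | exists 0; rewrite mono0 rmorph0].
have WD n u v : W n u -> W n v -> W n (u + v).
  move=> [Iu [x hx]] [Iv [y hy]]; split; first exact: idealD.
  by exists (x + y); rewrite rmorphD hx hy monoD.
have WM n u v : W n v -> W n (u * v).
  move=> [Iv [y hy]]; have [x hx] := fc u; split; first exact: idealM.
  by exists (x * y); rewrite rmorphM hx hy /rees_const -monoM.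
pose WI n := Ideal (W0 n) (@WD n) (@WM n).
have I1 : isub I (WI 1%N).
  rewrite {1}e; apply: generated_min => b bs; split; last exact: fs.
  by rewrite iexp1 e; apply: gen_mem.
have In n : isub (I ^i n) (WI n).
  elim: n => [|n IH]; first by move=> c _; split=> //; exact: fc.
  rewrite iexpS; apply: imul_min => u v /I1 [Iu [x hx]] /IH [Iv [y hy]]; split.
    by rewrite -add1n iexpD; apply: imul_mem.
  by exists (x * y); rewrite rmorphM hx hy -monoM ?add1n.
move=> p; rewrite (rees_sum p); elim: (size _) => [|m [x hx]].
  by exists 0; rewrite big_ord0 rmorph0.
have [_ [y hy]] := In m _ (rees_coef p m).
by exists (x + y); rewrite rmorphD hx hy big_ord_recr.
Qed.

Lemma rees_ideal_homog (K : ideal (rees I)) p :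
  (forall n, K (mono n (rees_poly p)`_n)) -> K p.
Proof. by move=> h; rewrite (rees_sum p); apply: ideal_sum => i _; apply: h. Qed.

(* The preimage in the Rees algebra of the kernel of [G(I) -> G(I(R/a))]. *)
Definition rees_ker (a : ideal R) : ideal (rees I).
Proof.
exists (fun p => forall n, (iadd (I ^i n.+1) a) (rees_poly p)`_n).
- by move=> n; rewrite coef0; apply: ideal0.
- by move=> p q hp hq n; rewrite coefD; apply: idealD.
- move=> p q hq n; rewrite coefM; apply: ideal_sum => i _.
  have [u [v [Iu av ->]]] := hq (n - i)%N; rewrite mulrDr.
  exists ((rees_poly p)`_i * u), ((rees_poly p)`_i * v); split=> //.
    have hi : (i <= n)%N by rewrite -ltnS.
    by have := ideal_expM (rees_coef p i) Iu; rewrite addnS subnKC.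
  exact: idealM.
Defined.

Lemma rees_kerE a p : rees_ker a p <-> forall n, (iadd (I ^i n.+1) a) (rees_poly p)`_n.
Proof. by []. Qed.

Lemma rees_ker0 : rees_ker izero = rees_shift I.
Proof. by apply: ideal_eq => p; rewrite rees_kerE; split=> h n; have := h n; rewrite iadd0. Qed.

Lemma rees_ker_mono a n c : (I ^i n) c -> rees_ker a (mono n c) <-> iadd (I ^i n.+1) a c.
Proof.
move=> Ic; rewrite rees_kerE; split=> [/(_ n)|h j].
  by rewrite monoE // coefZ coefXn eqxx mulr1.
rewrite monoE // coefZ coefXn; case: eqP => [->|_]; first by rewrite mulr1.
by rewrite mulr0; apply: ideal0.
Qed.

Definition rees_max (m : ideal R) : ideal (rees I).
Proof.
exists (fun p => m (rees_poly p)`_0).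
- by rewrite coef0; apply: ideal0.
- by move=> p q hp hq; rewrite coefD; apply: idealD.
- by move=> p q hq; rewrite coefM big_ord1; apply: idealM.
Defined.

Lemma graded_maxE (m : ideal R) : graded_max I m = quo_ideal (rees_shift I) (rees_max m).
Proof. by []. Qed.

End Rees.

(** * Regularity of the initial forms of a superficial sequence *)

Section ValabregaValla.
Variables (R : comNzRingType) (m I : ideal R) (xs : seq R).
Hypothesis noeth : noetherian R.
Variable N : nat.
Hypothesis mN : isub (m ^i N) I.
Local Notation k := (size xs).
Local Notation a i := (generated_by (take i xs)).
Local Notation X i := (nth 0 xs i).
Hypothesis xsI : forall i, (i < k)%N -> I (X i).
Variable n0 : nat.
Hypothesis large : forall i, (i < k)%N -> forall n, (n0 <= n)%N ->
  icolon (iadd (I ^i n.+1) (a i)) (X i) = iadd (I ^i n) (a i).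
Variable zs : seq (rees I).
Hypothesis zs_reg : regular_mod (rees_max I m) (rees_shift I) (size zs) zs.
Hypothesis zs_size : (k <= size zs)%N.

Let xt := [seq mono I 1 x | x <- xs].

Let aI i : isub (a i) I.
Proof.
apply: generated_min => x; rewrite /mkset => /mem_take xin.
by have := xsI (_ : index x xs < k)%N; rewrite nth_index //; apply; rewrite index_mem.
Qed.

(** The class of [u] in degree [n] of [G(I(R/a_i))] is nonzero and is killed by the initial form of
    [x_i]. *)
Let fails i n u := [/\ (I ^i n) u, iadd (I ^i n.+2) (a i) (X i * u)
  & ~ iadd (I ^i n.+1) (a i) u].

Let vv i := forall n, isub (icap (a i) (I ^i n.+1)) (a i *i I ^i n).

(** The kernel of [G(I) -> G(I(R/a_i))] is generated by the preceding initial forms, so regularity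
    on [G(I(R/a_i))] becomes regularity modulo these forms in [G(I)]. *)
Let layers i := rees_ker I (a i) = iadd (rees_shift I) (generated_by (take i xt)).

Lemma nth_xt i : (i < k)%N -> nth 0 xt i = mono I 1 (X i).
Proof. by move=> ik; rewrite (nth_map 0). Qed.

Let IX i : (i < k)%N -> (I ^i 1) (X i). Proof. by rewrite iexp1; apply: xsI. Qed.

Lemma no_failure i : (i < k)%N -> layers i ->
  regular_mod (rees_max I m) (rees_shift I) i (take i xt) ->
  forall n u, ~ fails i n u.
Proof.
move=> ik hl hreg n u hf.
pose P n := `[< exists u, fails i n u >].
have exP : exists n, P n by exists n; apply/asboolP; exists u.
have ubP j : P j -> (j <= n0)%N.
  move=> /asboolP [w [_ h1 h2]]; rewrite leqNgt; apply/negP => hj; apply: h2.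
  by rewrite -(large ik (leqW (ltnW hj))) icolonE.
(* By [large] no failure has degree above [n0], so there is one of highest degree. *)
have [{n u hf exP ubP}n /asboolP [u [Iu xu nu]] nmax] := ex_maxnP exP ubP.
have nofail j w : (n < j)%N -> ~ fails i j w.
  by move=> nj hw; have : P j by [apply/asboolP; exists w]; move/nmax; rewrite leqNgt nj.
(* [m^N] lies in [I] and kills the class of [u]; hence some nonzero multiple [c u] is killed by
   [m]. *)
have [|c [nc hc]] := @soc_of_nilpotent _ m (iadd (I ^i n.+1) (a i)) u N nu.
  move=> r /mN Ir; rewrite icolonE; apply: iadd_subl.
  by rewrite iexpS mulrC; apply: imul_mem.
have Icu : (I ^i n) (c * u) by apply: idealM.
have xcu : iadd (I ^i n.+2) (a i) (X i * (c * u)) by rewrite mulrCA; apply: idealM.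
have sc : soc (rees_max I m) (rees_ker I (a i)).
  exists (mono I n (c * u)); split; first by move/rees_ker_mono => /(_ Icu).
  move=> p p0; rewrite rees_kerE => j; rewrite rees_polyM monoE //.
  rewrite -scalerAr coefZ coefMXn; case: ltnP => nj; first by rewrite mulr0; apply: ideal0.
  rewrite mulrC; case: (ltngtP n j) nj => // [nj _|<- _]; last first.
    by rewrite subnn; apply: hc.
  (* A nonzero product in a degree [j] above [n] would be a failure of higher degree. *)
  apply: contrapT => hn; apply: (nofail j ((rees_poly p)`_(j - n) * (c * u))) => //.
  have Ip := rees_coef p (j - n); have jE : (j = j - n + n)%N by rewrite subnK // ltnW.
  split=> //; first by rewrite {1}jE iexpD; apply: imul_mem.
  have [b [d [Ib ad e]]] := xcu; rewrite mulrCA e mulrDr.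
  apply: idealD; last by apply: iadd_subr; apply: idealM.
  apply: iadd_subl; have -> : (j.+2 = j - n + n.+2)%N by rewrite {1}jE !addnS.
  by rewrite iexpD; apply: imul_mem.
rewrite hl in sc.
have sz : size (take i xt) = i by rewrite size_takel // size_map ltnW.
have := @regular_size_le _ (@noetherian_rees _ I noeth) (rees_max I m) (rees_shift I)
  (take i xt) zs.
rewrite sz => /(_ hreg sc zs_reg); rewrite leqNgt => /negP; apply.
exact: leq_trans zs_size.
Qed.

Lemma no_failure_nzd i : (i < k)%N -> (forall n u, ~ fails i n u) ->
  nzd (rees_ker I (a i)) (mono I 1 (X i)).
Proof.
move=> ik nf p; rewrite !rees_kerE => hp n; apply: contrapT => hn.
apply: (nf n (rees_poly p)`_n); split=> //; first exact: rees_coef.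
have := hp n.+1; rewrite rees_polyM monoE; last exact: IX.
by rewrite -scalerAl coefZ coefXnM /= subn1.
Qed.

(** Modulo [a_i], [u] climbs from [I^0] to [I^n] one power at a time; an obstruction at any stage
    would be a failure. *)
Lemma no_failure_colon i n : (i < k)%N -> (forall n u, ~ fails i n u) ->
  isub (icolon (iadd (I ^i n.+1) (a i)) (X i)) (iadd (I ^i n) (a i)).
Proof.
move=> ik nf u; rewrite icolonE => xu.
suff h j : (j <= n)%N -> iadd (I ^i j) (a i) u by apply: h.
elim: j => [|j IH] jn; first by rewrite iexp0; apply: iadd_subl.
have [b [d [Ib ad e]]] := IH (ltnW jn).
rewrite e; apply: idealD; last exact: iadd_subr.
apply: contrapT => nb; apply: (nf j b); split=> //.
have -> : X i * b = X i * u - X i * d by rewrite e; ring.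
apply: idealB; last by apply: iadd_subr; apply: idealM.
by move: xu; apply: iaddS => //; apply: iexp_le.
Qed.

(** In [w = b + x_i u] the factor [u] may be taken in [I^n], its component in [a_i] being moved into
    [b]. *)
Lemma vv_step i : (i < k)%N -> (forall n u, ~ fails i n u) -> vv i -> vv i.+1.
Proof.
move=> ik nf hv n w [aw Iw]; rewrite gen_take // in aw *.
have [b [_ [ab [u [_ ->]] e]]] := aw.
have [v [d [Iv ad e1]]] : iadd (I ^i n) (a i) u.
  apply: no_failure_colon => //; rewrite icolonE.
  have -> : X i * u = w - b by rewrite e; ring.
  by apply: idealB; [exact: iadd_subl | exact: iadd_subr].
have hb : icap (a i) (I ^i n.+1) (b + X i * d).
  split; first by apply: idealD => //; apply: idealM.
  have -> : b + X i * d = w - X i * v by rewrite e e1; ring.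
  by apply: idealB => //; rewrite iexpS; apply: imul_mem => //; apply: xsI.
have -> : w = (b + X i * d) + X i * v by rewrite e e1; ring.
rewrite imulDl; apply: idealD; first by apply: iadd_subl; apply: hv.
by apply: iadd_subr; apply: imul_mem => //; apply: iprin_mem.
Qed.

(** By [vv], an element of [a_(i+1)] in [I^(n+1)] is a combination of the [x_j] with coefficients in
    [I^n], hence comes from the initial forms in the right degree. *)
Lemma layers_step i : (i < k)%N -> layers i -> vv i.+1 -> layers i.+1.
Proof.
move=> ik hl hv; rewrite /layers (@gen_take _ xt) ?size_map // iaddA -hl nth_xt //.
apply: isub_anti; last first.
  apply: iadd_min.
    move=> p; rewrite !rees_kerE => hp n; move: (hp n); apply: iaddS => //.
    by rewrite gen_take //; apply: iadd_subl.
  apply: iprin_min; apply/rees_ker_mono; first exact: IX.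
  by apply: iadd_subr; rewrite gen_take //; apply: iadd_subr; apply: iprin_mem.
move=> p hp; apply: rees_ideal_homog => n.
have Ip := rees_coef p n; have {}hp := proj1 (rees_kerE _ _) hp n.
move: ((rees_poly p)`_n) Ip hp => c Ic hc.
case: n Ic hc => [|n] Ic [u [w [Iu aw e]]].
  apply: iadd_subl; apply/rees_ker_mono => //; rewrite e; apply: iadd_subl.
  by apply: idealD => //; rewrite iexp1; apply: aI aw.
have Iw : (I ^i n.+1) w.
  have -> : w = c - u by rewrite e; ring.
  by apply: idealB => //; apply: iexp_le Iu.
have [w1 [w2 [aw1 aw2 e2]]] : (iadd (a i *i I ^i n) (iscale (X i) (I ^i n))) w.
  by rewrite -imul_prin -imulDl -gen_take //; apply: hv.
have Iw2 : (I ^i n.+1) w2.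
  by case: aw2 => v [Iv ->]; rewrite iexpS; apply: imul_mem => //; apply: xsI.
have Iuw : (I ^i n.+1) (u + w1).
  have -> : u + w1 = c - w2 by rewrite e e2; ring.
  exact: idealB.
have -> : c = (u + w1) + w2 by rewrite e e2 addrA.
rewrite monoD //; apply: idealD.
  apply: iadd_subl; apply/rees_ker_mono => //; exists u, w1; split=> //.
  exact: imul_subl aw1.
apply: iadd_subr; case: aw2 => v [Iv ->]; exists (mono I n v); split=> //.
by rewrite -monoM ?add1n //; apply: IX.
Qed.

(** Three statements advance together: regularity of [i] initial forms and [layers i] exclude
    failures at [i]; this gives the next intersection property and the next regular form, and the
    intersection property gives the next kernel. *)
Lemma valabrega_valla n : isub (icap (generated_by xs) (I ^i n.+1))
  (generated_by xs *i I ^i n).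
Proof.
suff h i : (i <= k)%N -> [/\ vv i, layers i &
    regular_mod (rees_max I m) (rees_shift I) i (take i xt)].
  by have [hv _ _] := h k (leqnn _); have := hv n; rewrite take_size.
elim: i => [|i IH] ik.
  split.
  - move=> j u [+ _]; rewrite take0 gen_nil => ->; exact: ideal0.
  - by rewrite /layers !take0 !gen_nil rees_ker0 iadd0.
  - by [].
have [hv hl hr] := IH (ltnW ik).
have nf := no_failure ik hl hr.
have hv1 := vv_step ik nf hv.
split=> //; first exact: layers_step.
have sz : size (take i.+1 xt) = i.+1 by rewrite size_takel // size_map.
split; first by rewrite sz.
move=> j hj; rewrite (take_takel _ (ltnW hj)) nth_take //.
move: hj; rewrite ltnS leq_eqVlt => /orP[/eqP ->|ji].
  rewrite nth_xt // -hl; split; last exact: no_failure_nzd.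
  rewrite /rees_max /= monoE; last exact: IX.
  by rewrite coefZ coefXn /= mulr0; apply: ideal0.
have [_ h] := hr; have := h j ji.
by rewrite (take_takel _ (ltnW ji)) nth_take.
Qed.

End ValabregaValla.

(** * The theorem *)

Lemma maximal_prime (R : comPzRingType) (m : ideal R) : maximal_ideal m -> prime_ideal m.
Proof.
move=> [m1 mmax]; split=> // x y mxy; have [mx|nmx] := pselect (m x); [by left|right].
have [[b [_ [mb [v [_ ->]] e]]]|n1] := pselect (iadd m (iprin x) 1).
  have -> : y = b * y + v * (x * y) by rewrite -{1}(mul1r y) e; ring.
  by apply: idealD; [exact: ideal_mulr | exact: idealM].
case: nmx; rewrite -(mmax _ n1); last exact: iadd_subl.
by apply: iadd_subr; apply: iprin_mem.
Qed.

(** Let [y] be the last entry of [s] and [a] the ideal of the others. If [y f] is in [a] and [f] is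
    not, some multiple of [f] is a nonzero socle element modulo [a], so by [regular_size_le] no
    regular sequence in [m] has [k + 1] entries. If [y] is regular, [s] is such a sequence, and
    [regular_prime_chain] excludes longer ones. *)
Lemma cohen_macaulay_nzd (R : comPzRingType) (m : ideal R) (s : seq R) k N :
  noetherian R -> maximal_ideal m -> krull_dim R k.+1 -> size s = k.+1 ->
  (forall i, (i < k)%N -> nzd (generated_by (take i s)) (nth 0 s i)) ->
  isub (generated_by s) m -> isub (m ^i N) (generated_by s) ->
  (nzd (generated_by (take k s)) (nth 0 s k) <-> cohen_macaulay m).
Proof.
move=> noeth mmax kd sz reg sm mN; have [m1 _] := mmax.
have mem i : (i < k.+1)%N -> m (nth 0 s i).
  by move=> hi; apply: sm; apply: gen_mem; apply: mem_nth; rewrite sz.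
split=> [hy|[n [[kd1 kd2] [[zs [/regular_sequenceP [rzs _] zsm szs]] _]]]].
  exists k.+1; split=> //; split.
    exists s; split; [|by move=> x xs; apply: sm; apply: gen_mem|by rewrite sz].
    apply/regular_sequenceP; split; last by move/sm.
    move=> i; rewrite sz ltnS leq_eqVlt => /orP[/eqP ->//|]; exact: reg.
  move=> [zs [/regular_sequenceP [rzs _] zsm szs]].
  have hz i : (i < k.+2)%N -> nzd (generated_by (take i zs)) (nth 0 zs i).
    by move=> hi; apply: rzs; apply: leq_trans szs.
  have zm : isub (generated_by (take k.+2 zs)) m.
    by apply: generated_min => x /mem_take; apply: zsm.
  have [J [h1 h2 _]] := regular_prime_chain noeth szs hz (maximal_prime mmax) zm.
  have [_ /(_ k.+2)] := kd; rewrite ltnn => hno.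
  by have : false by apply: hno; exists J.
have nk : n = k.+1.
  by case: kd => kd3 kd4; apply/eqP; rewrite eqn_leq kd4 //= kd2.
subst n; move=> f ayf; apply: contrapT => naf.
have [|c [nc hc]] := @soc_of_nilpotent _ m (generated_by (take k s)) f N naf.
  apply: isub_trans mN _.
  have -> : generated_by s = iadd (generated_by (take k s)) (iprin (nth 0 s k)).
    by rewrite -gen_take ?sz // take_oversize // sz.
  apply: iadd_min; first by move=> r hr; rewrite icolonE; apply: idealM.
  by apply: iprin_min; rewrite icolonE mulrC; exact: ayf.
have sk : size (take k s) = k by rewrite size_takel // sz.
have := @regular_size_le _ noeth m izero (take k s) zs.
rewrite sk leqNgt szs iaddC iadd0; apply: (fun P Q => P Q) => h.
suff : ~~ true by [].
apply: h.
- split; first by rewrite sk.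
  move=> i ik; rewrite iaddC iadd0 take_takel ?nth_take // ?(ltnW ik) //.
  by split; [apply: mem; apply: ltnW | apply: reg].
- by exists (c * f).
- split=> // i hi; rewrite iaddC iadd0; split; last exact: rzs.
  by apply: zsm; apply: mem_nth.
Qed.

(** Representatives in the Rees algebra of a regular sequence of [G(I)] are regular modulo the ideal
    defining [G(I)], which is the form needed for the socle argument. *)
Lemma regular_lift (R : comNzRingType) (m I : ideal R) k : isub I m ->
  depth_ge (graded_max I m) k -> exists zs : seq (rees I),
    regular_mod (rees_max I m) (rees_shift I) (size zs) zs /\ (k <= size zs)%N.
Proof.
move=> Im [s [/regular_sequenceP [rs _] sm ks]].
pose B := rees_shift I; pose zs := [seq @quo_repr _ B z | z <- s].
have sz : size zs = size s by rewrite size_map.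
have gen i : ipre (generated_by (take i s)) = iadd B (generated_by (take i zs)).
  rewrite -(quo_ipre (generated_by (take i s))) ipre_quo.
  rewrite iaddC; apply: isub_anti.
    apply: iadd_min; first exact: iadd_subl.
    have h : isub (generated_by (take i s)) (quo_ideal B (generated_by (take i zs))).
      apply: generated_min => z zi; apply: sub_generated.
      exists (quo_repr z); last exact: quo_piK.
      by apply: gen_mem; rewrite -map_take; apply: map_f.
    by move=> p /h /quo_idealP; rewrite iaddC.
  apply: iaddS => //; apply: generated_min => p.
  rewrite /mkset -map_take => /mapP [z zi ->]; rewrite ipreE quo_piK.
  exact: gen_mem.
exists zs; rewrite sz; split=> //; split; first by rewrite sz.
move=> i hi; rewrite (nth_map 0) //; set z := nth 0 s i.
split.
  have : graded_max I m z by apply: sm; apply: mem_nth.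
  rewrite graded_maxE -{1}(quo_piK z) => /quo_idealP [p [q [mp Bq ->]]].
  apply: idealD => //; have := Bq 0%N; rewrite iexp1; exact: Im.
move=> p; rewrite -gen !ipreE rmorphM /= quo_piK => h.
by apply: (rs i hi).
Qed.

Theorem lemma4p5 (R : comNzRingType) (m I : ideal R) (d : nat)
    (x : d.-tuple R) (eI eQ : nat -> int) :
  let Q := generated_by x in
  let a := generated_by (take d.-1 x) in
  let I' := quo_ideal a I in
  let Q' := quo_ideal a Q in
  let B := sectional_genus I eI - sectional_genus Q eQ
           - (eI 0%N - eQ 1%N) * eQ 1%N in
  noetherian R ->
  local_ring m ->
  krull_dim R d ->
  (1 <= d)%N ->
  infinite_set [set: quo_ring m] ->
  depth_ge m d.-1 ->
  is_primary_to m I ->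
  superficial_sequence I x ->
  minimal_reduction Q I ->
  regular_sequence (take d.-1 x) ->
  hilbert_coefs d I eI ->
  hilbert_coefs d Q eQ ->
  (exists s : int,
     [/\ series1_eq (fun n => length (I' ^i n.+1) (Q' *i (I' ^i n))) s,
         s <= B &
         s = B <-> cohen_macaulay m]) /\
  (depth_ge (graded_max I m) d.-1 ->
   forall r : nat, is_reduction_number Q I r -> r%:Z <= B + 1).
Proof.
case: d x => [|k] x Q a I' Q' B noeth [mmax _] kd // _ _ _ [_ radI] sup.
move=> [[QI [r0 /ideal_set_inj red]] _] /regular_sequenceP [reg _].
move=> /hilbert_coefs_hil hI /hilbert_coefs_hil hQ.
have sx : size x = k.+1 by rewrite size_tuple.
pose xs := take k x; pose y := nth 0 x k.
have sxs : size xs = k by rewrite size_takel // sx.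
have QE : Q = iadd (generated_by xs) (iprin y).
  by rewrite -gen_take ?sx // take_oversize // sx.
have Im : isub I m.
  by move=> z Iz; rewrite -radI; exists 1%N; rewrite expr1.
have [N mN] : exists N, isub (m ^i N) I.
  by apply: (iexp_sub_of_radical noeth) => z; rewrite -radI.
have tk i : (i < k)%N -> take i xs = take i x /\ nth 0 xs i = nth 0 x i.
  by move=> ik; rewrite /xs take_takel ?nth_take // ltnW.
have reg' i : (i < size xs)%N -> nzd (generated_by (take i xs)) (nth 0 xs i).
  exact: reg.
have sup' i : (i < size xs)%N -> superf I (generated_by (take i xs)) (nth 0 xs i).
  rewrite sxs => ik; have [-> ->] := tk i ik; apply: superficial_quo; apply: sup.
  by rewrite sx ltnW.
have QI' : isub (iadd (generated_by xs) (iprin y)) I by rewrite -QE.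
have red' : iadd (generated_by xs) (iprin y) *i (I ^i r0) = I ^i r0.+1 by rewrite -QE.
have hI' : hil I izero (size xs).+1 eI by rewrite sxs.
have hQ' : hil (iadd (generated_by xs) (iprin y)) izero (size xs).+1 eQ.
  by rewrite -QE sxs.
have [fv [S [[n0 hS] SB SE]]] := core_bound noeth QI' red' reg' sup' hI' hQ'.
rewrite -QE -/a in fv hS SB SE.
set B' := (X in S%:Z <= X) in SB SE.
have BB : B = B'.
  have fI := fin_In hI' 1; rewrite iexp1 in fI.
  have fQ := fin_Qn red' hI' 1; rewrite iexp1 -QE in fQ.
  by rewrite /B /B' /sectional_genus !length_len.
have lv n : length (I' ^i n.+1) (Q' *i (I' ^i n)) =
    (len (iadd (I ^i n.+1) a) (iadd (Q *i I ^i n) a))%:Z%:E.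
  rewrite /I' /Q' -!quo_ideal_exp -quo_ideal_mul length_quo !ipre_quo //.
have mQ : isub (m ^i (N * r0.+1)) Q.
  rewrite iexpM; apply: isub_trans (iexpSub mN) _; rewrite -red; exact: imul_subl.
split.
  exists S%:Z; split; [|by rewrite BB|].
    exists n0 => j /hS <-; rewrite -sum_EFin; apply: eq_bigr => n _; exact: lv.
  rewrite BB SE; apply: (cohen_macaulay_nzd noeth mmax kd sx _ _ mQ).
    by move=> i ik; have := reg' i; rewrite sxs => /(_ ik); have [-> ->] := tk i ik.
  by move=> z /QI /Im.
move=> /(regular_lift Im) [zs [zr zk]] r [_ rmin].
have [n1 large] : exists n1, forall i, (i < size xs)%N -> forall n, (n1 <= n)%N ->
    icolon (iadd (I ^i n.+1) (generated_by (take i xs))) (nth 0 xs i) =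
    iadd (I ^i n) (generated_by (take i xs)).
  suff : forall j, (j <= size xs)%N -> exists n1, forall i, (i < j)%N ->
      forall n, (n1 <= n)%N ->
      icolon (iadd (I ^i n.+1) (generated_by (take i xs))) (nth 0 xs i) =
      iadd (I ^i n) (generated_by (take i xs)) by apply.
  elim=> [|j IH] hj; first by exists 0%N.
  have [n1 h1] := IH (ltnW hj).
  have [|n2 h2] := superf_colon noeth (reg' j hj) _ (sup' j hj).
    by apply: QI'; apply: iadd_subl; apply: gen_mem; apply: mem_nth.
  exists (maxn n1 n2) => i; rewrite ltnS leq_eqVlt => /orP[/eqP ->|ij] n.
    by rewrite geq_max => /andP[_]; apply: h2.
  by rewrite geq_max => /andP[hn _]; apply: h1.
have xsI i : (i < size xs)%N -> I (nth 0 xs i).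
  by move=> ik; apply: QI'; apply: iadd_subl; apply: gen_mem; apply: mem_nth.
have zk' : (size xs <= size zs)%N by rewrite sxs.
have vv := valabrega_valla noeth mN xsI large zr zk'.
(* If the length vanishes, [I^(n+1)] lies in [Q I^n + a]; the summand in [a] is in [a cap I^(n+1)],
   hence in [a I^n], so [Q I^n = I^(n+1)] and [r <= n]. *)
have v_gt0 n : (n < r)%N -> (0 < len (iadd (I ^i n.+1) a) (iadd (Q *i I ^i n) a))%N.
  rewrite lt0n; apply: contraL => /eqP /(len_eq0 (fv n)) e; rewrite -leqNgt.
  apply: rmin; congr ideal_set; apply: isub_anti.
    by rewrite iexpS; apply: imulS.
  move=> w Iw; have : iadd (I ^i n.+1) a w by apply: iadd_subl.
  rewrite e => -[q [b [Qq ab wE]]]; rewrite wE; apply: idealD => //.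
  suff h : isub (generated_by xs *i I ^i n) (Q *i I ^i n).
    apply/h/vv; split=> //; have -> : b = w - q by rewrite wE; ring.
    by apply: idealB => //; move: q Qq {wE}; rewrite iexpS; apply: imulS.
  by apply: imulS => //; rewrite QE; apply: iadd_subl.
(* There are [r - 1] indices [n] with [1 <= n < r], whence the added 1; [r = 0] is treated apart. *)
have rS : (r <= S.+1)%N.
  have := hS (maxn n0 r) (leq_maxl _ _) => <-.
  case: (posnP r) => [->//|r_gt0].
  rewrite (big_cat_nat r_gt0 (leq_maxr _ _)) /= -addSn; apply: leq_trans (leq_addr _ _).
  have {1}-> : r = (\sum_(1 <= n < r) 1).+1 by rewrite sum_nat_const_nat muln1 subnSK ?subn0.
  rewrite ltnS big_nat_cond [X in (_ <= X)%N]big_nat_cond.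
  by apply: leq_sum => n /andP[/andP[_ nr] _]; apply: v_gt0.
rewrite BB; apply: le_trans (_ : S%:Z + 1 <= _); last by rewrite lerD2r.
by rewrite -PoszD lez_nat addn1.
Qed.
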